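(* Let $Q$ be a bipartite quiver with source vertices $Q_0^+=\{v_1,\dots,v_n\}$ and sink vertices $Q_0^-=\{w_1,\dots,w_m\}$, let $\mathbf d\in\mathbb N^{Q_0}$ be a dimension vector of $Q$, and let $\sigma\in\mathbb Z^{Q_0}$ be an integral weight with $\sigma\cdot\mathbf d=0$. Assume that $\sigma$ is positive on $Q_0^+$ and negative on $Q_0^-$. (1) For a $\sigma$-semi-stable representation $V\in\operatorname{rep}(Q,\mathbf d)$, let $$\mathcal G_\sigma(V):=\{A\in\operatorname{GL}(\mathbf d) : (A\cdot V,\sigma)\text{ is a geometric datum}\}.$$ Then $\mathcal G_\sigma(V)\neq\emptyset$ if and only if $V$ is $\sigma$-polystable. (2) Let $V\in\operatorname{rep}(Q,\mathbf d)$ be $\sigma$-semi-stable. Then there exists a $\sigma$-polystable representation $\widetilde V\in\operatorname{rep}(Q,\mathbf d)$ such that $\widetilde V\in\overline{\operatorname{GL}(\mathbf d)_\sigma V}$. Furthermore, for any such $\widetilde V$, $$\mathbf D_Q(V,\sigma)=\mathbf D_Q(\widetilde V,\sigma)=\chi_\sigma(A)^2\qquad\text{for all }A\in\mathcal G_\sigma(\widetilde V).$$ (3) Let $V\in\operatorname{rep}(Q,\mathbf d)$ be a representation such that $$V(a)=\begin{pmatrix}V_1(a)&X(a)\\0&V_2(a)\end{pmatrix}\quad\text{for all }a\in Q_1,$$ where $V_i\in\operatorname{rep}(Q,\mathbf d_i)$, $i\in\{1,2\}$, are representations of $Q$ (so $\mathbf d=\mathbf d_1+\mathbf d_2$) and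 $X(a)\in\mathbb R^{\mathbf d_1(ha)\times\mathbf d_2(ta)}$ for all $a\in Q_1$. If $\sigma\cdot\mathbf{dim}\,V_1=0$, then $$\mathbf D_Q(V,\sigma)=\mathbf D_Q(V_1,\sigma)\cdot\mathbf D_Q(V_2,\sigma).$$ (4) Let $V\in\operatorname{rep}(Q,\mathbf d)$ with $\mathbf D_Q(V,\sigma)>0$. Then $(V,\sigma)$ is gaussian-extremisable if and only if $V$ is $\sigma$-polystable. If this is the case, then the gaussian extremisers of $(V,\sigma)$ are exactly the $m$-tuples of matrices $(A(w_j)^T\cdot A(w_j))_{j\in[m]}$ with $A\in\mathcal G_\sigma(V)$. (5) Let $V\in\operatorname{rep}(Q,\mathbf d)$ with $\mathbf D_Q(V,\sigma)>0$. If $(V,\sigma)$ has unique gaussian extremisers (up to scaling), then $V$ is $\sigma$-stable. Conversely, if $V$ is $\sigma$-stable and its space of endomorphisms $\operatorname{End}_Q(V)$ is one-dimensional over $\mathbb R$, then $(V,\sigma)$ has unique gaussian extremisers (up to scaling).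
   Context: A quiver $Q=(Q_0,Q_1,t,h)$ has finite sets $Q_0$ of vertices and $Q_1$ of arrows, and tail and head maps $t,h:Q_1\to Q_0$; quivers are assumed connected. $Q$ is bipartite if $Q_0$ is the disjoint union of $Q_0^+=\{v_1,\dots,v_n\}$ and $Q_0^-=\{w_1,\dots,w_m\}$ and every arrow goes from $Q_0^+$ to $Q_0^-$. $\mathcal A_{i,j}$ is the set of arrows from $v_i$ to $w_j$. $\mathbb N=\{0,1,\dots\}$ and $[L]=\{1,\dots,L\}$. For $\theta,\beta\in\mathbb R^{Q_0}$, $\theta\cdot\beta=\sum_{x\in Q_0}\theta(x)\beta(x)$. A (real) representation $V$ of $Q$ consists of finite-dimensional real vector spaces $V(x)$, $x\in Q_0$, and linear maps $V(a):V(ta)\to V(ha)$, $a\in Q_1$; $\mathbf{dim}\,V=(\dim_{\mathbb R}V(x))_{x\in Q_0}$. A subrepresentation $V'\le V$ is given by subspaces $V'(x)\le V(x)$ with $V(a)(V'(ta))\subseteq V'(ha)$ for all $a$, with the restricted maps. An endomorphism of $V$ is a family of linear maps $\phi(x):V(x)\to V(x)$ with $\phi(ha)V(a)=V(a)\phi(ta)$ for all $a$. $\operatorname{rep}(Q,\mathbf d)=\prod_{a\in Q_1}\mathbb R^{\mathbf d(ha)\times\mathbf d(ta)}$. The group $\operatorname{GL}(\mathbf d)=\prod_{x\in Q_0}\operatorname{GL}(\mathbf d(x),\mathbb R)$ acts on it by $(A\cdot V)(a)=A(ha)V(a)A(ta)^{-1}$. The character induced by $\sigma$ is $\chi_\sigma:\operatorname{GL}(\mathbf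 d)\to\mathbb R^\times$, $\chi_\sigma(A)=\prod_{x\in Q_0}\det(A(x))^{\sigma(x)}$, and $\operatorname{GL}(\mathbf d)_\sigma=\ker\chi_\sigma$. Closures are taken in the Euclidean topology. $V$ is $\sigma$-semi-stable if $\sigma\cdot\mathbf{dim}\,V=0$ and $\sigma\cdot\mathbf{dim}\,V'\le0$ for all subrepresentations $V'\le V$; it is $\sigma$-stable if $\sigma\cdot\mathbf{dim}\,V=0$ and $\sigma\cdot\mathbf{dim}\,V'<0$ for all subrepresentations $0\ne V'\lneq V$; it is $\sigma$-polystable if it is (isomorphic to) a finite direct sum of $\sigma$-stable representations. Capacity. Put $\sigma_+(v_i)=\sigma(v_i)$, $\sigma_-(w_j)=-\sigma(w_j)$, $N=\sum_{i=1}^n\sigma_+(v_i)\mathbf d(v_i)=\sum_{j=1}^m\sigma_-(w_j)\mathbf d(w_j)$, $M=\sum_j\sigma_-(w_j)$, $M'=\sum_i\sigma_+(v_i)$, $\mathcal I_j^-=\{q\in\mathbb Z:\sum_{k=1}^{j-1}\sigma_-(w_k)<q\le\sum_{k=1}^{j}\sigma_-(w_k)\}$ and $\mathcal I_i^+=\{r\in\mathbb Z:\sum_{k=1}^{i-1}\sigma_+(v_k)<r\le\sum_{k=1}^{i}\sigma_+(v_k)\}$. View $N\times N$ matrices as $M\times M'$ block matrices in which, for $q\in\mathcal I_j^-$ and $r\in\mathcal I_i^+$, the $(q,r)$ block has size $\mathbf d(w_j)\times\mathbf d(v_i)$. For $i\in[n]$, $j\in[m]$, $a\in\mathcal A_{i,j}$,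 $q\in\mathcal I_j^-$, $r\in\mathcal I_i^+$, let $V^{i,j,a}_{q,r}$ be the $N\times N$ matrix whose $(q,r)$ block is $V(a)$ and whose other blocks are zero. The Brascamp-Lieb operator is $$T_{V,\sigma}:\mathbb R^{N\times N}\to\mathbb R^{N\times N},\qquad T_{V,\sigma}(X)=\sum_{(i,j,a,q,r)}(V^{i,j,a}_{q,r})^T\,X\,V^{i,j,a}_{q,r},$$ and the capacity is $\mathbf D_Q(V,\sigma)=\inf\{\det(T_{V,\sigma}(X)) : X\in\mathcal S_N^+,\ \det X=1\}$, where $\mathcal S^+_d$ is the set of $d\times d$ symmetric positive definite real matrices. (The same definition is used for $V_1,V_2$ with dimension vectors $\mathbf d_1,\mathbf d_2$, which are both orthogonal to $\sigma$ in (3).) Geometric datum. $(V,\sigma)$ is geometric if $T_{V,\sigma}$ is doubly stochastic ($T_{V,\sigma}(\mathbf I)=T_{V,\sigma}^*(\mathbf I)=\mathbf I$), equivalently $$\sum_{j=1}^m\sigma_-(w_j)\sum_{a\in\mathcal A_{i,j}}V(a)^TV(a)=\mathbf I_{\mathbf d(v_i)}\ \ \forall i\in[n],\qquad \sum_{i=1}^n\sigma_+(v_i)\sum_{a\in\mathcal A_{i,j}}V(a)V(a)^T=\mathbf I_{\mathbf d(w_j)}\ \ \forall j\in[m].$$ Gaussian extremisers. For $Y=(Y_1,\dots,Y_m)$ with $Y_j\in\mathcal S^+_{\mathbf d(w_j)}$ put $$\mathbf D_Q(V,\sigma;Y)=\frac{\prod_{i=1}^n\det\Big(\sum_{j=1}^m\sigma_-(w_j)\sum_{a\in\mathcal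 A_{i,j}}V(a)^TY_jV(a)\Big)^{\sigma_+(v_i)}}{\prod_{j=1}^m\det(Y_j)^{\sigma_-(w_j)}}.$$ When $\mathbf D_Q(V,\sigma)>0$, $(V,\sigma)$ is gaussian-extremisable if there is such a $Y$ with $\mathbf D_Q(V,\sigma)=\mathbf D_Q(V,\sigma;Y)$; any such $Y$ is a gaussian extremiser for $(V,\sigma)$. ''Unique gaussian extremisers (up to scaling)'' means that gaussian extremisers exist and any two of them $Y,Y'$ satisfy $Y'=cY$ (i.e. $Y'_j=cY_j$ for all $j$) for some scalar $c>0$. *)

(* Defs.v *)
From HB Require Import structures.
From mathcomp Require Import all_boot all_order all_algebra.
From mathcomp Require Import all_classical all_reals all_analysis.

Set Implicit Arguments.
Unset Strict Implicit.
Unset Printing Implicit Defensive.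

Import Order.TTheory GRing.Theory Num.Theory.
Import numFieldNormedType.Exports.
Local Open Scope classical_set_scope.
Local Open Scope ring_scope.

Record quiver := Quiver {
  vertex : finType;
  arrow : finType;
  tl : arrow -> vertex;
  hd : arrow -> vertex }.

Definition adjacent (Q : quiver) : rel (vertex Q) := fun x y =>
  [exists a : arrow Q, ((tl a == x) && (hd a == y)) || ((tl a == y) && (hd a == x))].

Definition quiver_connected (Q : quiver) : Prop :=
  forall x y : vertex Q, connect (@adjacent Q) x y.

Section Representations.
Context (R : realType) (Q : quiver).
Implicit Types (d e : vertex Q -> nat) (s : vertex Q -> int).

Definition pairing s d : int := \sum_(x : vertex Q) s x * (d x)%:Z.

(* V a acts on column vectors.  As a library product space, rep d carries the
   product of the norm topologies of the matrix spaces, i.e. the Euclidean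
   topology. *)
Definition rep d : Type :=
  prod_topology (fun a : arrow Q => 'M[R]_(d (hd a), d (tl a))).

Definition is_subrep d (V : rep d) (U : forall x, {vspace 'cV[R]_(d x)}) : Prop :=
  forall (a : arrow Q) (u : 'cV[R]_(d (tl a))),
    u \in U (tl a) -> V a *m u \in U (hd a).

Definition subdim d (U : forall x, {vspace 'cV[R]_(d x)}) : vertex Q -> nat :=
  fun x => \dim (U x).

Definition semistable s d (V : rep d) : Prop :=
  pairing s d = 0 /\
  forall U, is_subrep V U -> pairing s (subdim U) <= 0.

(* Nothing is required of the zero representation, so it counts as stable. *)
Definition stable s d (V : rep d) : Prop :=
  pairing s d = 0 /\
  forall U, is_subrep V U ->
    (exists x, U x != 0%VS) -> (exists x, U x != fullv) ->
    pairing s (subdim U) < 0.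

Definition is_hom d e (V : rep d) (W : rep e)
    (f : forall x, 'M[R]_(e x, d x)) : Prop :=
  forall a : arrow Q, f (hd a) *m V a = W a *m f (tl a).

Definition isomorphic d e (V : rep d) (W : rep e) : Prop :=
  exists (f : forall x, 'M[R]_(e x, d x)) (g : forall x, 'M[R]_(d x, e x)),
    [/\ is_hom V W f, forall x, g x *m f x = 1%:M & forall x, f x *m g x = 1%:M].

(* The dimension-vector component is packed so that direct sums can be iterated. *)
Definition some_rep : Type := {d : vertex Q -> nat & rep d}.

Definition zero_rep : some_rep := existT rep (fun _ => 0%N) (fun _ => 0).

Definition dsum (V W : some_rep) : some_rep :=
  existT rep (fun x => projT1 V x + projT1 W x)%N
    (fun a => block_mx (projT2 V a) 0 0 (projT2 W a)).

Definition polystable s d (V : rep d) : Prop :=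
  exists (k : nat) (W : 'I_k -> some_rep),
    (forall i, stable s (projT2 (W i))) /\
    isomorphic V (projT2 (\big[dsum/zero_rep]_(i < k) W i)).

(* dim End(V) = 1: End(V) has a basis consisting of a single element. *)
Definition one_dim_End d (V : rep d) : Prop :=
  exists f : forall x, 'M[R]_(d x),
    [/\ is_hom V V f, exists x, f x != 0 &
        forall g : forall x, 'M[R]_(d x), is_hom V V g ->
          exists c : R, forall x, g x = c *: f x].

Definition GL d (A : forall x, 'M[R]_(d x)) : Prop :=
  forall x, A x \in unitmx.

Definition act d (A : forall x, 'M[R]_(d x)) (V : rep d) : rep d :=
  fun a => A (hd a) *m V a *m invmx (A (tl a)).

Definition chi s d (A : forall x, 'M[R]_(d x)) : R :=
  \prod_(x : vertex Q) (\det (A x)) ^ (s x).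

Definition GL_ker_orbit s d (V : rep d) : set (rep d) :=
  [set act A V | A in [set A | GL A /\ chi s A = 1]].

Definition in_orbit_closure s d (V W : rep d) : Prop :=
  @closure (prod_topology (fun a : arrow Q => 'M[R]_(d (hd a), d (tl a))))
    (GL_ker_orbit s V) W.

End Representations.

Arguments rep R Q d : clear implicits.
Arguments pairing Q s d : clear implicits.
Arguments semistable {R} Q s {d} V.
Arguments stable {R} Q s {d} V.
Arguments polystable {R} Q s {d} V.
Arguments chi {R} Q s {d} A.
Arguments in_orbit_closure {R} Q s {d} V W.

(* A bipartite quiver with Q_0^+ = {v_i | i : 'I_n} and Q_0^- = {w_j | j : 'I_m};
   its vertex type is 'I_n + 'I_m, with v_i = inl i and w_j = inr j. *)
Record bipartite_quiver (n m : nat) := BipartiteQuiver {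
  barrow : finType;
  src : barrow -> 'I_n;
  snk : barrow -> 'I_m }.

Coercion quiver_of_bipartite n m (Q : bipartite_quiver n m) : quiver :=
  @Quiver ('I_n + 'I_m)%type (barrow Q)
    (fun a => inl (src a)) (fun a => inr (snk a)).

Definition arrows_between n m (Q : bipartite_quiver n m) (i : 'I_n) (j : 'I_m)
    : {set barrow Q} :=
  [set a | (src a == i) && (snk a == j)].

(* The interval of indices, numbered from 0, that belong to the i-th group when
   consecutive groups have sizes p 0, p 1, etc. *)
Definition block_interval n (p : 'I_n -> nat) (i : 'I_n) : {set 'I_(\sum_k p k)%N} :=
  [set q : 'I_(\sum_k p k)%N |
    (\sum_(k < n | (k < i)%N) p k <= q < \sum_(k < n | (k <= i)%N) p k)%N].

Lemma in_block_interval n (p : 'I_n -> nat) (i : 'I_n) (q : 'I_(\sum_k p k)%N) :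
  (q \in block_interval p i) = (tagnat.sig1 q == i).
Proof.
have le_sum (j1 j2 : 'I_n) : (j1 < j2)%N ->
    (\sum_(k < n | (k <= j1)%N) p k <= \sum_(k < n | (k < j2)%N) p k)%N.
  move=> lt12; rewrite [leqRHS](bigID [pred k : 'I_n | (k <= j1)%N])/=.
  rewrite [X in (_ <= X + _)%N](eq_bigl [pred k : 'I_n | (k <= j1)%N]) ?leq_addr//.
  move=> k /=; case: (leqP k j1); rewrite ?andbF// => lek.
  by rewrite (leq_ltn_trans lek).
have own : (\sum_(k < n | (k < tagnat.sig1 q)%N) p k <= q
            < \sum_(k < n | (k <= tagnat.sig1 q)%N) p k)%N.
  rewrite (tagnat.rect q) leq_addr /=.
  rewrite [ltnRHS](bigID [pred k : 'I_n | (k < tagnat.sig1 q)%N])/=.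
  rewrite [X in (_ < X + _)%N](eq_bigl (fun k : 'I_n => (k < tagnat.sig1 q)%N)); last first.
    by move=> k; case: ltngtP.
  rewrite ltn_add2l (bigD1 (tagnat.sig1 q)) ?leqnn ?ltnn //=.
  by rewrite (leq_trans (ltn_ord (tagnat.sig2 q))) ?leq_addr.
rewrite inE; apply/idP/eqP => [|<- //].
move: own => /andP[lo hi] /andP[lo' hi']; apply/val_inj/eqP => /=.
rewrite eqn_leq; apply/andP; split; rewrite leqNgt; apply/negP.
  by move=> /le_sum h; move: (leq_ltn_trans (leq_trans h lo) hi'); rewrite ltnn.
by move=> /le_sum h; move: (leq_ltn_trans (leq_trans h lo') hi); rewrite ltnn.
Qed.

Lemma sum_tagnat_sig1 n (p F : 'I_n -> nat) :
  (\sum_(q < \sum_k p k) F (tagnat.sig1 q) = \sum_(i < n) p i * F i)%N.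
Proof.
rewrite (reindex _ tagnat.rank_bij_on) /=.
rewrite (eq_bigr (fun x : {i & 'I_(p i)} => F (tag x))); last first.
  by move=> x _; rewrite tagnat.rankE tagnat.Rank1K.
rewrite -(sig_big_dep xpredT (fun _ => xpredT) (fun i _ => F i)) /=.
by apply: eq_bigr => i _; rewrite sum_nat_const card_ord.
Qed.

Definition posdef (R : realType) k (X : 'M[R]_k) : Prop :=
  X^T = X /\ forall u : 'cV[R]_k, u != 0 -> 0 < (u^T *m X *m u) 0 0.

Section BrascampLieb.
Context (R : realType) (n m : nat) (Q : bipartite_quiver n m).
Context (s : 'I_n + 'I_m -> int).
Implicit Type d : 'I_n + 'I_m -> nat.

(* s is assumed positive on the v_i and negative on the w_j, so the absolute
   values are s (v_i) and - s (w_j) respectively. *)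
Definition sigma_pos (i : 'I_n) : nat := `|s (inl i)|%N.
Definition sigma_neg (j : 'I_m) : nat := `|s (inr j)|%N.

(* q : block_row is a block row index, q = 1, ..., M shifted to start at 0; by
   in_block_interval, tagnat.sig1 q is the j such that q lies in the j-th interval.
   Similarly for block columns. *)
Definition block_row := 'I_(\sum_(j < m) sigma_neg j)%N.
Definition block_col := 'I_(\sum_(i < n) sigma_pos i)%N.

Definition row_dim d (q : block_row) : nat := d (inr (tagnat.sig1 q)).
Definition col_dim d (r : block_col) : nat := d (inl (tagnat.sig1 r)).

(* Both total sizes are the integer N when pairing s d = 0, see total_row_dimE,
   total_col_dimE and total_dim_eq, but they are not convertible. *)
Definition total_row_dim d : nat := (\sum_(q : block_row) row_dim d q)%N.
Definition total_col_dim d : nat := (\sum_(r : block_col) col_dim d r)%N.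

(* V a itself, for a from v_i to w_j: conform_mx only transports V a along the
   equalities src a = i and snk a = j, and is used for such a only. *)
Definition arrow_mx d (V : rep R Q d) (i : 'I_n) (j : 'I_m) (a : barrow Q)
    : 'M[R]_(d (inr j), d (inl i)) :=
  conform_mx 0 (V a).

Definition bl_kraus d (V : rep R Q d) (a : barrow Q) (q : block_row) (r : block_col)
    : 'M[R]_(total_row_dim d, total_col_dim d) :=
  \mxblock_(q' < _, r' < _)
    (if (q' == q) && (r' == r)
     then arrow_mx V (tagnat.sig1 r') (tagnat.sig1 q') a else 0).

Definition bl_op d (V : rep R Q d) (X : 'M[R]_(total_row_dim d))
    : 'M[R]_(total_col_dim d) :=
  \sum_(i < n) \sum_(j < m) \sum_(a in arrows_between Q i j)
  \sum_(q in block_interval sigma_neg j) \sum_(r in block_interval sigma_pos i)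
    (bl_kraus V a q r)^T *m X *m bl_kraus V a q r.

(* The adjoint for the trace inner product, see bl_op_adjE. *)
Definition bl_op_adj d (V : rep R Q d) (Y : 'M[R]_(total_col_dim d))
    : 'M[R]_(total_row_dim d) :=
  \sum_(i < n) \sum_(j < m) \sum_(a in arrows_between Q i j)
  \sum_(q in block_interval sigma_neg j) \sum_(r in block_interval sigma_pos i)
    bl_kraus V a q r *m Y *m (bl_kraus V a q r)^T.

Definition capacity d (V : rep R Q d) : R :=
  inf [set \det (bl_op V X) |
        X in [set X : 'M[R]_(total_row_dim d) | posdef X /\ \det X = 1]].

Definition geometric d (V : rep R Q d) : Prop :=
  bl_op V 1%:M = 1%:M /\ bl_op_adj V 1%:M = 1%:M.

Definition geometrizing d (V : rep R Q d)
    (A : forall x : vertex Q, 'M[R]_(d x)) : Prop :=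
  GL A /\ geometric (act A V).

Definition gaussian_ratio d (V : rep R Q d)
    (Y : forall j : 'I_m, 'M[R]_(d (inr j))) : R :=
  (\prod_(i < n)
     (\det (\sum_(j < m) (sigma_neg j)%:R *:
              \sum_(a in arrows_between Q i j)
                (arrow_mx V i j a)^T *m Y j *m arrow_mx V i j a)) ^+ sigma_pos i)
  / \prod_(j < m) (\det (Y j)) ^+ sigma_neg j.

Definition gaussian_extremiser d (V : rep R Q d)
    (Y : forall j : 'I_m, 'M[R]_(d (inr j))) : Prop :=
  (forall j, posdef (Y j)) /\ capacity V = gaussian_ratio V Y.

Definition gaussian_extremisable d (V : rep R Q d) : Prop :=
  exists Y, gaussian_extremiser V Y.

Definition unique_gaussian_extremisers d (V : rep R Q d) : Prop :=
  gaussian_extremisable V /\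
  forall Y Y', gaussian_extremiser V Y -> gaussian_extremiser V Y' ->
    exists c : R, 0 < c /\ forall j, Y' j = c *: Y j.

Lemma bl_op_adjE d (V : rep R Q d) X Y :
  \tr ((bl_op V X)^T *m Y) = \tr (X^T *m bl_op_adj V Y).
Proof.
rewrite /bl_op /bl_op_adj.
do 5!(rewrite raddf_sum mulmx_suml mulmx_sumr !raddf_sum;
      apply: eq_bigr => ? _).
by rewrite /= !trmx_mul trmxK -!mulmxA mxtrace_mulC -!mulmxA.
Qed.

Lemma total_row_dimE d :
  total_row_dim d = (\sum_(j < m) sigma_neg j * d (inr j))%N.
Proof. exact: sum_tagnat_sig1 (fun j => d (inr j)). Qed.

Lemma total_col_dimE d :
  total_col_dim d = (\sum_(i < n) sigma_pos i * d (inl i))%N.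
Proof. exact: sum_tagnat_sig1 (fun i => d (inl i)). Qed.

Lemma total_dim_eq d :
  (forall i, 0 < s (inl i)) -> (forall j, s (inr j) < 0) ->
  pairing Q s d = 0 -> total_row_dim d = total_col_dim d.
Proof.
move=> s_pos s_neg; rewrite /pairing big_sumType /= => /eqP.
rewrite addr_eq0 -sumrN => /eqP sd0; apply/eqP; rewrite -eqz_nat.
rewrite total_row_dimE total_col_dimE !(big_morph Posz PoszD erefl); apply/eqP.
transitivity (\sum_(j < m) - (s (inr j) * (d (inr j))%:Z)).
  apply: eq_bigr => j _; rewrite PoszM -mulNr; congr (_ * _).
  by rewrite /sigma_neg abszE ltr0_norm.
rewrite -sd0; apply: eq_bigr => i _; rewrite PoszM; congr (_ * _).
by rewrite /sigma_pos abszE gtr0_norm.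
Qed.

End BrascampLieb.

(* Main.v *)
Require Import Defs.
From HB Require Import structures.
From mathcomp Require Import all_boot all_order all_algebra.
From mathcomp Require Import all_classical all_reals all_analysis.
From mathcomp Require complex.
Import (canonicals) complex.
From mathcomp Require Import ring lra.

(* The capacity is the infimum of the gaussian ratios [gaussian_ratio s V Y]: replacing a
   positive definite X by the block diagonal matrix whose blocks are averages of its diagonal
   blocks does not change T(X) and, by AM-GM, does not decrease det X.

   If V is geometric, all its gaussian ratios are at least 1, and the ratio is 1 at the
   identity. Indeed, in eigenbases of the Y_j and of the sums
   sum_j s_-(w_j) sum_a V(a)^T Y_j V(a), the squared entries of the V(a) form a doubly
   stochastic array, so this is a weighted AM-GM inequality; its equality case makes Y an
   endomorphism, and its stability under small perturbations of V gives continuity of the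
   capacity at geometric data, hence (2). A subrepresentation U of a geometric V satisfies
   s(U) <= 0, and if s(U) = 0 the orthogonal projection onto U is an endomorphism, so that
   V splits: geometric data are polystable.

   Conversely, let V be semi-stable. The weighted norm
   sum_a s_+ s_- |V(a)|^2 stays away from 0 on the orbit of ker chi: otherwise the limits of
   the eigenspaces of A^T A would yield a subrepresentation of positive weight, by a
   Hilbert-Mumford argument. A vector of minimal norm in the orbit closure is then
   geometric up to scaling (Kempf-Ness). If V is stable, a normalised limit of the group
   elements is a nonzero homomorphism from V to that vector, hence an isomorphism.

   All limits are taken along ultrafilters, so that bounded families converge. *)

Set Implicit Arguments.
Unset Strict Implicit.
Unset Printing Implicit Defensive.

Import Order.TTheory GRing.Theory Num.Theory.
Import numFieldNormedType.Exports.
Local Open Scope classical_set_scope.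
Local Open Scope ring_scope.

(** * Symmetric matrices *)

(** The capacity is an infimum of ratios that are continuous in V, so only its upper semicontinuity
    is automatic. The obstacle in (2) is a lower bound uniform in Y, which ranges over a non-compact
    cone. In [ratio_frame_ge] the eigenvalues of Y cancel, because the weights of the geometric
    limit are doubly stochastic; the error that remains depends on the eigenframes alone, and these
    live in compact orthogonal groups. Both optimality arguments, for extremisers and for minimal
    vectors, avoid derivatives: in [matrix_opt] a trace inequality, tested on tuples whose weighted
    product of determinants is 1, forces the identity. The weights [s_+ s_-] in the norm are those
    for which moving the sources alone, or the sinks alone, produces exactly [gram] or [cogram], the
    two halves of the geometric condition. *)

Section SymmetricMatrices.
Context {R : realType}.

Lemma trmxZ m n a (A : 'M[R]_(m, n)) : (a *: A)^T = a *: A^T.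
Proof. by apply/matrixP => i j; rewrite !mxE. Qed.

Lemma trmxB m n (A B : 'M[R]_(m, n)) : (A - B)^T = A^T - B^T.
Proof. by apply/matrixP => i j; rewrite !mxE. Qed.

Lemma trmxD m n (A B : 'M[R]_(m, n)) : (A + B)^T = A^T + B^T.
Proof. by apply/matrixP => i j; rewrite !mxE. Qed.

Lemma invmx_uniq n (A B : 'M[R]_n) : A *m B = 1%:M -> invmx A = B.
Proof.
by move=> AB; have [Au _] := mulmx1_unit AB; rewrite -[LHS]mulmx1 -AB mulKmx.
Qed.

Lemma sqnorm_ge0 n (u : 'cV[R]_n) : 0 <= (u^T *m u) 0 0.
Proof. by rewrite mxE sumr_ge0 // => i _; rewrite mxE -expr2 sqr_ge0. Qed.

Lemma sqnorm_eq0 n (u : 'cV[R]_n) : ((u^T *m u) 0 0 == 0) = (u == 0).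
Proof.
apply/eqP/eqP => [|->]; last by rewrite mulmx0 mxE.
rewrite mxE => /eqP; rewrite psumr_eq0 => [/allP u0|i _]; last first.
  by rewrite mxE -expr2 sqr_ge0.
apply/matrixP => i j; rewrite (ord1 j) [RHS]mxE.
by have := u0 i (mem_index_enum _); rewrite mxE -expr2 sqrf_eq0 => /eqP.
Qed.

Lemma sqnorm_gt0 n (u : 'cV[R]_n) : (0 < (u^T *m u) 0 0) = (u != 0).
Proof. by rewrite lt_def sqnorm_ge0 andbT sqnorm_eq0. Qed.

(** Over the complex numbers [X] is hermitian, so its spectral values are real; being a root of the
    characteristic polynomial, such a value is already an eigenvalue over [R]. *)
Lemma symmetric_eigenvalue n (X : 'M[R]_n.+1) : X^T = X -> exists a, eigenvalue X a.
Proof.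
move=> Xs; pose C : numClosedFieldType := complex.complex R.
pose XC : 'M[C]_n.+1 := map_mx (@complex.real_complex_def R (Phant R)) X.
have XCh : XC \is hermsymmx.
  apply: realsym_hermsym.
    by apply/is_hermitianmxP; rewrite expr0 scale1r map_mx_id // /XC map_trmx Xs.
  by apply/mxOverP => i j; rewrite mxE complex.complex_real.
have /orthomx_spectralP XE := hermitian_normalmx XCh.
have rr := hermitian_spectral_diag_real XCh.
set P := spectralmx XC in XE; set y := spectral_diag XC in XE rr.
have ev : eigenvalue XC (y 0 0).
  apply/eigenvalueP; exists (row 0 P); last first.
    apply/eqP => r0; have := spectral_unit XC; rewrite -row_free_unit => /row_freeP[B PB].
    have := congr1 (row 0) PB; rewrite row_mul r0 mul0mx => /rowP/(_ 0).
    by rewrite !mxE eqxx => /eqP; rewrite eq_sym oner_eq0.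
  rewrite -row_mul {1}XE !mulmxA mulmxV ?spectral_unit // mul1mx.
  apply/rowP => k; rewrite !mxE (bigD1 0) //= big1 ?addr0 ?mxE ?eqxx //.
  by move=> i i0; rewrite !mxE eq_sym (negbTE i0) mul0r.
move: ev; rewrite eigenvalue_root_char /XC -map_char_poly.
have /mxOverP/(_ 0 0)/complex.complex_realP[k ->] := rr.
by rewrite fmorph_root -eigenvalue_root_char => ?; exists k.
Qed.

(** The reflection in the hyperplane orthogonal to [u - e]; it swaps the two vectors because they
    have the same norm. *)
Lemma householder n (u : 'cV[R]_n) (e : 'cV[R]_n) :
    u^T *m u = 1%:M -> e^T *m e = 1%:M ->
  exists H : 'M[R]_n, [/\ H^T = H, H *m H = 1%:M & H *m u = e].
Proof.
move=> u1 e1; have [->|ue] := eqVneq u e.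
  by exists 1%:M; rewrite trmx1 !mul1mx.
pose w : 'cV[R]_n := u - e; pose c := (w^T *m w) 0 0.
have c0 : c != 0 by rewrite sqnorm_eq0 subr_eq0.
have wwE : w^T *m w = c%:M by rewrite [LHS]mx11_scalar.
(* Equal norms give [|u - e|^2 = 2 (u - e) . u], so the reflection moves [u] by exactly [w]. *)
have wu : w^T *m u = (c / 2)%:M.
  have eu : e^T *m u = u^T *m e.
    by apply: trmx_inj; rewrite trmx_mul trmxK [u^T *m e]mx11_scalar tr_scalar_mx.
  have wTu : w^T *m u = 1%:M - u^T *m e by rewrite /w trmxB mulmxBl u1 eu.
  have : c%:M = w^T *m u + w^T *m u.
    rewrite -wwE {2}/w mulmxBr wTu /w trmxB mulmxBl e1 opprB.
    by rewrite addrA.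
  move=> h; apply/matrixP => i j; have := congr1 (fun M : 'M[R]_1 => M i j) h.
  by rewrite !mxE; case: (i == j); rewrite ?mulr1n ?mulr0n => *; lra.
exists (1%:M - (2 / c) *: (w *m w^T)); split.
- by rewrite trmxB trmx1 trmxZ trmx_mul trmxK.
- rewrite mulmxBl mul1mx mulmxBr mulmx1 -scalemxAl -scalemxAr.
  rewrite mulmxA -(mulmxA w w^T w) wwE mul_mx_scalar -scalemxAl !scalerA.
  have -> : 2 / c * (2 / c * c) = 2 / c + 2 / c by field.
  rewrite scalerDl; set Z := (2 / c) *: _; rewrite opprB addrK -addrA.
 by rewrite addNr addr0.
- rewrite mulmxBl mul1mx -scalemxAl -mulmxA wu mul_mx_scalar scalerA.
  rewrite (_ : 2 / c * (c / 2) = 1) ?scale1r ?subKr //.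
  by field.
Qed.

(** Deflation: conjugating by the reflection that carries a unit eigenvector to the first basis
    vector splits off a 1 by 1 block, since symmetry clears the first row along with the first
    column. *)
Theorem symmetric_spectral n (X : 'M[R]_n) : X^T = X ->
  exists (Q : 'M[R]_n) (y : 'rV[R]_n),
    [/\ Q *m Q^T = 1%:M, Q^T *m Q = 1%:M & X = Q^T *m diag_mx y *m Q].
Proof.
elim: n X => [|n IHn] X Xs.
  by exists 1%:M, 0; split; apply/matrixP => -[].
have [a /eigenvalueP[v vX v0]] := symmetric_eigenvalue Xs.
pose u : 'cV[R]_n.+1 := (Num.sqrt ((v *m v^T) 0 0))^-1 *: v^T.
have vv0 : 0 < (v *m v^T) 0 0.
  by rewrite -{1}[v]trmxK sqnorm_gt0 -[0]trmx0 (inj_eq trmx_inj).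
have u1 : u^T *m u = 1%:M.
  rewrite [LHS]mx11_scalar; congr (_ %:M).
  rewrite /u trmxZ trmxK -scalemxAl -scalemxAr scalerA -invfM -expr2.
  by rewrite sqr_sqrtr ?ltW // mxE mulVf // gt_eqF.
have Xu : X *m u = a *: u.
  rewrite /u -scalemxAr scalerA mulrC -scalerA; congr (_ *: _).
  by rewrite -[X in LHS]Xs -trmx_mul vX linearZ.
pose e : 'cV[R]_n.+1 := delta_mx 0 0.
have e1 : e^T *m e = 1%:M.
  by rewrite trmx_delta mul_delta_mx [LHS]mx11_scalar mxE !eqxx.
have [H [Hs HH Hu]] := householder u1 e1.
have [X1 X1D] : exists X1 : 'M[R]_(1 + n), X1 = H *m X *m H.
  by exists (H *m X *m H).
have X1s : X1^T = X1 by rewrite X1D !trmx_mul Hs Xs mulmxA.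
have X1e : X1 *m e = a *: e.
  by rewrite X1D -Hu !mulmxA -(mulmxA _ H H) HH mulmx1 -(mulmxA H) Xu -scalemxAr.
have col0 i : X1 i 0 = a * (i == 0)%:R.
  have := congr1 (fun M : 'cV_(1 + n) => M i 0) X1e.
  rewrite !mxE (bigD1 0) //= big1 => [|j j0]; last first.
    by rewrite !mxE (negbTE j0) mulr0.
  by rewrite !mxE !eqxx mulr1 andbT addr0.
have X1E : X1 = block_mx a%:M 0 0 (drsubmx X1).
  rewrite -[LHS]submxK; congr block_mx.
  - apply/matrixP => i j; rewrite !ord1 !mxE eqxx mulr1n.
    by rewrite (_ : lshift n 0 = 0) ?col0 ?eqxx ?mulr1 //; exact: val_inj.
  - apply/matrixP => i j; rewrite -X1s !mxE ord1.
    by rewrite (_ : lshift n 0 = 0) ?col0 ?mulr0 //; exact: val_inj.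
  - apply/matrixP => i j; rewrite !mxE ord1.
    by rewrite (_ : lshift n 0 = 0) ?col0 ?mulr0 //; exact: val_inj.
have [|Q2 [y2 [QQ QQ' X2E]]] := IHn (drsubmx X1).
  by rewrite trmx_drsub X1s.
pose B : 'M[R]_(1 + n) := block_mx 1%:M 0 0 Q2.
have BT : B^T = block_mx 1%:M 0 0 Q2^T by rewrite tr_block_mx !trmx0 trmx1.
have BB : B *m B^T = 1%:M.
  by rewrite BT mulmx_block !mulmx0 !mul0mx !addr0 !add0r mulmx1 QQ -scalar_mx_block.
have BB' : B^T *m B = 1%:M.
  by rewrite BT mulmx_block !mulmx0 !mul0mx !addr0 !add0r mulmx1 QQ' -scalar_mx_block.
pose y : 'rV[R]_(1 + n) := row_mx a%:M y2.
have core : X1 = B^T *m diag_mx y *m B.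
  rewrite diag_mx_row BT mulmx_block !mulmx0 !mul0mx !addr0 !add0r mul1mx.
  rewrite mulmx_block !mulmx0 !mul0mx !addr0 !add0r mulmx1.
  rewrite X1E {1}X2E; congr block_mx.
    by apply/matrixP => i j; rewrite !ord1 !mxE eqxx !mulr1n.
exists (B *m H), y; split.
- by rewrite trmx_mul Hs mulmxA -(mulmxA B) HH mulmx1.
- by rewrite trmx_mul Hs mulmxA -(mulmxA H) BB' mulmx1.
- have -> : X = H *m X1 *m H.
    by rewrite X1D !mulmxA HH mul1mx -mulmxA HH mulmx1.
  by rewrite {1}core trmx_mul Hs !mulmxA.
Qed.

Lemma quad_diag n (y : 'rV[R]_n) (u : 'cV[R]_n) :
  (u^T *m diag_mx y *m u) 0 0 = \sum_k y 0 k * u k 0 ^+ 2.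
Proof.
rewrite mxE; apply: eq_bigr => k _; rewrite mul_mx_diag !mxE.
by rewrite mulrAC mulrC expr2.
Qed.

Lemma det_spectral n (Q : 'M[R]_n) y : Q *m Q^T = 1%:M ->
  \det (Q^T *m diag_mx y *m Q) = \prod_k y 0 k.
Proof.
move=> QQ; rewrite !det_mulmx mulrAC mulrC -det_mulmx.
by rewrite (mulmx1C QQ) det1 mulr1 det_diag.
Qed.

Lemma tr_spectral n (Q : 'M[R]_n) y : Q *m Q^T = 1%:M ->
  \tr (Q^T *m diag_mx y *m Q) = \sum_k y 0 k.
Proof. by move=> QQ; rewrite mxtrace_mulC mulmxA QQ mul1mx mxtrace_diag. Qed.

Definition psd n (X : 'M[R]_n) : Prop :=
  X^T = X /\ forall u : 'cV[R]_n, 0 <= (u^T *m X *m u) 0 0.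

Lemma posdef_psd n (X : 'M[R]_n) : posdef X -> psd X.
Proof.
move=> [Xs Xp]; split=> // u; have [->|/Xp/ltW//] := eqVneq u 0.
by rewrite mulmx0 mxE.
Qed.

Lemma psd0 n : psd (0 : 'M[R]_n).
Proof. by split=> [|u]; rewrite ?trmx0 // mulmx0 mul0mx mxE. Qed.

Lemma psdD n (X Y : 'M[R]_n) : psd X -> psd Y -> psd (X + Y).
Proof.
move=> [Xs Xp] [Ys Yp]; split=> [|u]; first by rewrite trmxD Xs Ys.
by rewrite mulmxDr mulmxDl mxE addr_ge0.
Qed.

Lemma posdefD n (X Y : 'M[R]_n) : posdef X -> psd Y -> posdef (X + Y).
Proof.
move=> [Xs Xp] [Ys Yp]; split=> [|u u0]; first by rewrite trmxD Xs Ys.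
by rewrite mulmxDr mulmxDl mxE ltr_wpDr ?Xp.
Qed.

Lemma psdZ n a (X : 'M[R]_n) : 0 <= a -> psd X -> psd (a *: X).
Proof.
move=> a0 [Xs Xp]; split=> [|u]; first by rewrite trmxZ Xs.
by rewrite -scalemxAr -scalemxAl mxE mulr_ge0.
Qed.

Lemma posdefZ n a (X : 'M[R]_n) : 0 < a -> posdef X -> posdef (a *: X).
Proof.
move=> a0 [Xs Xp]; split=> [|u u0]; first by rewrite trmxZ Xs.
by rewrite -scalemxAr -scalemxAl mxE mulr_gt0 ?Xp.
Qed.

Lemma psd_sum n (I : Type) (r : seq I) (P : pred I) (F : I -> 'M[R]_n) :
  (forall i, P i -> psd (F i)) -> psd (\sum_(i <- r | P i) F i).
Proof. by move=> Fp; elim/big_ind: _ => //; [exact: psd0|exact: psdD]. Qed.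

Lemma psd_conj n p (X : 'M[R]_n) (B : 'M[R]_(n, p)) : psd X -> psd (B^T *m X *m B).
Proof.
move=> [Xs Xp]; split=> [|u]; first by rewrite !trmx_mul trmxK Xs mulmxA.
by have := Xp (B *m u); rewrite trmx_mul !mulmxA.
Qed.

Lemma posdef_conj n (X A : 'M[R]_n) : A \in unitmx -> posdef X -> posdef (A^T *m X *m A).
Proof.
move=> Au [Xs Xp]; split=> [|u u0]; first by rewrite !trmx_mul trmxK Xs mulmxA.
have := Xp (A *m u); rewrite trmx_mul !mulmxA; apply.
by apply: contra_neq u0 => Au0; rewrite -(mulKmx Au u) Au0 mulmx0.
Qed.

Lemma posdef1 n : posdef (1%:M : 'M[R]_n).
Proof. by split=> [|u u0]; rewrite ?trmx1 // mulmx1 sqnorm_gt0. Qed.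

Lemma posdef_gram n (A : 'M[R]_n) : A \in unitmx -> posdef (A^T *m A).
Proof. by move=> Au; rewrite -(mulmx1 A^T); exact/posdef_conj/posdef1. Qed.

Lemma quad_spectral n (Q : 'M[R]_n) y k : Q *m Q^T = 1%:M ->
  let u : 'cV[R]_n := Q^T *m delta_mx k 0 in
  (u^T *m (Q^T *m diag_mx y *m Q) *m u) 0 0 = y 0 k.
Proof.
move=> QQ u; rewrite /u trmx_mul trmxK !mulmxA -(mulmxA _ Q Q^T) QQ mulmx1.
rewrite -(mulmxA _ Q Q^T) QQ mulmx1 quad_diag (bigD1 k) //= big1 => [|j jk].
  by rewrite mxE !eqxx expr1n mulr1 addr0.
by rewrite mxE (negbTE jk) expr0n mulr0.
Qed.

Lemma psd_spectral n (X : 'M[R]_n) : psd X ->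
  exists (Q : 'M[R]_n) (y : 'rV[R]_n),
    [/\ Q *m Q^T = 1%:M, Q^T *m Q = 1%:M, X = Q^T *m diag_mx y *m Q
      & forall k, 0 <= y 0 k].
Proof.
move=> [Xs Xp]; have [Q [y [QQ QQ' XE]]] := symmetric_spectral Xs.
by exists Q, y; split=> // k; rewrite -(quad_spectral y k QQ) -XE.
Qed.

Lemma posdef_spectral n (X : 'M[R]_n) : posdef X ->
  exists (Q : 'M[R]_n) (y : 'rV[R]_n),
    [/\ Q *m Q^T = 1%:M, Q^T *m Q = 1%:M, X = Q^T *m diag_mx y *m Q
      & forall k, 0 < y 0 k].
Proof.
move=> [Xs Xp]; have [Q [y [QQ QQ' XE]]] := symmetric_spectral Xs.
exists Q, y; split=> // k; rewrite -(quad_spectral y k QQ) -XE Xp //.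
apply/eqP => /(congr1 (mulmx Q)); rewrite mulmxA QQ mul1mx mulmx0.
by move=> /matrixP/(_ k 0)/eqP; rewrite !mxE !eqxx oner_eq0.
Qed.

Lemma posdef_sqrt_det n (X : 'M[R]_n) : posdef X ->
  exists2 A : 'M[R]_n, 0 < \det A & A^T *m A = X.
Proof.
move=> /posdef_spectral[F [y [FF FF' -> yp]]].
exists (F^T *m diag_mx (\row_l Num.sqrt (y 0 l)) *m F).
  by rewrite det_spectral // prodr_gt0 // => l _; rewrite mxE sqrtr_gt0.
rewrite !trmx_mul trmxK tr_diag_mx !mulmxA -(mulmxA _ F F^T) FF mulmx1; congr (_ *m _).
rewrite -mulmxA; congr (_ *m _).
rewrite mulmx_diag; congr diag_mx; apply/rowP => l.
by rewrite !mxE -expr2 sqr_sqrtr ?ltW.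
Qed.

Lemma posdef_sqrt n (X : 'M[R]_n) : posdef X ->
  exists2 A : 'M[R]_n, A \in unitmx & A^T *m A = X.
Proof.
by move=> /posdef_sqrt_det[A A0 AX]; exists A; rewrite // unitmxE unitfE gt_eqF.
Qed.

Lemma posdef_det_gt0 n (X : 'M[R]_n) : posdef X -> 0 < \det X.
Proof.
move=> /posdef_spectral[Q [y [QQ _ -> yp]]].
by rewrite det_spectral // prodr_gt0.
Qed.

Lemma posdef_unit n (X : 'M[R]_n) : posdef X -> X \in unitmx.
Proof. by move=> /posdef_det_gt0 X0; rewrite unitmxE unitfE gt_eqF. Qed.

Lemma posdef_inv n (X : 'M[R]_n) : posdef X -> posdef (invmx X).
Proof.
move=> Xp; have Xu := posdef_unit Xp; have Xs : X^T = X by case: Xp.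
have := posdef_conj (A := invmx X) _ Xp.
by rewrite unitmx_inv trmx_inv Xs -mulmxA mulmxV // mulmx1; apply.
Qed.

Lemma psd_det_ge0 n (X : 'M[R]_n) : psd X -> 0 <= \det X.
Proof.
move=> /psd_spectral[Q [y [QQ _ -> yp]]].
by rewrite det_spectral // prodr_ge0.
Qed.

Lemma psd_tr_ge0 n (X : 'M[R]_n) : psd X -> 0 <= \tr X.
Proof.
move=> /psd_spectral[Q [y [QQ _ -> yp]]].
by rewrite tr_spectral // sumr_ge0.
Qed.

Lemma psd_det_neq0 n (X : 'M[R]_n) : psd X -> \det X != 0 -> posdef X.
Proof.
move=> Xp; have [Q [y [QQ QQ' XE yp]]] := psd_spectral Xp.
rewrite XE det_spectral // => /prodf_neq0 y0.
have Qu : Q \in unitmx by case: (mulmx1_unit QQ).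
apply: posdef_conj => //; split=> [|u u0]; first by rewrite tr_diag_mx.
rewrite quad_diag lt_def sumr_ge0 ?andbT => [|k _]; last by rewrite mulr_ge0 ?sqr_ge0.
apply: contra_neq u0 => /eqP; rewrite psumr_eq0 => [/allP h|k _]; last first.
  by rewrite mulr_ge0 ?sqr_ge0.
apply/matrixP => k j; rewrite (ord1 j) [RHS]mxE.
have := h k (mem_index_enum _); rewrite mulf_eq0 (negbTE (y0 k isT)) /=.
by rewrite sqrf_eq0 => /eqP.
Qed.

(** For invertible [X = A^T A] one has [Z = A^T (1 + W) A] with [W] positive semidefinite, and the
    eigenvalues of [1 + W] are at least 1. *)
Lemma det_le n (X Z : 'M[R]_n) : psd X -> psd (Z - X) -> \det X <= \det Z.
Proof.
move=> Xp ZX; have [X0|X0] := eqVneq (\det X) 0.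
  by rewrite X0 psd_det_ge0 // -(subrK X Z); exact: psdD.
have [A Au AE] := posdef_sqrt (psd_det_neq0 Xp X0).
pose B := invmx A; pose W := B^T *m (Z - X) *m B.
have Wp : psd W by exact: psd_conj.
have ZE : Z = A^T *m (1%:M + W) *m A.
  rewrite mulmxDr mulmx1 mulmxDl AE /W !mulmxA -trmx_mul mulVmx // trmx1 mul1mx.
  by rewrite -mulmxA mulVmx // mulmx1 addrC subrK.
rewrite ZE -AE !det_mulmx mulrAC ler_peMr //.
  by rewrite det_tr -expr2 sqr_ge0.
have [Q [y [QQ QQ' WE yp]]] := psd_spectral Wp.
have -> : 1%:M + W = Q^T *m diag_mx (\row_k (1 + y 0 k)) *m Q.
  rewrite WE -QQ' -{1}(mulmx1 Q^T) -mulmxDl -mulmxDr; congr (_ *m _ *m _).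
  by apply/matrixP => i j; rewrite !mxE mulrnDl.
rewrite det_spectral //; apply: (@le_trans _ _ (\prod_(k < n) 1)).
  by rewrite prodr_const expr1n.
by apply: ler_prod => k _; rewrite ler01 mxE lerDl yp.
Qed.

Lemma eq_prodr_le (I : finType) (a b : I -> R) : (forall i, 0 <= a i <= b i) ->
    (forall i, 0 < b i) -> \prod_i a i = \prod_i b i ->
  forall i, a i = b i.
Proof.
move=> ab b0 E i; apply/eqP; apply: contra_eqT E => abi.
have {abi} : a i < b i by rewrite lt_neqAle abi; case/andP: (ab i).
move=> abi; rewrite lt_eqF // (bigD1 i) //= [ltRHS](bigD1 i) //=.
apply: (@le_lt_trans _ _ (a i * \prod_(j | j != i) b j)).
  rewrite ler_wpM2l //; first by case/andP: (ab i).
  by apply: ler_prod.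
by rewrite ltr_pM2r // prodr_gt0.
Qed.

(** AM-GM in exponential form: eigenvalue by eigenvalue, [y <= exp (y - 1)], with equality only at
    [y = 1]. *)
Lemma psd_det_le_exp n (X : 'M[R]_n) : psd X ->
  \det X <= expR (\tr X - n%:R) /\
  (\det X = expR (\tr X - n%:R) -> X = 1%:M).
Proof.
move=> /psd_spectral[Q [y [QQ QQ' -> yp]]].
have -> : expR (\tr (Q^T *m diag_mx y *m Q) - n%:R) = \prod_k expR (y 0 k - 1).
  by rewrite -expR_sum tr_spectral // sumrB sumr_const card_ord.
have yle k : 0 <= y 0 k <= expR (y 0 k - 1).
  by rewrite yp /=; have := expR_ge1Dx (y 0 k - 1); rewrite addrC subrK.
rewrite det_spectral //; split; first by apply: ler_prod => k _.
move=> /(eq_prodr_le yle) y1.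
suff -> : diag_mx y = 1%:M by rewrite mulmx1.
rewrite -diag_const_mx; congr diag_mx; apply/rowP => k; rewrite mxE.
apply/eqP; apply: contra_eqT (y1 (fun=> expR_gt0 _) k) => yk1.
rewrite lt_eqF //; have := @expR_gt1Dx _ (y 0 k - 1).
by rewrite subr_eq0 addrC subrK; apply.
Qed.

(** The [k i] play the role of block multiplicities. The trace bound makes the product of the
    exponential bounds at most 1, so a determinant product equal to 1 forces equality in every
    factor. *)
Lemma matrix_AMGM (I : finType) (k n : I -> nat) (P : forall i, 'M[R]_(n i)) :
    (forall i, psd (P i)) ->
    \sum_i (k i)%:R * \tr (P i) <= \sum_i (k i * n i)%:R ->
  \prod_i \det (P i) ^+ k i <= 1 /\
  (\prod_i \det (P i) ^+ k i = 1 -> forall i, (0 < k i)%N -> P i = 1%:M).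
Proof.
move=> Pp le_tr.
pose b i := expR (\tr (P i) - (n i)%:R) ^+ k i.
have ab i : 0 <= \det (P i) ^+ k i <= b i.
  have [h _] := psd_det_le_exp (Pp i).
  by rewrite exprn_ge0 ?psd_det_ge0 //= lerXn2r // nnegrE ?psd_det_ge0 ?expR_ge0.
have b0 i : 0 < b i by rewrite exprn_gt0 ?expR_gt0.
have b1 : \prod_i b i <= 1.
  rewrite /b (eq_bigr (fun i => expR ((k i)%:R * \tr (P i) - (k i * n i)%:R))).
    by rewrite -expR_sum -[leRHS]expR0 ler_expR sumrB subr_le0.
  by move=> i _; rewrite -expRM_natl mulrBr natrM.
have dle : \prod_i \det (P i) ^+ k i <= \prod_i b i by apply: ler_prod.
split; first exact: le_trans b1.
move=> E i ki; have [_] := psd_det_le_exp (Pp i); apply.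
have /(eq_prodr_le ab b0)/(_ i) : \prod_i \det (P i) ^+ k i = \prod_i b i.
  by apply/le_anti; rewrite dle E b1.
by move=> /(pexpIrn ki); apply; rewrite nnegrE ?psd_det_ge0 ?expR_ge0.
Qed.
End SymmetricMatrices.

(** * The gaussian formula for the capacity *)

Lemma det_cast (R : comNzRingType) n n' (e : n = n') (A : 'M[R]_n) :
  \det (castmx (e, e) A) = \det A.
Proof. by case: n' / e; rewrite castmx_id. Qed.

Lemma det_mxdiag (R : comNzRingType) p (p_ : 'I_p -> nat) (B_ : forall i, 'M[R]_(p_ i)) :
  \det (\mxdiag_i B_ i) = \prod_i \det (B_ i).
Proof.
elim: p p_ B_ => [|p IHp] p_ B_.
  have e : (\sum_(i < 0) p_ i = 0)%N by rewrite big_ord0.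
  by rewrite [RHS]big_ord0; move: (mxdiag B_); rewrite e => M; exact: det_mx00.
by rewrite mxdiag_recl det_cast det_ublock IHp big_ord_recl.
Qed.

Lemma prod_tagnat_sig1 (R : comPzSemiRingType) n (p : 'I_n -> nat) (F : 'I_n -> R) :
  \prod_(q < (\sum_k p k)%N) F (tagnat.sig1 q) = \prod_(i < n) F i ^+ p i.
Proof.
rewrite (reindex _ tagnat.rank_bij_on) /=.
rewrite (eq_bigr (fun x : {i & 'I_(p i)} => F (tag x))); last first.
  by move=> x _; rewrite tagnat.rankE tagnat.Rank1K.
rewrite -(sig_big_dep xpredT (fun _ => xpredT) (fun i _ => F i)) /=.
by apply: eq_bigr => i _; rewrite prodr_const card_ord.
Qed.

Section BlockPosdef.
Context {R : realType} p (p_ : 'I_p -> nat).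

Lemma posdef_mxdiag (Y : forall i, 'M[R]_(p_ i)) :
  (forall i, posdef (Y i)) -> posdef (\mxdiag_i Y i).
Proof.
move=> Yp.
pose A i := s2val (cid2 (posdef_sqrt (Yp i))).
have Au i : A i \in unitmx by exact: (s2valP (cid2 (posdef_sqrt (Yp i)))).
have AE i : (A i)^T *m A i = Y i by exact: (s2valP' (cid2 (posdef_sqrt (Yp i)))).
have -> : \mxdiag_i Y i = (\mxdiag_i A i)^T *m \mxdiag_i A i.
  rewrite tr_mxdiag mul_mxdiag_mxblock; apply/eq_mxblock => i j.
  case: eqP => [e|_]; last by rewrite mulmx0.
  by case: j / e; rewrite !conform_mx_id AE.
apply: posdef_gram; rewrite unitmxE unitfE det_mxdiag.
by apply/prodf_neq0 => i _; rewrite -unitfE -unitmxE.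
Qed.

Lemma mulmx_mxdiag (A B : forall i, 'M[R]_(p_ i)) :
  \mxdiag_i A i *m \mxdiag_i B i = \mxdiag_i (A i *m B i).
Proof.
rewrite mul_mxdiag_mxblock; apply/eq_mxblock => i j.
case: eqP => [e|_]; last by rewrite mulmx0.
by case: j / e; rewrite !conform_mx_id.
Qed.

Lemma posdef_submxblock (X : 'M[R]_(\sum_i p_ i)) i :
  posdef X -> posdef (submxblock X i i).
Proof.
move=> [Xs Xp]; split=> [|u u0]; first by rewrite tr_submxblock Xs.
pose v : forall j, 'cV[R]_(p_ j) := fun j => if j == i then conform_mx 0 u else 0.
have vi : v i = u by rewrite /v eqxx conform_mx_id.
have -> : u^T *m submxblock X i i *m u
          = (\mxcol_j v j)^T *m X *m (\mxcol_j v j).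
  rewrite -[X in _ = _ *m X *m _]submxblockK tr_mxcol mul_mxrow_mxblock mul_mxrow_mxcol.
  rewrite (bigD1 i) //= [X in _ + X]big1 => [|j ji]; last first.
    by rewrite /v (negbTE ji) mulmx0.
  rewrite addr0 vi (bigD1 i) //= big1 => [|j ji]; last first.
    by rewrite /v (negbTE ji) trmx0 mul0mx.
  by rewrite addr0 vi.
apply: Xp; apply: contra_neq u0 => v0; rewrite -vi.
by have := congr1 (fun w => submxcol w i) v0; rewrite mxcolK submxcol0.
Qed.
End BlockPosdef.

Section Components.
Context {R : realType} {n m : nat} {Q : bipartite_quiver n m}.
Context (s : 'I_n + 'I_m -> int).
Implicit Type d : 'I_n + 'I_m -> nat.

(* [V a] if [a] goes from v_i to w_j and 0 otherwise, so that sums can range over all arrows. *)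
Definition comp_mx d (V : rep R Q d) i j a : 'M[R]_(d (inr j), d (inl i)) :=
  if a \in arrows_between Q i j then arrow_mx V i j a else 0.

Lemma comp_mx_arrow d (V : rep R Q d) (a : barrow Q) : comp_mx V (src a) (snk a) a = V a.
Proof. by rewrite /comp_mx inE !eqxx /arrow_mx conform_mx_id. Qed.

(** Arrow matrices indexed by [i j] carry a type transport. A relation that holds between zero
    matrices and at true arrows holds for all of them, and at true arrows the transport computes
    away. *)
Lemma comp_mx_ind d e (V : rep R Q d) (W : rep R Q e)
    (P : forall i j, 'M[R]_(d (inr j), d (inl i)) -> 'M[R]_(e (inr j), e (inl i)) -> Prop) :
    (forall i j, P i j 0 0) ->
    (forall a : barrow Q, P (src a) (snk a) (V a) (W a)) ->
  forall i j a, P i j (comp_mx V i j a) (comp_mx W i j a).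
Proof.
move=> P0 PV i j a; have [|na] := boolP (a \in arrows_between Q i j); last first.
  by rewrite /comp_mx (negbTE na).
by rewrite inE => /andP[/eqP <- /eqP <-]; rewrite !comp_mx_arrow.
Qed.

Lemma comp_mx_act d (V : rep R Q d) (A : forall x : vertex Q, 'M[R]_(d x)) i j a :
  comp_mx (act A V) i j a = A (inr j) *m comp_mx V i j a *m invmx (A (inl i)).
Proof.
move: i j a; apply: (@comp_mx_ind _ _ (act A V) V
  (fun i j M N => M = A (inr j) *m N *m invmx (A (inl i)))) => // i j.
by rewrite mulmx0 mul0mx.
Qed.

Lemma is_hom_comp d e (V : rep R Q d) (W : rep R Q e) (f : forall x : vertex Q, 'M[R]_(e x, d x)) :
  is_hom V W f <->
  forall i j a, f (inr j) *m comp_mx V i j a = comp_mx W i j a *m f (inl i).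
Proof.
split=> [h|h a]; last by have := h (src a) (snk a) a; rewrite !comp_mx_arrow.
apply: (@comp_mx_ind _ _ V W (fun i j M N => f (inr j) *m M = N *m f (inl i))) => // i j.
by rewrite mulmx0 mul0mx.
Qed.

(** At identity tuples, [gram] and [cogram] are the left-hand sides of the two geometric identities;
    [gram_cogram] shows that they are adjoint for the weighted traces. *)
Definition gram d (V : rep R Q d) (Y : forall j, 'M[R]_(d (inr j))) i : 'M[R]_(d (inl i)) :=
  \sum_j (sigma_neg s j)%:R *:
    \sum_a (comp_mx V i j a)^T *m Y j *m comp_mx V i j a.

Definition cogram d (V : rep R Q d) (Z : forall i, 'M[R]_(d (inl i))) j : 'M[R]_(d (inr j)) :=
  \sum_i (sigma_pos s i)%:R *:
    \sum_a comp_mx V i j a *m Z i *m (comp_mx V i j a)^T.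

Lemma gaussian_ratioE d (V : rep R Q d) Y :
  gaussian_ratio s V Y = (\prod_i \det (gram V Y i) ^+ sigma_pos s i)
                         / \prod_j \det (Y j) ^+ sigma_neg s j.
Proof.
rewrite /gaussian_ratio; congr (_ / _); apply: eq_bigr => i _; congr (\det _ ^+ _).
apply: eq_bigr => j _; congr (_ *: _).
rewrite [LHS]big_mkcond; apply: eq_bigr => a _.
by rewrite /comp_mx; case: ifP => // _; rewrite mulmx0.
Qed.

Lemma mul_kraus d (V : rep R Q d) (X : 'M[R]_(total_row_dim s d)) a q r :
  (bl_kraus V a q r)^T *m X *m bl_kraus V a q r =
  \mxdiag_(r' < _) (if r' == r then
     (arrow_mx V (tagnat.sig1 r') (tagnat.sig1 q) a)^T *m submxblock X q q
       *m arrow_mx V (tagnat.sig1 r') (tagnat.sig1 q) a else 0).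
Proof.
rewrite -{1}[X]submxblockK tr_mxblock !mul_mxblock; apply/eq_mxblock => r1 r2.
rewrite (bigD1 q) //= [X in _ + X]big1 ?addr0 => [|q' q'q]; last first.
  by rewrite (negbTE q'q) mulmx0.
rewrite (bigD1 q) //= [X in _ + X]big1 ?addr0 => [|q' q'q]; last first.
  by rewrite (negbTE q'q) trmx0 mul0mx.
rewrite eqxx /=; case: (eqVneq r1 r2) => [<-|r12].
  by rewrite conform_mx_id; case: ifP; rewrite ?mulmx0.
case: (eqVneq r1 r) r12 => [->|] r12; last by rewrite trmx0 !mul0mx.
by rewrite eq_sym (negbTE r12) mulmx0.
Qed.

Lemma mul_kraus_adj d (V : rep R Q d) (X : 'M[R]_(total_col_dim s d)) a q r :
  bl_kraus V a q r *m X *m (bl_kraus V a q r)^T =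
  \mxdiag_(q' < _) (if q' == q then
     arrow_mx V (tagnat.sig1 r) (tagnat.sig1 q') a *m submxblock X r r
       *m (arrow_mx V (tagnat.sig1 r) (tagnat.sig1 q') a)^T else 0).
Proof.
rewrite -{1}[X]submxblockK tr_mxblock !mul_mxblock; apply/eq_mxblock => q1 q2.
rewrite (bigD1 r) //= [X in _ + X]big1 ?addr0 => [|r' r'r]; last first.
  by rewrite (negbTE r'r) andbF trmx0 mulmx0.
rewrite (bigD1 r) //= [X in _ + X]big1 ?addr0 => [|r' r'r]; last first.
  by rewrite (negbTE r'r) andbF mul0mx.
rewrite eqxx /= !andbT; case: (eqVneq q1 q2) => [<-|q12].
  by rewrite conform_mx_id; case: ifP; rewrite ?mul0mx.
case: (eqVneq q1 q) q12 => [->|] q12; last by rewrite !mul0mx.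
by rewrite eq_sym (negbTE q12) trmx0 mulmx0.
Qed.

Lemma sum_block_interval p (p_ : 'I_p -> nat) (V : nmodType) i r (F : V) :
  \sum_(r' in block_interval p_ i) (if r == r' then F else 0) =
  if tagnat.sig1 r == i then F else 0.
Proof.
rewrite big_mkcond (bigD1 r) //= eqxx in_block_interval big1 ?addr0 // => r' r'r.
by rewrite eq_sym (negbTE r'r) if_same.
Qed.

(** Each Kraus matrix has a single nonzero block, so only the diagonal blocks of [X] survive the
    sandwich; this is what lets [X] be replaced by a block diagonal matrix. *)
Lemma bl_opE d (V : rep R Q d) (X : 'M[R]_(total_row_dim s d)) : bl_op V X =
  \mxdiag_(r < _) \sum_q \sum_a
    (comp_mx V (tagnat.sig1 r) (tagnat.sig1 q) a)^T *m submxblock X q q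
      *m comp_mx V (tagnat.sig1 r) (tagnat.sig1 q) a.
Proof.
rewrite /bl_op; transitivity (\mxdiag_(r' < _) \sum_i \sum_j
    \sum_(a in arrows_between Q i j) \sum_(q in block_interval (sigma_neg s) j)
    \sum_(r in block_interval (sigma_pos s) i) (if r' == r then
      (arrow_mx V (tagnat.sig1 r') (tagnat.sig1 q) a)^T *m submxblock X q q
      *m arrow_mx V (tagnat.sig1 r') (tagnat.sig1 q) a else 0)).
  do 5!(rewrite mxdiag_sum; apply: eq_bigr => ? _); exact: mul_kraus.
apply: eq_mxdiag => r.
pose F q a := (arrow_mx V (tagnat.sig1 r) (tagnat.sig1 q) a)^T *m submxblock X q q
      *m arrow_mx V (tagnat.sig1 r) (tagnat.sig1 q) a.
transitivity (\sum_i \sum_j \sum_(a in arrows_between Q i j)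
    \sum_(q in block_interval (sigma_neg s) j)
      (if tagnat.sig1 r == i then F q a else 0)).
  by do 4!(apply: eq_bigr => ? _); rewrite sum_block_interval.
rewrite (bigD1 (tagnat.sig1 r)) //= [X in _ + X]big1 ?addr0 => [|i ir]; last first.
  do 3!(rewrite big1 // => ? _).
  by rewrite eq_sym (negbTE ir).
transitivity (\sum_j \sum_q \sum_(a in arrows_between Q (tagnat.sig1 r) j)
    (if tagnat.sig1 q == j then F q a else 0)).
  apply: eq_bigr => j _; rewrite exchange_big [LHS]big_mkcond; apply: eq_bigr => q _.
  rewrite in_block_interval eqxx; case: ifP => _ //; by rewrite big1.
rewrite exchange_big; apply: eq_bigr => q _ /=.
rewrite (bigD1 (tagnat.sig1 q)) //= [X in _ + X]big1 ?addr0 => [|j jq]; last first.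
  by rewrite big1 // => a _; rewrite eq_sym (negbTE jq).
rewrite eqxx [LHS]big_mkcond; apply: eq_bigr => a _.
by rewrite /comp_mx; case: ifP => // _; rewrite mulmx0.
Qed.

Lemma bl_op_adj_blockE d (V : rep R Q d) (X : 'M[R]_(total_col_dim s d)) : bl_op_adj V X =
  \mxdiag_(q < _) \sum_r \sum_a
    comp_mx V (tagnat.sig1 r) (tagnat.sig1 q) a *m submxblock X r r
      *m (comp_mx V (tagnat.sig1 r) (tagnat.sig1 q) a)^T.
Proof.
rewrite /bl_op_adj; transitivity (\mxdiag_(q' < _) \sum_i \sum_j
    \sum_(a in arrows_between Q i j) \sum_(r in block_interval (sigma_pos s) i)
    \sum_(q in block_interval (sigma_neg s) j) (if q' == q then
      arrow_mx V (tagnat.sig1 r) (tagnat.sig1 q') a *m submxblock X r r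
      *m (arrow_mx V (tagnat.sig1 r) (tagnat.sig1 q') a)^T else 0)).
  do 3!(rewrite mxdiag_sum; apply: eq_bigr => ? _); rewrite exchange_big.
  do 2!(rewrite mxdiag_sum; apply: eq_bigr => ? _); exact: mul_kraus_adj.
apply: eq_mxdiag => q.
pose F r a := arrow_mx V (tagnat.sig1 r) (tagnat.sig1 q) a *m submxblock X r r
      *m (arrow_mx V (tagnat.sig1 r) (tagnat.sig1 q) a)^T.
transitivity (\sum_j \sum_i \sum_(a in arrows_between Q i j)
    \sum_(r in block_interval (sigma_pos s) i)
      (if tagnat.sig1 q == j then F r a else 0)).
  rewrite exchange_big.
  by do 4!(apply: eq_bigr => ? _); rewrite sum_block_interval.
rewrite (bigD1 (tagnat.sig1 q)) //= [X in _ + X]big1 ?addr0 => [|j jq]; last first.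
  do 3!(rewrite big1 // => ? _).
  by rewrite eq_sym (negbTE jq).
transitivity (\sum_i \sum_r \sum_(a in arrows_between Q i (tagnat.sig1 q))
    (if tagnat.sig1 r == i then F r a else 0)).
  apply: eq_bigr => i _; rewrite exchange_big [LHS]big_mkcond; apply: eq_bigr => r _.
  rewrite in_block_interval eqxx; case: ifP => _ //; by rewrite big1.
rewrite exchange_big; apply: eq_bigr => r _ /=.
rewrite (bigD1 (tagnat.sig1 r)) //= [X in _ + X]big1 ?addr0 => [|i ir]; last first.
  by rewrite big1 // => a _; rewrite eq_sym (negbTE ir).
rewrite eqxx [LHS]big_mkcond; apply: eq_bigr => a _.
by rewrite /comp_mx; case: ifP => // _; rewrite !mul0mx.
Qed.

(** The blocks [q] over one sink [j] have types that are equal only propositionally; [conform_mx]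
    brings them into a common type, where they can be added. *)
Lemma sum_block_row (V : nmodType) d (F : forall j, 'M[R]_(d (inr j)) -> V)
    (X : 'M[R]_(total_row_dim s d)) :
  \sum_q F (tagnat.sig1 q) (submxblock X q q) =
  \sum_j \sum_(q | tagnat.sig1 q == j) F j (conform_mx 0 (submxblock X q q)).
Proof.
rewrite (partition_big (fun q => tagnat.sig1 q) xpredT) //=.
apply: eq_bigr => j _; apply: eq_bigr => q /eqP; case: j /.
by rewrite conform_mx_id.
Qed.

Lemma card_tagnat_sig1 p (p_ : 'I_p -> nat) i :
  #|[pred q : 'I_(\sum_k p_ k)%N | tagnat.sig1 q == i]| = p_ i.
Proof.
have <- : (\sum_k p_ k * (k == i))%N = p_ i.
  rewrite (bigD1 i) //= eqxx muln1 big1 ?addn0 // => k ki.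
  by rewrite (negbTE ki) muln0.
rewrite -(sum_tagnat_sig1 p_ (fun k => (k == i : nat))) -sum1_card big_mkcond /=.
by apply: eq_bigr => q _; rewrite inE; case: eqP.
Qed.

Definition block_sum d (X : 'M[R]_(total_row_dim s d)) j : 'M[R]_(d (inr j)) :=
  \sum_(q | tagnat.sig1 q == j) conform_mx 0 (submxblock X q q).

Lemma bl_op_gram d (V : rep R Q d) (X : 'M[R]_(total_row_dim s d)) Y :
    (forall j, block_sum X j = (sigma_neg s j)%:R *: Y j) ->
  bl_op V X = \mxdiag_(r < _) gram V Y (tagnat.sig1 r).
Proof.
move=> XY; rewrite bl_opE; apply: eq_mxdiag => r.
pose i := tagnat.sig1 r; pose F j (M : 'M[R]_(d (inr j))) :=
  \sum_a (comp_mx V i j a)^T *m M *m comp_mx V i j a.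
rewrite (sum_block_row F); apply: eq_bigr => j _.
transitivity (F j (block_sum X j)).
  rewrite /F exchange_big; apply: eq_bigr => a _.
  by rewrite /block_sum mulmx_sumr mulmx_suml.
rewrite XY /F scaler_sumr; apply: eq_bigr => a _.
by rewrite -scalemxAr -scalemxAl.
Qed.

Lemma bl_op_adj_cogram d (V : rep R Q d) (Z : forall i, 'M[R]_(d (inl i))) :
  bl_op_adj V (\mxdiag_(r < _) Z (tagnat.sig1 r) : 'M[R]_(total_col_dim s d)) =
  \mxdiag_(q < _) cogram V Z (tagnat.sig1 q).
Proof.
rewrite bl_op_adj_blockE; apply: eq_mxdiag => q.
pose j := tagnat.sig1 q; pose F i := \sum_a comp_mx V i j a *m Z i *m (comp_mx V i j a)^T.
transitivity (\sum_(r < (\sum_k sigma_pos s k)%N) F (tagnat.sig1 r)).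
  by apply: eq_bigr => r _; apply: eq_bigr => a _; rewrite submxblock_diag.
rewrite (partition_big (fun r => tagnat.sig1 r) xpredT) //=.
apply: eq_bigr => i _; rewrite (eq_bigr (fun=> F i)); last by move=> r /eqP ->.
by rewrite sumr_const card_tagnat_sig1 scaler_nat.
Qed.

Lemma block_sum_mxdiag d (Y : forall j, 'M[R]_(d (inr j))) j :
  block_sum (\mxdiag_(q < _) Y (tagnat.sig1 q)) j = (sigma_neg s j)%:R *: Y j.
Proof.
rewrite /block_sum (eq_bigr (fun=> Y j)) => [|q /eqP e].
  by rewrite sumr_const card_tagnat_sig1 scaler_nat.
by rewrite submxblock_diag; case: j / e; rewrite conform_mx_id.
Qed.

Lemma block_sumZ d c (X : 'M[R]_(total_row_dim s d)) j :
  block_sum (c *: X) j = c *: block_sum X j.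
Proof.
rewrite /block_sum scaler_sumr; apply: eq_bigr => q /eqP e.
by case: j / e; rewrite !conform_mx_id; apply/matrixP => k l; rewrite !mxE.
Qed.

Lemma geometricE d (V : rep R Q d) :
    (forall i, 0 < s (inl i)) -> (forall j, s (inr j) < 0) ->
  Defs.geometric s V <->
  (forall i, gram V (fun=> 1%:M) i = 1%:M) /\ (forall j, cogram V (fun=> 1%:M) j = 1%:M).
Proof.
move=> s_pos s_neg.
have E1 : bl_op V (1%:M : 'M[R]_(total_row_dim s d)) = \mxdiag_(r < _) gram V (fun=> 1%:M) (tagnat.sig1 r).
  apply: bl_op_gram => j; rewrite -mxdiagZ.
  exact: (block_sum_mxdiag (fun=> 1%:M)).
have E2 : bl_op_adj V (1%:M : 'M[R]_(total_col_dim s d)) = \mxdiag_(q < _) cogram V (fun=> 1%:M) (tagnat.sig1 q).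
  by rewrite -mxdiagZ; exact: (bl_op_adj_cogram V (fun=> 1%:M)).
rewrite /Defs.geometric E1 E2; split=> -[h1 h2]; split.
- move=> i; move: h1; rewrite -mxdiagZ => /eq_mxdiagP h1.
  (* Since its weight is positive, the vertex [i] owns at least one block column, where the block
     identity can be read off. *)
  have p0 : (0 < sigma_pos s i)%N by rewrite /sigma_pos absz_gt0 gt_eqF.
  have h k (r : block_col s) (e : tagnat.sig1 r = k) : gram V (fun=> 1%:M) k = 1%:M.
    by case: k / e; exact: h1.
  exact: h (tagnat.Rank1K (Ordinal p0)).
- move=> j; move: h2; rewrite -mxdiagZ => /eq_mxdiagP h2.
  have p0 : (0 < sigma_neg s j)%N by rewrite /sigma_neg absz_gt0 lt_eqF.
  have h k (q : block_row s) (e : tagnat.sig1 q = k) : cogram V (fun=> 1%:M) k = 1%:M.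
    by case: k / e; exact: h2.
  exact: h (tagnat.Rank1K (Ordinal p0)).
- by rewrite -mxdiagZ; apply: eq_mxdiag => r; rewrite h1.
- by rewrite -mxdiagZ; apply: eq_mxdiag => r; rewrite h2.
Qed.

Lemma det_bl_op_gram d (V : rep R Q d) (X : 'M[R]_(total_row_dim s d)) Y :
    (forall j, block_sum X j = (sigma_neg s j)%:R *: Y j) ->
  \det (bl_op V X) = \prod_i \det (gram V Y i) ^+ sigma_pos s i.
Proof.
move=> /(bl_op_gram V) ->; rewrite det_mxdiag.
exact: (prod_tagnat_sig1 (sigma_pos s) (fun i => \det (gram V Y i))).
Qed.

Lemma psd_gram_rep d (V : rep R Q d) Y i : (forall j, psd (Y j)) -> psd (gram V Y i).
Proof.
move=> Yp; apply: psd_sum => j _; apply: psdZ; rewrite ?ler0n //.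
by apply: psd_sum => a _; exact: psd_conj.
Qed.

Lemma gram_num_ge0 d (V : rep R Q d) Y : (forall j, psd (Y j)) ->
  0 <= \prod_i \det (gram V Y i) ^+ sigma_pos s i.
Proof.
by move=> Yp; apply: prodr_ge0 => i _; rewrite exprn_ge0 // psd_det_ge0 //; exact: psd_gram_rep.
Qed.

Lemma gram_den_gt0 d (Y : forall j, 'M[R]_(d (inr j))) : (forall j, posdef (Y j)) ->
  0 < \prod_j \det (Y j) ^+ sigma_neg s j.
Proof. by move=> Yp; apply: prodr_gt0 => j _; rewrite exprn_gt0 // posdef_det_gt0. Qed.

Lemma ratio_ge0 d (V : rep R Q d) Y : (forall j, posdef (Y j)) -> 0 <= gaussian_ratio s V Y.
Proof.
move=> Yp; rewrite gaussian_ratioE; apply: divr_ge0; last exact/ltW/gram_den_gt0.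
by apply: gram_num_ge0 => j; exact: posdef_psd.
Qed.

Lemma capacity_set_lb d (V : rep R Q d) :
  lbound [set \det (bl_op V X) |
        X in [set X : 'M[R]_(total_row_dim s d) | posdef X /\ \det X = 1]] 0.
Proof.
move=> _ [X [Xp _] <-]; apply: psd_det_ge0.
by do 5!(apply: psd_sum => ? _); apply: psd_conj; exact: posdef_psd.
Qed.

(** The block diagonal matrix with [sigma_neg s j] copies of each [Y j], rescaled to determinant 1,
    is a competitor; rescaling leaves the ratio unchanged because the two total dimensions agree. *)
Lemma capacity_le d (V : rep R Q d) Y : total_row_dim s d = total_col_dim s d ->
  (forall j, posdef (Y j)) -> capacity s V <= gaussian_ratio s V Y.
Proof.
move=> sd Yp.
have Y'p (q : block_row s) : posdef (Y (tagnat.sig1 q)) by [].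
pose B : 'M[R]_(total_row_dim s d) := \mxdiag_(q < _) Y (tagnat.sig1 q).
have Bp : posdef B by exact: posdef_mxdiag.
have dB : \det B = \prod_j \det (Y j) ^+ sigma_neg s j.
  rewrite det_mxdiag; exact: (prod_tagnat_sig1 (sigma_neg s) (fun j => \det (Y j))).
pose N := total_row_dim s d.
(* An [N]-th root of the inverse determinant; for [N = 0] the determinant is 1 and any positive
   scalar serves. *)
have [c c0 cN] : exists2 c : R, 0 < c & c ^+ N = (\det B)^-1.
  have [N0|N0] := posnP N.
    exists 1 => //; rewrite N0 expr0; move: (B); rewrite -/N N0 => B0.
    by rewrite det_mx00 invr1.
  exists (expR (- (ln (\det B) / N%:R))); first exact: expR_gt0.
  rewrite -expRM_natl mulrN mulrCA divff ?pnatr_eq0 -?lt0n // mulr1.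
  by rewrite expRN lnK // posrE posdef_det_gt0.
have -> : gaussian_ratio s V Y = \det (bl_op V (c *: B)).
  rewrite gaussian_ratioE (@det_bl_op_gram _ V _ (fun j => c *: Y j)); last first.
    by move=> j; rewrite block_sumZ block_sum_mxdiag !scalerA mulrC.
  rewrite -dB -cN /N sd total_col_dimE -prodrXr mulrC -big_split /=.
  apply: eq_bigr => i _; rewrite mulnC exprM -exprMn; congr (_ ^+ _).
  rewrite -detZ; congr (\det _); rewrite /gram scaler_sumr; apply: eq_bigr => j _.
  rewrite scalerA mulrC -scalerA; congr (_ *: _); rewrite scaler_sumr.
  by apply: eq_bigr => a _; rewrite -scalemxAr -scalemxAl.
apply: ge_inf; first by exists 0; exact: capacity_set_lb.
exists (c *: B) => //; split; first exact: posdefZ.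
by rewrite detZ -/N cN mulVf // gt_eqF // posdef_det_gt0.
Qed.

Lemma capacity_ge d (V : rep R Q d) c : (forall j, s (inr j) < 0) ->
    (forall Y, (forall j, posdef (Y j)) -> c <= gaussian_ratio s V Y) ->
  c <= capacity s V.
Proof.
move=> s_neg cY; apply: lb_le_inf.
  exists (\det (bl_op V (1%:M : 'M[R]_(total_row_dim s d)))), 1%:M => //.
  by split; rewrite ?det1 //; exact: posdef1.
move=> _ [X [Xp X1] <-].
have sn0 j : (0 < sigma_neg s j)%N by rewrite /sigma_neg absz_gt0 lt_eqF.
have bp j q : tagnat.sig1 q = j ->
    posdef (conform_mx (0 : 'M[R]_(d (inr j))) (submxblock X q q)).
  by move=> e; case: j / e; rewrite conform_mx_id; exact: posdef_submxblock.
pose Y j := (sigma_neg s j)%:R^-1 *: block_sum X j.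
have Yp j : posdef (Y j).
  apply: posdefZ; first by rewrite invr_gt0 ltr0n.
  rewrite /block_sum (bigD1 (@tagnat.Rank _ (sigma_neg s) j (Ordinal (sn0 j)))) ?tagnat.Rank1K //=.
  apply: posdefD; first by apply: bp; rewrite tagnat.Rank1K.
  by apply: psd_sum => q /andP[/eqP e _]; apply: posdef_psd; exact: bp.
have XY j : block_sum X j = (sigma_neg s j)%:R *: Y j.
  by rewrite scalerA divff ?scale1r // pnatr_eq0 -lt0n.
rewrite (det_bl_op_gram V XY); apply: le_trans (cY Y Yp) _; rewrite gaussian_ratioE.
rewrite ler_pdivrMr ?gram_den_gt0 // ler_peMr //.
  by apply: gram_num_ge0 => j; exact: posdef_psd.
pose B : 'M[R]_(total_row_dim s d) := \mxdiag_(q < _) Y (tagnat.sig1 q).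
have Bp : posdef B by apply: posdef_mxdiag => q; exact: Yp.
have <- : \det B = \prod_j \det (Y j) ^+ sigma_neg s j.
  rewrite det_mxdiag; exact: (prod_tagnat_sig1 (sigma_neg s) (fun j => \det (Y j))).
have [C Cu CE] := posdef_sqrt Bp; pose D := invmx C.
(* AM-GM for [X] in the coordinates where [B] becomes the identity. Its trace there is exactly the
   size of the matrix, because [B] averages the diagonal blocks of [X]; hence [det X <= det B]. *)
have [le_det _] := psd_det_le_exp (psd_conj D (posdef_psd Xp)).
have DD : D *m D^T = \mxdiag_(q < _) invmx (Y (tagnat.sig1 q)).
  have <- : invmx B = D *m D^T.
    rewrite -CE; have CTu : C^T \in unitmx by rewrite unitmx_tr.
    apply: invmx_uniq; rewrite mulmxA -(mulmxA C^T) mulmxV // mulmx1.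
    by rewrite -trmx_mul mulVmx // trmx1.
  apply: invmx_uniq; rewrite mulmx_mxdiag -mxdiagZ; apply: eq_mxdiag => q.
  exact: (mulmxV (posdef_unit (Yp _))).
have trE : \tr (D^T *m X *m D) = (total_row_dim s d)%:R.
  rewrite -mulmxA mxtrace_mulC -mulmxA DD -[X in X *m _]submxblockK.
  rewrite mul_mxblock_mxdiag mxtrace_mxblock.
  pose F j (M : 'M[R]_(d (inr j))) := \tr (M *m invmx (Y j)).
  rewrite (sum_block_row F) total_row_dimE natr_sum; apply: eq_bigr => j _.
  transitivity (F j (block_sum X j)).
    by rewrite /F /block_sum mulmx_suml raddf_sum.
  by rewrite XY /F -scalemxAl mulmxV ?posdef_unit // mxtraceZ mxtrace1 natrM.
move: le_det; rewrite trE subrr expR0 !det_mulmx X1 mulr1 -det_mulmx => le_det.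
have dC : \det B * (\det (D^T *m D)) = 1.
  rewrite -CE !det_mulmx !det_tr /D det_inv.
  have : \det C != 0 by rewrite -unitfE -unitmxE.
  by move=> ?; field.
by rewrite -dC ler_piMr //; exact: ltW (posdef_det_gt0 Bp).
Qed.
End Components.

(** * Entrywise limits *)

Section EntrywiseLimits.
Context {R : realType} {T : Type} (F : set_system T).

Definition mx_cvg p q (A : T -> 'M[R]_(p, q)) (B : 'M[R]_(p, q)) : Prop :=
  forall i j, (fun t => A t i j) @ F --> B i j.

Section Filter.
Context {FF : Filter F}.

Lemma cvg_bigsum (I : finType) (f : I -> T -> R) (l : I -> R) (P : pred I) :
  (forall i, P i -> f i @ F --> l i) ->
  (fun t => \sum_(i | P i) f i t) @ F --> \sum_(i | P i) l i.
Proof.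
move=> fl; rewrite (_ : (fun t => _) = \sum_(i | P i) f i); last first.
  by apply/funext => t; rewrite fct_sumE.
elim/big_rec2: _ => [|i x y Pi xy]; first exact: cvg_cst.
by apply: cvgD => //; exact: fl.
Qed.

Lemma cvg_bigprod (I : finType) (f : I -> T -> R) (l : I -> R) (P : pred I) :
  (forall i, P i -> f i @ F --> l i) ->
  (fun t => \prod_(i | P i) f i t) @ F --> \prod_(i | P i) l i.
Proof.
move=> fl; rewrite (_ : (fun t => _) = \prod_(i | P i) f i); last first.
  by apply/funext => t; rewrite fct_prodE.
elim/big_rec2: _ => [|i x y Pi xy]; first exact: cvg_cst.
by apply: cvgM => //; exact: fl.
Qed.

Lemma cvg_exprn (f : T -> R) (l : R) k : f @ F --> l -> (fun t => f t ^+ k) @ F --> l ^+ k.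
Proof.
move=> fl; elim: k => [|k IHk]; first exact: cvg_cst.
by under eq_fun do rewrite exprS; rewrite exprS; exact: cvgM.
Qed.

Lemma mx_cvg_cst p q (A : 'M[R]_(p, q)) : mx_cvg (fun=> A) A.
Proof. by move=> i j; exact: cvg_cst. Qed.

Lemma mx_cvgD p q (A B : T -> 'M[R]_(p, q)) A' B' :
  mx_cvg A A' -> mx_cvg B B' -> mx_cvg (fun t => A t + B t) (A' + B').
Proof.
move=> hA hB i j; under eq_fun do rewrite mxE; rewrite mxE.
by apply: cvgD; [exact: hA|exact: hB].
Qed.

Lemma mx_cvgM p q r (A : T -> 'M[R]_(p, q)) (B : T -> 'M[R]_(q, r)) A' B' :
  mx_cvg A A' -> mx_cvg B B' -> mx_cvg (fun t => A t *m B t) (A' *m B').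
Proof.
move=> hA hB i j; under eq_fun do rewrite mxE; rewrite mxE.
by apply: cvg_bigsum => k _; apply: cvgM; [exact: hA|exact: hB].
Qed.

Lemma mx_cvgT p q (A : T -> 'M[R]_(p, q)) A' :
  mx_cvg A A' -> mx_cvg (fun t => (A t)^T) A'^T.
Proof. by move=> hA i j; under eq_fun do rewrite mxE; rewrite mxE; exact: hA. Qed.

Lemma mx_cvgZ p q (a : T -> R) (a' : R) (A : T -> 'M[R]_(p, q)) A' :
  a @ F --> a' -> mx_cvg A A' -> mx_cvg (fun t => a t *: A t) (a' *: A').
Proof.
move=> ha hA i j; under eq_fun do rewrite mxE; rewrite mxE.
by apply: cvgM => //; exact: hA.
Qed.

Lemma mx_cvg_sum p q (I : finType) (A : I -> T -> 'M[R]_(p, q)) A' (P : pred I) :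
  (forall i, P i -> mx_cvg (A i) (A' i)) ->
  mx_cvg (fun t => \sum_(i | P i) A i t) (\sum_(i | P i) A' i).
Proof.
move=> hA k l; under eq_fun do rewrite summxE; rewrite summxE.
by apply: cvg_bigsum => i Pi; exact: hA.
Qed.

Lemma cvg_mxtrace p (A : T -> 'M[R]_p) A' : mx_cvg A A' -> (fun t => \tr (A t)) @ F --> \tr A'.
Proof. by move=> hA; apply: cvg_bigsum => i _; exact: hA. Qed.

Lemma cvg_det p (A : T -> 'M[R]_p) A' : mx_cvg A A' -> (fun t => \det (A t)) @ F --> \det A'.
Proof.
move=> hA; apply: cvg_bigsum => g _; apply: cvgM; first exact: cvg_cst.
by apply: cvg_bigprod => i _; exact: hA.
Qed.

End Filter.

Lemma mx_cvg_unique {FF : ProperFilter F} p q (A : T -> 'M[R]_(p, q)) A' B' :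
  mx_cvg A A' -> mx_cvg A B' -> A' = B'.
Proof.
move=> h1 h2; apply/matrixP => i j.
exact: (cvg_unique (F := (fun t => A t i j) @ F) _ (h1 i j) (h2 i j)).
Qed.

Lemma ultra_bounded_cvg {FF : UltraFilter F} (f : T -> R) (M : R) :
  (forall t, `|f t| <= M) -> exists l : R, f @ F --> l.
Proof.
move=> fM; have := @segment_compact R (- M) M; rewrite compact_ultra.
have UF : UltraFilter (f @ F).
  split; first exact: fmap_proper_filter.
  move=> G GF FG; apply/seteqP; split => // A GA.
  have [//|FnA] := in_ultra_setVsetC (f @^-1` A) FF.
  have GnA : G (~` A) by exact: FG.
  have : G set0 by rewrite -(setICr A); exact: filterI.
  by move=> G0; case: (@filter_not_empty _ G _ G0).
move=> /(_ (f @ F) UF); case=> [|l [_ fl]]; last by exists l.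
apply: (@filterE _ F _ (f @^-1` `[- M, M]%classic)) => t.
by rewrite /= in_itv /= -ler_norml fM.
Qed.

Lemma ultra_bounded_mx_cvg {FF : UltraFilter F} p q (A : T -> 'M[R]_(p, q)) (M : R) :
  (forall t i j, `|A t i j| <= M) -> exists B, mx_cvg A B.
Proof.
move=> AM.
have h i j : exists l : R, (fun t => A t i j) @ F --> l.
  by apply: ultra_bounded_cvg => t; exact: AM.
by exists (\matrix_(i, j) sval (cid (h i j))) => i j; rewrite mxE; exact: (svalP (cid (h i j))).
Qed.

End EntrywiseLimits.

Lemma orthogonal_entry_le1 {R : realType} n (Q : 'M[R]_n) i j :
  Q *m Q^T = 1%:M -> `|Q i j| <= 1.
Proof.
move=> /matrixP/(_ i i); rewrite !mxE eqxx mulr1n => E.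
rewrite -(@ler_pXn2r _ 2) ?nnegrE // expr1n -normrX ger0_norm ?sqr_ge0 //.
rewrite -E (bigD1 j) //= mxE -expr2 lerDl sumr_ge0 // => k _.
by rewrite mxE -expr2 sqr_ge0.
Qed.

Lemma ultra_orthogonal_cvg {R : realType} T (F : set_system T) {FF : UltraFilter F} n
    (Q : T -> 'M[R]_n) : (forall t, Q t *m (Q t)^T = 1%:M) ->
  exists2 Q0, mx_cvg F Q Q0 & Q0 *m Q0^T = 1%:M.
Proof.
move=> QQ; have [Q0 h] : exists Q0, mx_cvg F Q Q0.
  apply: (@ultra_bounded_mx_cvg _ _ F FF _ _ Q 1) => t i j.
  exact: orthogonal_entry_le1.
exists Q0 => //; apply: (@mx_cvg_unique _ _ F _ _ _ (fun t => Q t *m (Q t)^T)).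
  by apply: mx_cvgM => //; exact: mx_cvgT.
by under eq_fun do rewrite QQ; exact: mx_cvg_cst.
Qed.

(* The hypothesis is applied to the normalised inverses of the perturbations [P i + e]. *)
Lemma matrix_opt {R : realType} (I : finType) (k n : I -> nat) (P : forall i, 'M[R]_(n i)) :
    (forall i, psd (P i)) -> \sum_i (k i)%:R * \tr (P i) = (\sum_i k i * n i)%:R ->
    (forall C : forall i, 'M[R]_(n i), (forall i, posdef (C i)) ->
       \prod_i \det (C i) ^+ k i = 1 ->
       (\sum_i k i * n i)%:R <= \sum_i (k i)%:R * \tr (P i *m C i)) ->
  forall i, (0 < k i)%N -> P i = 1%:M.
Proof.
move=> Pp trP opt; pose N := (\sum_i k i * n i)%N.
(* AM-GM bounds the product by 1, with equality only at the identity, so only the bound from below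
   remains to be shown. *)
have [le1] : \prod_i \det (P i) ^+ k i <= 1 /\
    (\prod_i \det (P i) ^+ k i = 1 -> forall i, (0 < k i)%N -> P i = 1%:M).
  by apply: (@matrix_AMGM _ I k n P) => //; rewrite trP natr_sum.
apply; apply/le_anti; rewrite le1 /=.
(* The [P i] may be singular, hence the shift by [e > 0], removed by letting [e] tend to 0. *)
pose Pe (e : R) i := P i + e%:M.
have Pep (e : R) i : 0 < e -> posdef (Pe e i).
  move=> e0; rewrite /Pe addrC; apply: posdefD => //; rewrite -scalemx1.
  exact/posdefZ/posdef1.
suff gep (e : R) : 0 < e -> 1 <= \prod_i \det (Pe e i) ^+ k i.
  suff lim : (fun e : R => \prod_i \det (Pe e i) ^+ k i) @ 0^'+ -->
      (\prod_i \det (P i) ^+ k i : R).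
    by apply: (cvgr_to_ge lim); near=> e; apply: gep.
  apply: cvg_bigprod => i _; apply: cvg_exprn; apply: cvg_det.
  rewrite -[P i]addr0; apply: mx_cvgD; first exact: mx_cvg_cst.
  move=> a b; under eq_fun do rewrite mxE; rewrite mxE.
  case: (a == b); last exact: cvg_cst.
  have cvg_id : (fun e : R => e) @ 0^'+ --> (0 : R) by apply: cvg_within.
  exact: cvg_id.
move=> e0; pose t := \prod_i \det (Pe e i) ^+ k i.
have t0 : 0 < t by apply: prodr_gt0 => i _; rewrite exprn_gt0 // posdef_det_gt0 //; exact: Pep.
have [N0|N0] := posnP N.
  rewrite -/t /t big1 // => i _; have [->|k0] := posnP (k i); first by rewrite expr0.
  have n0 : n i = 0%N.
    move/eqP: N0; rewrite /N sum_nat_eq0 => /forallP/(_ i) /=.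
    by rewrite muln_eq0 eqn0Ngt k0 => /eqP.
  by move: (Pe e i); rewrite n0 => M; rewrite det_mx00 expr1n.
pose al := expR (ln t / N%:R).
have al0 : 0 < al by exact: expR_gt0.
have alN : al ^+ N = t.
  by rewrite -expRM_natl mulrCA divff ?pnatr_eq0 -?lt0n // mulr1 lnK.
have det1 : \prod_i \det (al *: invmx (Pe e i)) ^+ k i = 1.
  rewrite (eq_bigr (fun i => al ^+ (k i * n i) * (\det (Pe e i) ^+ k i)^-1)).
    rewrite big_split /= prodfV -/t prodrXr alN divff // gt_eqF //.
  by move=> i _; rewrite detZ exprMn -exprM mulnC det_inv exprVn.
have al1 : 1 <= al.
  have N0' : 0 < (N%:R : R) by rewrite ltr0n.
  rewrite -(ler_pM2r N0') mul1r.
  have := opt _ (fun i => posdefZ al0 (posdef_inv (Pep e i e0))) det1.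
  move=> /le_trans; apply; rewrite natr_sum mulr_sumr; apply: ler_sum => i _.
  rewrite -scalemxAr mxtraceZ mulrCA ler_pM2l // natrM; apply: ler_wpM2l => //.
  (* In this form the trace is visibly at most [n i], which turns the hypothesis into
     [N <= al * N]. *)
  have -> : P i *m invmx (Pe e i) = 1%:M - e *: invmx (Pe e i).
    rewrite -[X in X - _](mulmxV (posdef_unit (Pep e i e0))) -mul_scalar_mx -mulmxBl.
    by rewrite /Pe addrK.
  rewrite raddfB /= mxtrace1 mxtraceZ gerBl; apply: mulr_ge0; first exact: ltW.
  exact/psd_tr_ge0/posdef_psd/posdef_inv/Pep.
by rewrite -/t -alN exprn_ege1.
Unshelve. all: by end_near. Qed.

(** * The action of GL(d) *)

Section Action.
Context {R : realType} {n m : nat} {Q : bipartite_quiver n m}.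
Context (s : 'I_n + 'I_m -> int).
Context (s_pos : forall i, 0 < s (inl i)) (s_neg : forall j, s (inr j) < 0).
Implicit Type d : 'I_n + 'I_m -> nat.

Lemma sigma_posE i : s (inl i) = sigma_pos s i.
Proof. by rewrite /sigma_pos gez0_abs // ltW. Qed.

Lemma sigma_negE j : s (inr j) = - (sigma_neg s j : int).
Proof. by rewrite /sigma_neg ltz0_abs // opprK. Qed.

Lemma sigma_pos_gt0 i : (0 < sigma_pos s i)%N.
Proof. by rewrite /sigma_pos absz_gt0 gt_eqF. Qed.

Lemma sigma_neg_gt0 j : (0 < sigma_neg s j)%N.
Proof. by rewrite /sigma_neg absz_gt0 lt_eqF. Qed.

Lemma pairingE d : pairing Q s d =
  (\sum_i sigma_pos s i * d (inl i))%N%:Z - (\sum_j sigma_neg s j * d (inr j))%N%:Z.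
Proof.
rewrite /pairing big_sumType /= !(big_morph Posz PoszD erefl) -sumrN; congr (_ + _).
  by apply: eq_bigr => i _; rewrite sigma_posE PoszM.
by apply: eq_bigr => j _; rewrite sigma_negE PoszM mulNr.
Qed.

Lemma chiE d (A : forall x : vertex Q, 'M[R]_(d x)) :
  chi Q s A = (\prod_i \det (A (inl i)) ^+ sigma_pos s i)
            / (\prod_j \det (A (inr j)) ^+ sigma_neg s j).
Proof.
rewrite /chi big_sumType /=; congr (_ * _).
  by apply: eq_bigr => i _; rewrite sigma_posE.
rewrite -prodfV; apply: eq_bigr => j _.
by rewrite sigma_negE exprnN.
Qed.

Lemma GL_det_neq0 d (A : forall x : vertex Q, 'M[R]_(d x)) x : GL A -> \det (A x) != 0.
Proof. by move=> gA; rewrite -unitfE -unitmxE; exact: gA. Qed.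

Lemma chi_neq0 d (A : forall x : vertex Q, 'M[R]_(d x)) : GL A -> chi Q s A != 0.
Proof.
move=> gA; rewrite chiE mulf_neq0 ?invr_eq0 //; apply/prodf_neq0 => x _;
  by rewrite expf_neq0 // (GL_det_neq0 _ gA).
Qed.

Definition gl_mul d (A B : forall x : vertex Q, 'M[R]_(d x)) : forall x : vertex Q, 'M[R]_(d x) :=
  fun x => A x *m B x.

Definition gl_inv d (A : forall x : vertex Q, 'M[R]_(d x)) : forall x : vertex Q, 'M[R]_(d x) :=
  fun x => invmx (A x).

Lemma GL_mul d (A B : forall x : vertex Q, 'M[R]_(d x)) : GL A -> GL B -> GL (gl_mul A B).
Proof. by move=> gA gB x; rewrite unitmx_mul gA gB. Qed.

Lemma GL_inv d (A : forall x : vertex Q, 'M[R]_(d x)) : GL A -> GL (gl_inv A).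
Proof. by move=> gA x; rewrite unitmx_inv gA. Qed.

Lemma chi_mul d (A B : forall x : vertex Q, 'M[R]_(d x)) :
  chi Q s (gl_mul A B) = chi Q s A * chi Q s B.
Proof. by rewrite /chi -big_split; apply: eq_bigr => x _; rewrite det_mulmx expfzMl. Qed.

Lemma chi_inv d (A : forall x : vertex Q, 'M[R]_(d x)) : chi Q s (gl_inv A) = (chi Q s A)^-1.
Proof. by rewrite /chi -prodfV; apply: eq_bigr => x _; rewrite det_inv exprz_inv -invr_expz. Qed.

Lemma act_mul d (A B : forall x : vertex Q, 'M[R]_(d x)) (V : rep R Q d) : GL A -> GL B ->
  act (gl_mul A B) V = act A (act B V).
Proof.
move=> gA gB; apply: functional_extensionality_dep => a; rewrite /act /gl_mul.
rewrite -!mulmxA; congr (_ *m (_ *m (_ *m _))); apply: invmx_uniq.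
by rewrite mulmxA -(mulmxA (A _)) mulmxV // mulmx1 mulmxV.
Qed.

Lemma actK d (A : forall x : vertex Q, 'M[R]_(d x)) (V : rep R Q d) : GL A ->
  act (gl_inv A) (act A V) = V.
Proof.
move=> gA; apply: functional_extensionality_dep => a; rewrite /act /gl_inv.
by rewrite invmxK !mulmxA mulVmx // mul1mx -mulmxA mulVmx // mulmx1.
Qed.

Lemma gram_act d (V : rep R Q d) (A : forall x : vertex Q, 'M[R]_(d x)) Y i :
  gram s (act A V) Y i = (invmx (A (inl i)))^T *m
    gram s V (fun j => (A (inr j))^T *m Y j *m A (inr j)) i *m invmx (A (inl i)).
Proof.
rewrite /gram mulmx_sumr mulmx_suml; apply: eq_bigr => j _.
rewrite -scalemxAr -scalemxAl; congr (_ *: _).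
rewrite mulmx_sumr mulmx_suml; apply: eq_bigr => a _.
by rewrite comp_mx_act !trmx_mul !mulmxA.
Qed.

Lemma cogram_act d (V : rep R Q d) (A : forall x : vertex Q, 'M[R]_(d x)) Z j :
  cogram s (act A V) Z j = A (inr j) *m
    cogram s V (fun i => invmx (A (inl i)) *m Z i *m (invmx (A (inl i)))^T) j *m (A (inr j))^T.
Proof.
rewrite /cogram mulmx_sumr mulmx_suml; apply: eq_bigr => i _.
rewrite -scalemxAr -scalemxAl; congr (_ *: _).
rewrite mulmx_sumr mulmx_suml; apply: eq_bigr => a _.
by rewrite comp_mx_act !trmx_mul !mulmxA.
Qed.

Lemma ratio_act d (V : rep R Q d) (A : forall x : vertex Q, 'M[R]_(d x)) Y : GL A ->
  gaussian_ratio s (act A V) Y =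
  gaussian_ratio s V (fun j => (A (inr j))^T *m Y j *m A (inr j)) / chi Q s A ^+ 2.
Proof.
move=> gA; rewrite !gaussian_ratioE chiE.
set Y' := (fun j => _ *m _).
rewrite (eq_bigr (fun i => (\det (A (inl i)) ^+ sigma_pos s i) ^- 2 *
    \det (gram s V Y' i) ^+ sigma_pos s i)); last first.
  move=> i _; rewrite gram_act !det_mulmx det_tr !det_inv mulrAC -expr2 exprMn.
  by rewrite -!exprM exprVn mulnC.
rewrite [X in _ = _ / X / _](eq_bigr (fun j => (\det (A (inr j)) ^+ sigma_neg s j) ^+ 2 *
    \det (Y j) ^+ sigma_neg s j)); last first.
  move=> j _; rewrite /Y' !det_mulmx det_tr mulrAC -expr2 exprMn.
  by rewrite -!exprM mulnC.
rewrite !big_split /= prodfV !prodrXl.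
set a := \prod_i _ ^+ _; set b := \prod_j \det (A _) ^+ _.
have a0 : a != 0 by apply/prodf_neq0 => i _; rewrite expf_neq0 // (GL_det_neq0 _ gA).
have b0 : b != 0 by apply/prodf_neq0 => i _; rewrite expf_neq0 // (GL_det_neq0 _ gA).
set y := \prod_(j < m) \det (Y j) ^+ _; set g := \prod_(i < n) _ ^+ _.
have [->|y0] := eqVneq y 0; first by rewrite !(mulr0, invr0, mul0r).
by field; rewrite a0 b0 y0.
Qed.

Lemma posdef_act d (A : forall x : vertex Q, 'M[R]_(d x)) (Y : forall j, 'M[R]_(d (inr j))) :
  GL A -> (forall j, posdef (Y j)) -> forall j, posdef ((A (inr j))^T *m Y j *m A (inr j)).
Proof. by move=> gA Yp j; exact: posdef_conj. Qed.

Lemma total_dimE d : pairing Q s d = 0 -> total_row_dim s d = total_col_dim s d.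
Proof. exact: total_dim_eq. Qed.

(** Congruence by [A] permutes the positive definite tuples and changes all ratios by the same
    factor. One inequality suffices, applied to [A] and to its inverse. *)
Lemma capacity_act d (V : rep R Q d) (A : forall x : vertex Q, 'M[R]_(d x)) :
  pairing Q s d = 0 -> GL A -> capacity s (act A V) = capacity s V / chi Q s A ^+ 2.
Proof.
move=> sd0 gA.
have le B (W : rep R Q d) : GL B -> capacity s W / chi Q s B ^+ 2 <= capacity s (act B W).
  move=> gB; apply: capacity_ge => // Y Yp; rewrite ratio_act // ler_pM2r.
    by apply: capacity_le; [exact: total_dimE|exact: posdef_act].
  by rewrite invr_gt0 exprn_even_gt0 //= chi_neq0.
apply/le_anti; rewrite le // andbT.
have := le (gl_inv A) (act A V) (GL_inv gA); rewrite actK // chi_inv.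
by rewrite exprVn invrK -ler_pdivlMr ?exprn_even_gt0 //= chi_neq0.
Qed.

(** Cyclicity of the trace; it trades a condition on the sources for one on the sinks. *)
Lemma gram_cogram d (V : rep R Q d) Y Z :
  \sum_i (sigma_pos s i)%:R * \tr (gram s V Y i *m Z i) =
  \sum_j (sigma_neg s j)%:R * \tr (Y j *m cogram s V Z j).
Proof.
transitivity (\sum_i \sum_j \sum_a (sigma_pos s i)%:R * (sigma_neg s j)%:R *
    \tr ((comp_mx V i j a)^T *m Y j *m comp_mx V i j a *m Z i)).
  apply: eq_bigr => i _; rewrite /gram mulmx_suml raddf_sum mulr_sumr.
  apply: eq_bigr => j _ /=; rewrite -scalemxAl mxtraceZ mulmx_suml raddf_sum mulrA mulr_sumr.
  exact: eq_bigr.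
rewrite exchange_big; apply: eq_bigr => j _ /=.
rewrite /cogram mulmx_sumr raddf_sum mulr_sumr; apply: eq_bigr => i _ /=.
rewrite -scalemxAr mxtraceZ mulrA [X in _ = X * _]mulrC mulmx_sumr raddf_sum mulr_sumr.
apply: eq_bigr => a _; congr (_ * _).
by rewrite -!mulmxA mxtrace_mulC -!mulmxA.
Qed.

Lemma cogram_psd d (V : rep R Q d) Z j : (forall i, psd (Z i)) -> psd (cogram s V Z j).
Proof.
move=> Zp; apply: psd_sum => i _; apply: psdZ; rewrite ?ler0n //.
by apply: psd_sum => a _; rewrite -{1}(trmxK (comp_mx V i j a)); exact: psd_conj.
Qed.

(** Roots of the gram matrices at the sources and of [Y] at the sinks make the first geometric
    identity hold; the second is the first-order condition of minimality, extracted by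
    [matrix_opt]. *)
Lemma extremiser_geometrizing d (V : rep R Q d) Y :
    pairing Q s d = 0 -> 0 < capacity s V -> gaussian_extremiser s V Y ->
  exists A, geometrizing s V A /\ forall j, Y j = (A (inr j))^T *m A (inr j).
Proof.
move=> sd0 D0 [Yp DY].
have num_neq0 : \prod_i \det (gram s V Y i) ^+ sigma_pos s i != 0.
  by move: D0; rewrite DY gaussian_ratioE; apply: contraTneq => ->; rewrite mul0r ltxx.
have Gp i : posdef (gram s V Y i).
  apply: psd_det_neq0; first by apply: psd_gram_rep => j; exact: posdef_psd.
  move/prodf_neq0: num_neq0 => /(_ i isT).
  by rewrite expf_eq0 sigma_pos_gt0.
pose A (x : vertex Q) : 'M[R]_(d x) := match x with
  | inl i => s2val (cid2 (posdef_sqrt (Gp i)))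
  | inr j => s2val (cid2 (posdef_sqrt (Yp j))) end.
have gA : GL A by case=> i; [exact: (s2valP (cid2 (posdef_sqrt (Gp i))))|exact: (s2valP (cid2 (posdef_sqrt (Yp i))))].
have Al i : (A (inl i))^T *m A (inl i) = gram s V Y i.
  exact: (s2valP' (cid2 (posdef_sqrt (Gp i)))).
have Ar j : (A (inr j))^T *m A (inr j) = Y j.
  exact: (s2valP' (cid2 (posdef_sqrt (Yp j)))).
exists A; split=> //; split=> //; apply/geometricE => //.
have gram1 i : gram s (act A V) (fun=> 1%:M) i = 1%:M.
  rewrite gram_act (_ : (fun j => _) = Y); last first.
    by apply: functional_extensionality_dep => j; rewrite mulmx1 Ar.
  rewrite -Al mulmxA -trmx_mul -mulmxA !mulmxV ?gA // trmx1 mul1mx //.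
have eqN : (\sum_j sigma_neg s j * d (inr j) = \sum_i sigma_pos s i * d (inl i))%N.
  by rewrite -total_row_dimE total_dimE // total_col_dimE.
split=> // j; apply: (@matrix_opt _ _ (sigma_neg s) (fun j => d (inr j))
  (cogram s (act A V) (fun=> 1%:M))) (sigma_neg_gt0 j).
- by move=> k; apply: cogram_psd => i; exact/posdef_psd/posdef1.
- have := gram_cogram (act A V) (fun=> 1%:M) (fun=> 1%:M).
  under [in X in _ = X]eq_bigr do rewrite mul1mx.
  move=> <-; rewrite eqN natr_sum; apply: eq_bigr => i _.
  by rewrite gram1 mulmx1 mxtrace1 natrM.
(* If the trace were below the total dimension, AM-GM would bound the numerator of the ratio at [C]
   by 1. Minimality bounds it below by 1, so equality holds and the gram matrices at [C] are
   identities, whose weighted trace is the total dimension itself. *)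
move=> C Cp C1; rewrite leNgt; apply/negP => lt_tr.
have ge1 : 1 <= \prod_i \det (gram s (act A V) C i) ^+ sigma_pos s i.
  have rI : gaussian_ratio s (act A V) (fun=> 1%:M) = 1.
    rewrite gaussian_ratioE !big1 ?divr1 // => i _; rewrite ?gram1 det1 expr1n //.
  have := capacity_le (act A V) (total_dimE sd0) Cp.
  rewrite capacity_act // [gaussian_ratio _ _ C]gaussian_ratioE C1 divr1; apply: le_trans.
  rewrite DY -rI ratio_act //; rewrite (_ : (fun j => _) = Y) //.
  by apply: functional_extensionality_dep => k; rewrite mulmx1 Ar.
have trE : \sum_i (sigma_pos s i)%:R * \tr (gram s (act A V) C i) =
    \sum_j (sigma_neg s j)%:R * \tr (cogram s (act A V) (fun=> 1%:M) j *m C j).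
  have := gram_cogram (act A V) C (fun=> 1%:M).
  under eq_bigr do rewrite mulmx1.
  by move=> ->; apply: eq_bigr => k _; rewrite mxtrace_mulC.
have Gp' i : psd (gram s (act A V) C i) by apply: psd_gram_rep => k; exact: posdef_psd.
have [|le1 eq1] := matrix_AMGM (k := sigma_pos s) Gp'.
  by rewrite trE -natr_sum -eqN ltW.
have /eq1 G1 : \prod_i \det (gram s (act A V) C i) ^+ sigma_pos s i = 1.
  by apply/le_anti; rewrite le1.
move: lt_tr; rewrite -trE eqN natr_sum.
rewrite (eq_bigr (fun i => (sigma_pos s i * d (inl i))%:R)) ?ltxx // => i _.
by rewrite G1 ?sigma_pos_gt0 // mxtrace1 natrM.
Qed.
End Action.

(** * Gaussian ratios of geometric data *)

Section WeightedAMGM.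
Context {R : realType} (I : finType).

Lemma ln_le_sub1 (x : R) : 0 < x -> ln x <= x - 1.
Proof. by move=> x0; have := @le_ln1Dx R (x - 1); rewrite [1 + _]addrC subrK; apply; rewrite ltrBrDr addNr. Qed.

Lemma ln_eq_sub1 (x : R) : 0 < x -> ln x = x - 1 -> x = 1.
Proof.
move=> x0 E; apply/eqP; apply: contra_eqT (lnK x0) => x1; rewrite E gt_eqF //.
by have := @expR_gt1Dx R (x - 1); rewrite subr_eq0 addrC subrK; apply.
Qed.

(** Gibbs' variational inequality: the lower bound is the [w]-average of [ln y] minus the relative
    entropy of [w] with respect to [p]. The [p] need not sum to 1, as is the case for perturbations
    of geometric data. *)
Lemma weighted_AMGM (w p y : I -> R) : (forall t, 0 <= w t) -> \sum_t w t = 1 ->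
    (forall t, 0 <= p t) -> (forall t, 0 < w t -> 0 < p t) -> (forall t, 0 < y t) ->
  0 < \sum_t p t * y t /\
  \sum_t w t * ln (y t) + \sum_t w t * ln (p t / w t) <= ln (\sum_t p t * y t).
Proof.
move=> w0 w1 p0 wp y0; set S := \sum_t p t * y t.
have S0 : 0 < S.
  have [t wt] : exists t, 0 < w t.
    apply: contrapT => h; suff : \sum_t w t = 0 by rewrite w1 => /eqP; rewrite oner_eq0.
    apply: big1 => t _; apply/eqP; rewrite eq_le w0 andbT leNgt.
    by apply/negP => wt; apply: h; exists t.
  rewrite /S (bigD1 t) //= ltr_pwDl ?mulr_gt0 ?wp // sumr_ge0 // => u _.
  by rewrite mulr_ge0 // ltW.
split=> //; rewrite -big_split /=.
(* The corrections [p y / S - w] add up to 0 and make the inequality hold term by term, through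
   [ln z <= z - 1]. *)
have -> : ln S = \sum_t (w t * ln S + (p t * y t / S - w t)).
  by rewrite big_split sumrB /= -!mulr_suml w1 mul1r -/S divff ?gt_eqF // subrr addr0.
apply: ler_sum => t _; have [wt0|wt0] := eqVneq (w t) 0.
  by rewrite wt0 !mul0r addr0 add0r subr0 divr_ge0 ?mulr_ge0 // ltW.
have wt : 0 < w t by rewrite lt_def wt0 w0.
have pt := wp t wt; have yt := y0 t.
rewrite -mulrDr -lnM ?posrE ?divr_gt0 //.
have -> : p t * y t / S - w t = w t * (y t * (p t / w t) / S - 1).
  by field; rewrite wt0 gt_eqF.
rewrite -mulrDr ler_wpM2l //.
have -> : y t * (p t / w t) = S * (y t * (p t / w t) / S) by field; rewrite wt0 gt_eqF.
rewrite lnM ?posrE ?divr_gt0 ?mulr_gt0 ?invr_gt0 //.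
rewrite lerD2l [S * _]mulrC divfK ?gt_eqF //.
by apply: ln_le_sub1; rewrite ?divr_gt0 ?mulr_gt0 ?invr_gt0.
Qed.

(** Equality case: with [z = y / S], the nonnegative terms [w (z - 1 - ln z)] have sum at most 0 by
    hypothesis, so each vanishes. *)
Lemma weighted_AMGM_eq (w y : I -> R) : (forall t, 0 <= w t) -> \sum_t w t = 1 ->
    (forall t, 0 < y t) -> ln (\sum_t w t * y t) <= \sum_t w t * ln (y t) ->
  forall t, 0 < w t -> y t = \sum_t w t * y t.
Proof.
move=> w0 w1 y0; set S := \sum_t w t * y t => le_S.
have [S0 _] := weighted_AMGM w0 w1 w0 (fun t h => h) y0.
have sum0 : \sum_t w t * (y t / S - 1 - ln (y t / S)) = 0.
  apply/le_anti/andP; split; last first.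
    apply: sumr_ge0 => t _; rewrite mulr_ge0 // subr_ge0 ln_le_sub1 // divr_gt0 //.
  have -> : \sum_t w t * (y t / S - 1 - ln (y t / S)) =
      (\sum_t w t * y t) / S - \sum_t w t - (\sum_t w t * ln (y t) - \sum_t w t * ln S).
    rewrite mulr_suml -!sumrB; apply: eq_bigr => t _.
    by rewrite ln_div ?posrE //; ring.
  rewrite -/S divff ?gt_eqF // w1 subrr sub0r opprB -mulr_suml w1 mul1r.
  by rewrite subr_le0.
move=> t wt; apply/eqP.
move/eqP: sum0; rewrite psumr_eq0 => [/allP/(_ t (mem_index_enum _))|u _]; last first.
  by rewrite mulr_ge0 // subr_ge0 ln_le_sub1 // divr_gt0.
rewrite mulf_eq0 gt_eqF //= subr_eq0 => /eqP/esym/ln_eq_sub1.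
by rewrite divr_gt0 // => /(_ isT) E; rewrite -(divfK (lt0r_neq0 S0) (y t)) E mul1r.
Qed.
End WeightedAMGM.

(** * Chosen diagonalisations of symmetric matrices *)

Section EigenFrame.
Context {R : realType} {n : nat}.
Implicit Type X : 'M[R]_n.

Definition eigen_spec X (p : 'M[R]_n * 'rV[R]_n) : Prop :=
  p.1 *m p.1^T = 1%:M /\ X = p.1^T *m diag_mx p.2 *m p.1.

(** A fixed choice of diagonalisation, so that frames and eigenvalues become functions of the
    matrix; the default value is met only for matrices that are not symmetric. *)
Definition eigen_pair X := xget (1%:M, 0) (eigen_spec X).
Definition eigen_frame X := (eigen_pair X).1.
Definition eigen_value X k := (eigen_pair X).2 0 k.

Lemma eigen_pairP X : X^T = X -> eigen_spec X (eigen_pair X).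
Proof.
move=> /symmetric_spectral[Q [y [QQ _ XE]]].
by apply: (@xgetPex _ _ (eigen_spec X)); exists (Q, y).
Qed.

Lemma eigen_frameP X : X^T = X -> eigen_frame X *m (eigen_frame X)^T = 1%:M.
Proof. by move=> /eigen_pairP[]. Qed.

Lemma eigen_frameE X : X^T = X ->
  X = (eigen_frame X)^T *m diag_mx (\row_k eigen_value X k) *m eigen_frame X.
Proof.
move=> /eigen_pairP[_ XE]; rewrite [LHS]XE; congr (_ *m diag_mx _ *m _).
by apply/rowP => k; rewrite mxE.
Qed.

Lemma eigen_value_gt0 X k : posdef X -> 0 < eigen_value X k.
Proof.
move=> Xp; have Xs : X^T = X by case: Xp.
have QQ := eigen_frameP Xs; have := eigen_frameE Xs.
set y := (\row_k _) => XE; have := quad_spectral y k QQ; rewrite -XE mxE => <-.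
case: Xp => _; apply; apply/eqP => /(congr1 (mulmx (eigen_frame X))).
rewrite mulmxA QQ mul1mx mulmx0 => /matrixP/(_ k 0)/eqP.
by rewrite !mxE !eqxx oner_eq0.
Qed.

Lemma eigen_det X : X^T = X -> \det X = \prod_k eigen_value X k.
Proof.
move=> Xs; rewrite {1}(eigen_frameE Xs) det_spectral ?eigen_frameP //.
by apply: eq_bigr => k _; rewrite mxE.
Qed.

End EigenFrame.

(** * Doubly stochastic weights in orthonormal frames *)

Section Frames.
Context {R : realType} {n m : nat} {Q : bipartite_quiver n m}.
Context (s : 'I_n + 'I_m -> int).
Context (s_pos : forall i, 0 < s (inl i)) (s_neg : forall j, s (inr j) < 0).
Implicit Type d : 'I_n + 'I_m -> nat.

(* Squared entries of the arrow matrices in orthonormal frames of the [V(w_j)] and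
   [V(v_i)]. *)
Definition frame_wt d (V : rep R Q d) (B : forall j, 'M[R]_(d (inr j)))
    (E : forall i, 'M[R]_(d (inl i))) i j k l : R :=
  \sum_a (B j *m comp_mx V i j a *m (E i)^T) k l ^+ 2.

Arguments frame_wt {d} V B E i j k l.

Lemma frame_wt_ge0 d (V : rep R Q d) B E i j k l : 0 <= frame_wt V B E i j k l.
Proof. by apply: sumr_ge0 => a _; rewrite sqr_ge0. Qed.

Lemma gram_frame d (V : rep R Q d) B E (y : forall j, 'rV[R]_(d (inr j))) i l :
  (E i *m gram s V (fun j => (B j)^T *m diag_mx (y j) *m B j) i *m (E i)^T) l l =
  \sum_j \sum_k (sigma_neg s j)%:R * frame_wt V B E i j k l * y j 0 k.
Proof.
rewrite /gram mulmx_sumr mulmx_suml summxE; apply: eq_bigr => j _.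
rewrite -scalemxAr -scalemxAl mxE mulmx_sumr mulmx_suml summxE.
under [RHS]eq_bigr do rewrite -mulrA; rewrite -mulr_sumr; congr (_ * _).
transitivity (\sum_a \sum_k (B j *m comp_mx V i j a *m (E i)^T) k l ^+ 2 * y j 0 k).
  apply: eq_bigr => a _; set M := B j *m _ *m _.
  have -> : E i *m ((comp_mx V i j a)^T *m ((B j)^T *m diag_mx (y j) *m B j) *m comp_mx V i j a)
      *m (E i)^T = M^T *m diag_mx (y j) *m M by rewrite /M !trmx_mul !trmxK !mulmxA.
  rewrite mxE; apply: eq_bigr => k _; rewrite mul_mx_diag !mxE.
  by rewrite mulrAC -expr2.
by rewrite exchange_big; apply: eq_bigr => k _; rewrite mulr_suml.
Qed.

Lemma cogram_frame d (V : rep R Q d) B E j k : (forall i, (E i)^T *m E i = 1%:M) ->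
  (B j *m cogram s V (fun=> 1%:M) j *m (B j)^T) k k =
  \sum_i \sum_l (sigma_pos s i)%:R * frame_wt V B E i j k l.
Proof.
move=> EE; rewrite /cogram mulmx_sumr mulmx_suml summxE; apply: eq_bigr => i _.
rewrite -scalemxAr -scalemxAl mxE mulmx_sumr mulmx_suml summxE -mulr_sumr; congr (_ * _).
rewrite exchange_big; apply: eq_bigr => a _.
set M := B j *m _ *m (E i)^T.
have -> : B j *m (comp_mx V i j a *m 1%:M *m (comp_mx V i j a)^T) *m (B j)^T = M *m M^T.
  by rewrite /M !trmx_mul !trmxK mulmx1 !mulmxA -[in RHS](mulmxA _ (E i)^T) EE mulmx1.
rewrite [LHS]mxE; apply: eq_bigr => l _.
by rewrite [X in _ * X]mxE expr2.
Qed.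

Definition geometric_rep d (V : rep R Q d) : Prop :=
  (forall i, gram s V (fun=> 1%:M) i = 1%:M) /\
  (forall j, cogram s V (fun=> 1%:M) j = 1%:M).

(** A diagonal entry of the first geometric identity in the frame [E]. With [frame_wt_sum_in], which
    comes from the second identity, it makes the array doubly stochastic up to multiplicities. *)
Lemma frame_wt_sum_out d (V : rep R Q d) B E i l : geometric_rep V ->
  (forall j, B j *m (B j)^T = 1%:M) -> (forall i, E i *m (E i)^T = 1%:M) ->
  \sum_j \sum_k (sigma_neg s j)%:R * frame_wt V B E i j k l = 1.
Proof.
move=> [g1 _] BB EE; have := gram_frame V B E (fun=> const_mx 1) l.
rewrite (_ : (fun j => _) = (fun=> 1%:M)); last first.
  apply: functional_extensionality_dep => j.
  by rewrite diag_const_mx mulmx1 (mulmx1C (BB j)).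
rewrite g1 mulmx1 EE mxE eqxx => /esym E1; rewrite -[RHS]E1.
by apply: eq_bigr => j _; apply: eq_bigr => k _; rewrite mxE mulr1.
Qed.

Lemma frame_wt_sum_in d (V : rep R Q d) B E j k : geometric_rep V ->
  (forall j, B j *m (B j)^T = 1%:M) -> (forall i, E i *m (E i)^T = 1%:M) ->
  \sum_i \sum_l (sigma_pos s i)%:R * frame_wt V B E i j k l = 1.
Proof.
move=> [_ g2] BB EE; rewrite -cogram_frame => [|i]; last exact: mulmx1C.
by rewrite g2 mulmx1 BB mxE eqxx.
Qed.

(** Minus a weighted relative entropy; for weights taken in frames it involves no eigenvalue, and it
    vanishes at [p = w]. *)
Definition frame_err d (w p : forall i j, 'I_(d (inr j)) -> 'I_(d (inl i)) -> R) : R :=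
  \sum_i \sum_l \sum_j \sum_k
    (sigma_pos s i)%:R * ((sigma_neg s j)%:R * w i j k l * ln (p i j k l / w i j k l)).

Lemma gram_symmetric d (V : rep R Q d) Y i :
  (forall j, posdef (Y j)) -> (gram s V Y i)^T = gram s V Y i.
Proof. by move=> Yp; case: (psd_gram_rep s V i (fun j => posdef_psd (Yp j))). Qed.

(** In the eigenframe of the gram matrix itself the eigenvalues are diagonal entries, and
    [gram_frame] writes these as weighted sums of the eigenvalues of the [Y j]. *)
Lemma gram_eigenE d (V : rep R Q d) Y i l : (forall j, posdef (Y j)) ->
  eigen_value (gram s V Y i) l = \sum_j \sum_k (sigma_neg s j)%:R *
    frame_wt V (fun j => eigen_frame (Y j)) (fun i => eigen_frame (gram s V Y i)) i j k l *
    eigen_value (Y j) k.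
Proof.
move=> Yp; set B := (fun j => eigen_frame _); set E := (fun i => eigen_frame _).
have := gram_frame V B E (fun j => \row_k eigen_value (Y j) k) l.
rewrite (_ : (fun j => _) = Y); last first.
  apply: functional_extensionality_dep => j.
  by rewrite -eigen_frameE //; case: (Yp j).
have Gs := gram_symmetric V i Yp.
have EE : E i *m (E i)^T = 1%:M by exact: eigen_frameP.
rewrite {1}(eigen_frameE Gs) !mulmxA EE mul1mx -mulmxA EE mulmx1.
rewrite !mxE eqxx mulr1n => ->; apply: eq_bigr => j _; apply: eq_bigr => k _.
by rewrite mxE.
Qed.

Lemma ln_prod (I : finType) (f : I -> R) : (forall t, 0 < f t) ->
  ln (\prod_t f t) = \sum_t ln (f t).
Proof.
move=> f0; apply: (@expR_inj R); rewrite lnK ?posrE ?prodr_gt0 // expR_sum.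
by apply: eq_bigr => t _; rewrite lnK ?posrE.
Qed.

Lemma ln_ratio d (V : rep R Q d) Y : (forall j, posdef (Y j)) ->
    (forall i l, 0 < eigen_value (gram s V Y i) l) ->
  0 < gaussian_ratio s V Y /\
  ln (gaussian_ratio s V Y) =
    \sum_i \sum_l (sigma_pos s i)%:R * ln (eigen_value (gram s V Y i) l) -
    \sum_j \sum_k (sigma_neg s j)%:R * ln (eigen_value (Y j) k).
Proof.
move=> Yp g0; have y0 j k : 0 < eigen_value (Y j) k by exact: eigen_value_gt0.
have numE : \prod_i \det (gram s V Y i) ^+ sigma_pos s i =
    \prod_i \prod_l eigen_value (gram s V Y i) l ^+ sigma_pos s i.
  by apply: eq_bigr => i _; rewrite eigen_det ?gram_symmetric // prodrXl.
have denE : \prod_j \det (Y j) ^+ sigma_neg s j =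
    \prod_j \prod_k eigen_value (Y j) k ^+ sigma_neg s j.
  by apply: eq_bigr => j _; rewrite eigen_det ?prodrXl //; case: (Yp j).
have num0 : 0 < \prod_i \det (gram s V Y i) ^+ sigma_pos s i.
  rewrite numE; apply: prodr_gt0 => i _; apply: prodr_gt0 => l _.
  by rewrite exprn_gt0.
have den0 := gram_den_gt0 s Yp.
rewrite gaussian_ratioE; split; first exact: divr_gt0.
rewrite ln_div ?posrE // numE denE; congr (_ - _).
  rewrite ln_prod => [|i]; last by apply: prodr_gt0 => l _; rewrite exprn_gt0.
  apply: eq_bigr => i _; rewrite ln_prod => [|l]; last by rewrite exprn_gt0.
  by apply: eq_bigr => l _; rewrite lnXn ?mulr_natl.
rewrite ln_prod => [|j]; last by apply: prodr_gt0 => k _; rewrite exprn_gt0.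
apply: eq_bigr => j _; rewrite ln_prod => [|k]; last by rewrite exprn_gt0.
by apply: eq_bigr => k _; rewrite lnXn ?mulr_natl.
Qed.

(** Double stochasticity spreads a sum over the sinks, such as the logarithm of the denominator of a
    ratio, over the sources, where it is compared term by term with the numerator. *)
Lemma sum_frame_wt d (V : rep R Q d) B E (f : forall j, 'I_(d (inr j)) -> R) :
    geometric_rep V ->
    (forall j, B j *m (B j)^T = 1%:M) -> (forall i, E i *m (E i)^T = 1%:M) ->
  \sum_j \sum_k (sigma_neg s j)%:R * f j k =
  \sum_i \sum_l (sigma_pos s i)%:R *
    \sum_j \sum_k (sigma_neg s j)%:R * frame_wt V B E i j k l * f j k.
Proof.
move=> g BB EE; symmetry.
transitivity (\sum_i \sum_l \sum_j \sum_k
    (sigma_neg s j)%:R * f j k * ((sigma_pos s i)%:R * frame_wt V B E i j k l)).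
  apply: eq_bigr => i _; apply: eq_bigr => l _; rewrite mulr_sumr.
  by apply: eq_bigr => j _; rewrite mulr_sumr; apply: eq_bigr => k _; ring.
transitivity (\sum_j \sum_k \sum_i \sum_l
    (sigma_neg s j)%:R * f j k * ((sigma_pos s i)%:R * frame_wt V B E i j k l)).
  under eq_bigr do rewrite exchange_big.
  rewrite exchange_big; apply: eq_bigr => j _.
  under eq_bigr do rewrite exchange_big.
  by rewrite exchange_big.
apply: eq_bigr => j _; apply: eq_bigr => k _.
transitivity ((sigma_neg s j)%:R * f j k *
    \sum_i \sum_l (sigma_pos s i)%:R * frame_wt V B E i j k l); last first.
  by rewrite frame_wt_sum_in // mulr1.
by rewrite mulr_sumr; apply: eq_bigr => i _; rewrite mulr_sumr.
Qed.

(** The weighted AM-GM inequality at one source basis vector [(i, l)]: the weights come from the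
    geometric [V0], the sum from a perturbed array [p]. The last clause is the equality case. *)
Lemma frame_key d (V0 : rep R Q d) B0 E0 i l
    (p : forall j, 'I_(d (inr j)) -> R) (y : forall j, 'I_(d (inr j)) -> R) :
    geometric_rep V0 ->
    (forall j, B0 j *m (B0 j)^T = 1%:M) -> (forall i, E0 i *m (E0 i)^T = 1%:M) ->
  let w j k := frame_wt V0 B0 E0 i j k l in
  (forall j k, 0 < y j k) -> (forall j k, 0 <= p j k) ->
  (forall j k, 0 < w j k -> 0 < p j k) ->
  let S := \sum_j \sum_k (sigma_neg s j)%:R * p j k * y j k in
  let T := \sum_j \sum_k (sigma_neg s j)%:R * w j k * ln (y j k) in
  [/\ 0 < S, T + \sum_j \sum_k (sigma_neg s j)%:R * w j k * ln (p j k / w j k) <= ln S &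
      (forall j k, p j k = w j k) -> ln S <= T -> forall j k, 0 < w j k -> y j k = S].
Proof.
move=> g0 BB EE w y0 p0 wp S T.
pose I : finType := {j : 'I_m & 'I_(d (inr j))}.
have sumI (f : forall j, 'I_(d (inr j)) -> R) :
    \sum_j \sum_k f j k = \sum_(t : I) f (tag t) (tagged t).
  by rewrite (sig_big_dep xpredT (fun _ => xpredT) (fun j k => f j k)).
have sn0 j : 0 < (sigma_neg s j)%:R :> R by rewrite ltr0n sigma_neg_gt0.
pose w' (t : I) := (sigma_neg s (tag t))%:R * w (tag t) (tagged t).
pose p' (t : I) := (sigma_neg s (tag t))%:R * p (tag t) (tagged t).
pose y' (t : I) := y (tag t) (tagged t).
have w'0 t : 0 <= w' t by rewrite mulr_ge0 ?ler0n ?frame_wt_ge0.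
have w'1 : \sum_t w' t = 1.
  rewrite -(sumI (fun j k => (sigma_neg s j)%:R * w j k)).
  exact: frame_wt_sum_out.
have p'0 t : 0 <= p' t by rewrite mulr_ge0 ?ler0n.
have w'p' t : 0 < w' t -> 0 < p' t by rewrite /w' /p' !pmulr_rgt0 //; exact: wp.
have y'0 t : 0 < y' t by exact: y0.
have [S0 le] := weighted_AMGM w'0 w'1 p'0 w'p' y'0.
have SE : S = \sum_t p' t * y' t by rewrite /S sumI.
split; first by rewrite SE.
  rewrite SE; apply: le_trans le; rewrite /T !sumI lerD2l; apply: ler_sum => t _.
  have [w0|w0] := eqVneq (w (tag t) (tagged t)) 0; first by rewrite /w' w0 mulr0 !mul0r.
  rewrite /w' /p' (_ : _ / (_ * _) = p (tag t) (tagged t) / w (tag t) (tagged t)) //.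
  by field; rewrite w0 gt_eqF.
move=> pw leT j k wjk; have Sw : S = \sum_t w' t * y' t.
  by rewrite SE; apply: eq_bigr => t _; rewrite /p' pw.
rewrite Sw; apply: (weighted_AMGM_eq w'0 w'1 y'0 _ (t := Tagged _ k)).
  by rewrite -Sw (le_trans leT) // /T sumI.
by rewrite /w' /= mulr_gt0.
Qed.

(** Only [V0] is geometric, and that is enough for the eigenvalues of [Y] to cancel; the lower bound
    is therefore uniform in them. *)
Lemma ratio_frame_ge d (V0 V : rep R Q d) B0 E0 Y :
  geometric_rep V0 ->
  (forall j, B0 j *m (B0 j)^T = 1%:M) -> (forall i, E0 i *m (E0 i)^T = 1%:M) ->
  (forall j, posdef (Y j)) ->
  let B j := eigen_frame (Y j) in let E i := eigen_frame (gram s V Y i) in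
  (forall i j k l, 0 < frame_wt V0 B0 E0 i j k l -> 0 < frame_wt V B E i j k l) ->
  0 < gaussian_ratio s V Y /\
  frame_err (frame_wt V0 B0 E0) (frame_wt V B E) <= ln (gaussian_ratio s V Y).
Proof.
move=> g0 BB0 EE0 Yp B E wp.
have y0 j k : 0 < eigen_value (Y j) k by exact: eigen_value_gt0.
have key i l := frame_key g0 BB0 EE0 y0 (fun j k => frame_wt_ge0 V B E k l)
  (fun j k => wp i j k l).
have g_gt0 i l : 0 < eigen_value (gram s V Y i) l.
  by rewrite gram_eigenE //; case: (key i l).
have [r0 ->] := ln_ratio Yp g_gt0; split=> //.
rewrite (sum_frame_wt _ g0 BB0 EE0) lerBrDl /frame_err -!big_split /=.
apply: ler_sum => i _; rewrite -!big_split /=; apply: ler_sum => l _.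
have [_ le _] := key i l.
rewrite [X in _ + X](_ : _ = (sigma_pos s i)%:R * \sum_j \sum_k (sigma_neg s j)%:R *
    frame_wt V0 B0 E0 i j k l * ln (frame_wt V B E i j k l / frame_wt V0 B0 E0 i j k l)).
  by rewrite -mulrDr ler_wpM2l ?ler0n // gram_eigenE.
by rewrite mulr_sumr; apply: eq_bigr => j _; rewrite mulr_sumr.
Qed.

Lemma geometric_ratio_ge1 d (V : rep R Q d) Y : geometric_rep V ->
  (forall j, posdef (Y j)) -> 1 <= gaussian_ratio s V Y.
Proof.
move=> g Yp; have BB j : eigen_frame (Y j) *m (eigen_frame (Y j))^T = 1%:M.
  by apply: eigen_frameP; case: (Yp j).
have EE i : eigen_frame (gram s V Y i) *m (eigen_frame (gram s V Y i))^T = 1%:M.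
  by apply: eigen_frameP; exact: gram_symmetric.
(* With [V0 = V] and the same frames on both sides, the error term vanishes. *)
have [r0] := ratio_frame_ge (V := V) g BB EE Yp (fun _ _ _ _ h => h).
rewrite /frame_err big1 => [|i _]; last first.
  rewrite big1 // => l _; rewrite big1 // => j _; rewrite big1 // => k _.
  set w := frame_wt _ _ _ _ _ _ _; have [->|w0] := eqVneq w 0.
    by rewrite mulr0 mul0r mulr0.
  by rewrite divff // ln1 !mulr0.
by rewrite -[X in X <= _]ln1 ler_ln ?posrE.
Qed.

Lemma geometric_ratio1 d (V : rep R Q d) : geometric_rep V ->
  gaussian_ratio s V (fun=> 1%:M) = 1.
Proof.
move=> [g1 _]; rewrite gaussian_ratioE !big1 ?divr1 // => i _.
  by rewrite det1 expr1n.
by rewrite g1 det1 expr1n.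
Qed.

Lemma capacity_geometric d (V : rep R Q d) : pairing Q s d = 0 -> geometric_rep V ->
  capacity s V = 1.
Proof.
move=> sd0 g; apply/le_anti/andP; split.
  rewrite -(geometric_ratio1 g); apply: capacity_le; first exact: (total_dimE s_pos s_neg sd0).
  by move=> j; exact: posdef1.
by apply: capacity_ge => // Y; exact: geometric_ratio_ge1.
Qed.

(* Equality case of the weighted AM-GM inequality: in eigenbases, an entry of an arrow
   matrix that does not vanish joins equal eigenvalues. *)
Lemma geometric_ratio_eq1 d (V : rep R Q d) Y : geometric_rep V ->
    (forall j, posdef (Y j)) -> gaussian_ratio s V Y = 1 ->
  forall i j a, Y j *m comp_mx V i j a = comp_mx V i j a *m gram s V Y i.
Proof.
move=> g Yp r1.
pose B j := eigen_frame (Y j); pose E i := eigen_frame (gram s V Y i).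
have Ys j : (Y j)^T = Y j by case: (Yp j).
have BB j : B j *m (B j)^T = 1%:M by exact: eigen_frameP.
have Gs i := gram_symmetric V i Yp.
have EE i : E i *m (E i)^T = 1%:M by exact: eigen_frameP.
have y0 j k : 0 < eigen_value (Y j) k by exact: eigen_value_gt0.
have key i l := frame_key g BB EE y0 (fun j k => frame_wt_ge0 V B E k l)
  (fun j k h => h) (i := i) (l := l).
have g_gt0 i l : 0 < eigen_value (gram s V Y i) l.
  by rewrite gram_eigenE //; case: (key i l).
have [r0] := ln_ratio Yp g_gt0.
rewrite r1 ln1 (sum_frame_wt _ g BB EE) -sumrB => /esym sum0.
(* The terms are nonnegative and, the ratio being 1, add up to 0; hence AM-GM is an equality at
   every [(i, l)]. *)
have term_ge0 i l : 0 <= (sigma_pos s i)%:R * ln (eigen_value (gram s V Y i) l) -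
    (sigma_pos s i)%:R * \sum_j \sum_k
      (sigma_neg s j)%:R * frame_wt V B E i j k l * ln (eigen_value (Y j) k).
  rewrite -mulrBr mulr_ge0 ?ler0n // subr_ge0 gram_eigenE //.
  have [_ + _] := key i l; apply: le_trans.
  rewrite lerDl sumr_ge0 // => j _; rewrite sumr_ge0 // => k _.
  set w := frame_wt _ _ _ _ _ _ _; have [->|w0] := eqVneq w 0.
    by rewrite mulr0 mul0r.
  by rewrite divff // ln1 mulr0.
have eq_val i j k l : 0 < frame_wt V B E i j k l ->
    eigen_value (Y j) k = eigen_value (gram s V Y i) l.
  have [_ _ /(_ (fun _ _ => erefl)) eqS] := key i l.
  rewrite gram_eigenE //; apply: eqS.
  rewrite -gram_eigenE // -subr_le0.
  have sp0 : 0 < (sigma_pos s i)%:R :> R by rewrite ltr0n sigma_pos_gt0.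
  rewrite -(pmulr_rle0 _ sp0) mulrBr.
  move/eqP: sum0; rewrite psumr_eq0 => [/allP/(_ i (mem_index_enum _))|i' _]; last first.
    by rewrite -sumrB sumr_ge0.
  rewrite -sumrB psumr_eq0 // => /allP/(_ l (mem_index_enum _)) /eqP ->; exact: lexx.
move=> i j a; set M := comp_mx V i j a.
have [N ND] : exists N : 'M[R]_(d (inr j), d (inl i)), N = B j *m M *m (E i)^T.
  by exists (B j *m M *m (E i)^T).
have NE : diag_mx (\row_k eigen_value (Y j) k) *m N =
    N *m diag_mx (\row_l eigen_value (gram s V Y i) l).
  apply/matrixP => k l; rewrite mul_diag_mx mul_mx_diag [LHS]mxE [RHS]mxE.
  rewrite [X in X * _ = _]mxE [X in _ = _ * X]mxE.
  have [->|N0] := eqVneq (N k l) 0; first by rewrite mul0r mulr0.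
  rewrite mulrC (eq_val i j k l) // /frame_wt (bigD1 a) //= ltr_pwDl //.
    by rewrite -/M -ND lt_def sqrf_eq0 N0 sqr_ge0.
  by rewrite sumr_ge0 // => b _; rewrite sqr_ge0.
have BB' := mulmx1C (BB j); have EE' := mulmx1C (EE i).
have ME : M = (B j)^T *m N *m E i.
  by rewrite ND !mulmxA BB' mul1mx -mulmxA EE' mulmx1.
rewrite {1}(eigen_frameE (Ys j)) {1}ME (eigen_frameE (Gs i)) -/(B j) -/(E i).
rewrite ME -!mulmxA; congr (_ *m _).
rewrite (mulmxA (B j)) BB mul1mx !mulmxA NE -!mulmxA; congr (_ *m _).
by rewrite [in RHS]mulmxA EE mul1mx.
Qed.

Lemma cvg_ln T (F : set_system T) {FF : Filter F} (f : T -> R) (l : R) : 0 < l ->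
  f @ F --> l -> (fun t => ln (f t)) @ F --> (ln l : R).
Proof. by move=> l0 fl; apply: continuous_cvg => //; exact: continuous_ln. Qed.

Lemma cvg_gram T (F : set_system T) {FF : Filter F} d (V : T -> rep R Q d) (W : rep R Q d) Y i :
  (forall i j a, mx_cvg F (fun t => comp_mx (V t) i j a) (comp_mx W i j a)) ->
  mx_cvg F (fun t => gram s (V t) Y i) (gram s W Y i).
Proof.
move=> VW; apply: mx_cvg_sum => j _; apply: mx_cvgZ; first exact: cvg_cst.
apply: mx_cvg_sum => a _; apply: mx_cvgM => //; apply: mx_cvgM; last exact: mx_cvg_cst.
exact: mx_cvgT.
Qed.

Lemma cvg_frame_wt T (F : set_system T) {FF : Filter F} d (V : T -> rep R Q d) (W : rep R Q d)
    B B0 E E0 i j k l :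
  (forall i j a, mx_cvg F (fun t => comp_mx (V t) i j a) (comp_mx W i j a)) ->
  (forall j, mx_cvg F (fun t => B t j) (B0 j)) ->
  (forall i, mx_cvg F (fun t => E t i) (E0 i)) ->
  (fun t => frame_wt (V t) (B t) (E t) i j k l) @ F --> (frame_wt W B0 E0 i j k l : R).
Proof.
move=> VW BB EE; apply: cvg_bigsum => a _; apply: cvg_exprn.
by apply: mx_cvgM; [apply: mx_cvgM|apply: mx_cvgT].
Qed.

(* The gaussian ratios of the [V t] are bounded below by an expression in squared entries in
   orthonormal frames, which tends to 1 as the frames converge along an ultrafilter. *)
Lemma capacity_limit_geometric T (F : set_system T) {FF : ProperFilter F} d
    (V : T -> rep R Q d) (W : rep R Q d) c :
    pairing Q s d = 0 -> geometric_rep W ->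
    (forall i j a, mx_cvg F (fun t => comp_mx (V t) i j a) (comp_mx W i j a)) ->
    (forall t, capacity s (V t) = c) ->
  c = 1.
Proof.
move=> sd0 gW VW Vc; apply/le_anti/andP; split.
  (* Upper bound: the identity is a competitor for each [V t], and its ratio tends to 1. *)
  have lim : (fun t => gaussian_ratio s (V t) (fun=> 1%:M)) @ F -->
      (gaussian_ratio s W (fun=> 1%:M) : R).
    under eq_fun do rewrite gaussian_ratioE.
    rewrite gaussian_ratioE; apply: cvgM; last exact: cvg_cst.
    by apply: cvg_bigprod => i _; apply: cvg_exprn; apply: cvg_det; exact: cvg_gram.
  rewrite -(geometric_ratio1 gW).
  apply: (cvgr_to_ge lim); near=> t; rewrite -(Vc t).
  apply: capacity_le; first exact: (total_dimE s_pos s_neg sd0).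
  by move=> j; exact: posdef1.
rewrite leNgt; apply/negP => c1.
have [G [UG FG]] := ultraFilterLemma FF.
(* If [c < 1], every [V t] has a tuple with ratio below the midpoint [(c + 1) / 2], which is itself
   below 1. *)
have /choice[Y YP] : forall t, exists Y : forall j, 'M[R]_(d (inr j)),
    (forall j, posdef (Y j)) /\ gaussian_ratio s (V t) Y < (c + 1) / 2.
  move=> t; apply: contrapT => h.
  suff : (c + 1) / 2 <= capacity s (V t) by rewrite Vc leNgt; case/negP; lra.
  apply: capacity_ge => // Y Yp; rewrite leNgt; apply/negP => lt.
  by apply: h; exists Y.
have Yp t j : posdef (Y t j) by case: (YP t).
pose B t j := eigen_frame (Y t j); pose E t i := eigen_frame (gram s (V t) (Y t) i).
have [B0 B0P] : exists B0 : forall j, 'M[R]_(d (inr j)),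
    forall j, mx_cvg G (fun t => B t j) (B0 j) /\ B0 j *m (B0 j)^T = 1%:M.
  have h j : exists2 B0, mx_cvg G (fun t => B t j) B0 & B0 *m B0^T = 1%:M.
    by apply: ultra_orthogonal_cvg => t; apply: eigen_frameP; case: (Yp t j).
  exists (fun j => s2val (cid2 (h j))) => j.
  by split; [exact: (s2valP (cid2 (h j)))|exact: (s2valP' (cid2 (h j)))].
have [E0 E0P] : exists E0 : forall i, 'M[R]_(d (inl i)),
    forall i, mx_cvg G (fun t => E t i) (E0 i) /\ E0 i *m (E0 i)^T = 1%:M.
  have h i : exists2 E0, mx_cvg G (fun t => E t i) E0 & E0 *m E0^T = 1%:M.
    by apply: ultra_orthogonal_cvg => t; apply: eigen_frameP; apply: gram_symmetric => j.
  exists (fun i => s2val (cid2 (h i))) => i.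
  by split; [exact: (s2valP (cid2 (h i)))|exact: (s2valP' (cid2 (h i)))].
have VW' i j a : mx_cvg G (fun t => comp_mx (V t) i j a) (comp_mx W i j a).
  by move=> k l A /VW; exact: FG.
have wtc i j k l : (fun t => frame_wt (V t) (B t) (E t) i j k l) @ G -->
    (frame_wt W B0 E0 i j k l : R).
  apply: cvg_frame_wt => //; first by move=> j'; case: (B0P j').
  by move=> i'; case: (E0P i').
have err0 : (fun t => frame_err (frame_wt W B0 E0) (frame_wt (V t) (B t) (E t))) @ G --> (0 : R).
  rewrite (_ : 0 = frame_err (frame_wt W B0 E0) (frame_wt W B0 E0)); last first.
    rewrite /frame_err big1 // => i _; rewrite big1 // => l _; rewrite big1 // => j _.
    rewrite big1 // => k _.
    set w := frame_wt _ _ _ _ _ _ _; have [->|w0] := eqVneq w 0.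
      by rewrite mulr0 mul0r mulr0.
    by rewrite divff // ln1 !mulr0.
  apply: cvg_bigsum => i _; apply: cvg_bigsum => l _; apply: cvg_bigsum => j _.
  apply: cvg_bigsum => k _; apply: cvgM; first exact: cvg_cst.
  (* Terms whose limit weight is 0 vanish identically; in the others the argument of the logarithm
     tends to 1. *)
  have [w0|w0] := eqVneq (frame_wt W B0 E0 i j k l) 0.
    by under eq_fun do rewrite w0 mulr0 mul0r; rewrite w0 mulr0 mul0r; exact: cvg_cst.
  apply: cvgM; first exact: cvg_cst.
  apply: cvg_ln; first by rewrite divff // ltr01.
  by apply: cvgM; [exact: wtc|exact: cvg_cst].
have pos_near : \forall t \near G, forall i j k l,
    0 < frame_wt W B0 E0 i j k l -> 0 < frame_wt (V t) (B t) (E t) i j k l.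
  apply: filter_forall => i; apply: filter_forall => j; apply: filter_forall => k.
  apply: filter_forall => l; have [w0|w0] := ltP 0 (frame_wt W B0 E0 i j k l).
    by near=> t => _; near: t; apply: (cvgr_gt _ (wtc i j k l)).
  by apply: filterE.
have : 0 <= ln ((c + 1) / 2).
  apply: (cvgr_to_le err0); near=> t.
  have BB0 j : B0 j *m (B0 j)^T = 1%:M by case: (B0P j).
  have EE0 i : E0 i *m (E0 i)^T = 1%:M by case: (E0P i).
  have [|r0 le] := ratio_frame_ge (V := V t) gW BB0 EE0 (Yp t); first by near: t.
  apply: le_trans le _; rewrite ler_ln ?posrE //; first by case: (YP t) => _ /ltW.
  by case: (YP t) => _; apply: lt_trans.
rewrite leNgt ln_lt0 //.
have c0 : 0 <= c.
  have [t _] := @filter_ex _ F _ setT filterT.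
  rewrite -(Vc t); apply: capacity_ge => // Z Zp; exact: ratio_ge0.
by apply/andP; split; lra.
Unshelve. all: by end_near. Qed.

End Frames.

Arguments frame_wt {R n m Q d} V B E i j k l.

(** * Geometric data are polystable *)

Section Projections.
Context {R : realType}.

Lemma tr_gramE p q (N : 'M[R]_(p, q)) : \tr (N^T *m N) = \sum_l \sum_k N k l ^+ 2.
Proof.
apply: eq_bigr => l _; rewrite mxE; apply: eq_bigr => k _.
by rewrite mxE expr2.
Qed.

Lemma tr_gram_ge0 p q (N : 'M[R]_(p, q)) : 0 <= \tr (N^T *m N).
Proof. by rewrite tr_gramE; apply: sumr_ge0 => l _; apply: sumr_ge0 => k _; rewrite sqr_ge0. Qed.

Lemma tr_gram_eq0 p q (N : 'M[R]_(p, q)) : \tr (N^T *m N) = 0 -> N = 0.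
Proof.
rewrite tr_gramE => /eqP; rewrite psumr_eq0 => [/allP h|l _]; last first.
  by apply: sumr_ge0 => k _; rewrite sqr_ge0.
apply/matrixP => k l; rewrite mxE; apply/eqP; rewrite -sqrf_eq0.
have /eqP := h l (mem_index_enum _) => /eqP; rewrite psumr_eq0 => [/allP/(_ k (mem_index_enum _))|k' _] //.
by rewrite sqr_ge0.
Qed.

Definition orth_proj k (U : {vspace 'cV[R]_k}) (p : 'M[R]_k) : Prop :=
  [/\ p^T = p, p *m p = p, forall u, (u \in U) = (p *m u == u) & \tr p = (\dim U)%:R].

(** The formula [B (B^T B)^-1 B^T], where the columns of [B] form a basis of [U]. *)
Lemma orth_projP k (U : {vspace 'cV[R]_k}) : exists p, orth_proj U p.
Proof.
pose r := \dim U; pose b := vbasis U.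
pose B : 'M[R]_(k, r) := \matrix_(i, j) (tnth b j) i 0.
have BE (c : 'cV[R]_r) : B *m c = \sum_j c j 0 *: tnth b j.
  apply/matrixP => i z; rewrite (ord1 z) mxE summxE; apply: eq_bigr => j _.
  by rewrite !mxE mulrC.
have BU (c : 'cV[R]_r) : B *m c \in U.
  rewrite BE memv_suml // => j _; rewrite memvZ //.
  by apply: vbasis_mem; exact: mem_tnth.
have Binj (c : 'cV[R]_r) : B *m c = 0 -> c = 0.
  rewrite BE => c0; have /basis_free/freeP bf := vbasisP U.
  apply/matrixP => j z; rewrite (ord1 z) mxE; apply: (bf (fun j => c j 0)).
  by rewrite -[RHS]c0; apply: eq_bigr => j' _; rewrite (tnth_nth 0).
have Bsurj u : u \in U -> exists c : 'cV[R]_r, u = B *m c.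
  move=> uU; exists (\col_j coord b j u); rewrite BE {1}(coord_vbasis uU).
  by apply: eq_bigr => j _; rewrite mxE (tnth_nth 0).
pose G := B^T *m B.
have Gp : posdef G.
  split=> [|c c0]; first by rewrite /G trmx_mul trmxK.
  have := sqnorm_gt0 (B *m c); rewrite trmx_mul !mulmxA => ->.
  by apply: contra_neq c0 => /Binj.
have Gu := posdef_unit Gp; have Gs : G^T = G by case: Gp.
pose p := B *m invmx G *m B^T.
have pB : p *m B = B by rewrite /p -!mulmxA mulVmx // mulmx1.
exists p; split.
- by rewrite /p !trmx_mul trmxK trmx_inv Gs mulmxA.
- by rewrite {2}/p !mulmxA pB.
- move=> u; apply/idP/eqP => [/Bsurj[c ->]|<-]; first by rewrite mulmxA pB.
  by rewrite /p -!mulmxA; exact: BU.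
- by rewrite /p mxtrace_mulC mulmxA mulmxV // mxtrace1.
Qed.

(** The columns of [B] are an orthonormal basis of the image: a column basis of [p], corrected by
    the inverse of a root of its Gram matrix. *)
Lemma proj_factor k (p : 'M[R]_k) : p^T = p -> p *m p = p ->
  exists B : 'M[R]_(k, \rank p), B *m B^T = p /\ B^T *m B = 1%:M.
Proof.
move=> ps pp; pose B0 := col_base p.
have B0E : B0 *m row_base p = p by rewrite mulmx_base.
have /row_freeP[D RD] := row_base_free p.
have B0f (c : 'cV[R]_(\rank p)) : B0 *m c = 0 -> c = 0.
  have /row_freeP[C BC] : row_free B0^T by rewrite /row_free mxrank_tr; exact: col_base_full p.
  have CB : C^T *m B0 = 1%:M by rewrite -[B0]trmxK -trmx_mul BC trmx1.
  by move=> h; rewrite -[c]mul1mx -CB -mulmxA h mulmx0.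
have Gp : posdef (B0^T *m B0).
  split=> [|c c0]; first by rewrite trmx_mul trmxK.
  have := sqnorm_gt0 (B0 *m c); rewrite trmx_mul !mulmxA => ->.
  by apply: contra_neq c0 => /B0f.
have [A Au AE] := posdef_sqrt Gp.
exists (B0 *m invmx A); rewrite trmx_mul.
have BB : (invmx A)^T *m B0^T *m (B0 *m invmx A) = 1%:M.
  rewrite mulmxA -(mulmxA (invmx A)^T B0^T B0) -AE mulmxA -trmx_mul mulmxV // trmx1.
  by rewrite mul1mx mulmxV.
split=> //; set q := _ *m _.
have qs : q^T = q by rewrite /q !trmx_mul !trmxK !mulmxA.
have pq : p *m q = q.
  have pB0 : p *m B0 = B0.
    have B0D : p *m D = B0.
      transitivity (B0 *m row_base p *m D); first by rewrite B0E.
      by rewrite -mulmxA RD mulmx1.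
    by rewrite -B0D mulmxA pp.
  by rewrite /q -(mulmxA B0) (mulmxA p) pB0.
have qB0 : q *m B0 = B0.
  have -> : q *m B0 = B0 *m invmx A *m ((invmx A)^T *m B0^T *m (B0 *m invmx A)) *m A.
    by rewrite /q !mulmxA mulmxKV.
  by rewrite BB mulmx1 mulmxKV.
have qp : q *m p = p.
  transitivity (q *m (B0 *m row_base p)); first by rewrite B0E.
  by rewrite mulmxA qB0 B0E.
by have := congr1 trmx qp; rewrite trmx_mul ps qs pq.
Qed.
End Projections.

Section Subrepresentations.
Context {R : realType} {n m : nat} {Q : bipartite_quiver n m}.
Context (s : 'I_n + 'I_m -> int).
Context (s_pos : forall i, 0 < s (inl i)) (s_neg : forall j, s (inr j) < 0).
Implicit Type d : 'I_n + 'I_m -> nat.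

Lemma is_subrep_comp d (V : rep R Q d) (U : forall x : vertex Q, {vspace 'cV[R]_(d x)}) :
  is_subrep V U <->
  forall i j a u, u \in U (inl i) -> comp_mx V i j a *m u \in U (inr j).
Proof.
split=> [h|h a u uU]; last by have := h (src a) (snk a) a u; rewrite comp_mx_arrow; apply.
apply: (@comp_mx_ind _ _ _ _ _ _ V V
  (fun i j M _ => forall u, u \in U (inl i) -> M *m u \in U (inr j))) => //.
by move=> i j u _; rewrite mul0mx mem0v.
Qed.

Lemma orth_proj_subrep d (V : rep R Q d) (U : forall x : vertex Q, {vspace 'cV[R]_(d x)})
    (p : forall x : vertex Q, 'M[R]_(d x)) :
  (forall x, orth_proj (U x) (p x)) -> is_subrep V U ->
  forall i j a, p (inr j) *m comp_mx V i j a *m p (inl i) = comp_mx V i j a *m p (inl i).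
Proof.
move=> hp /is_subrep_comp hU i j a; apply/matrixP => k l.
have [_ ppv memv _] := hp (inl i); have [_ _ memw _] := hp (inr j).
have : p (inl i) *m delta_mx l (0 : 'I_1) \in U (inl i) by rewrite memv mulmxA ppv.
move=> /(hU i j a); rewrite memw => /eqP/matrixP/(_ k 0).
by rewrite !mulmxA -!colE !mxE.
Qed.

Definition pair_form d (V : rep R Q d) (F : forall i j, 'M[R]_(d (inr j), d (inl i)) -> R) : R :=
  \sum_i \sum_j \sum_a (sigma_pos s i)%:R * (sigma_neg s j)%:R * F i j (comp_mx V i j a).

Lemma tr_gram1 d (V : rep R Q d) (Z : forall i, 'M[R]_(d (inl i))) :
  \sum_i (sigma_pos s i)%:R * \tr (gram s V (fun=> 1%:M) i *m Z i) =
  pair_form V (fun i j M => \tr (M^T *m M *m Z i)).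
Proof.
apply: eq_bigr => i _; rewrite /gram mulmx_suml raddf_sum mulr_sumr.
apply: eq_bigr => j _ /=; rewrite -scalemxAl mxtraceZ mulmx_suml raddf_sum mulrA mulr_sumr.
by apply: eq_bigr => a _; rewrite mulmx1.
Qed.

Lemma tr_cogram1 d (V : rep R Q d) (Y : forall j, 'M[R]_(d (inr j))) :
  \sum_j (sigma_neg s j)%:R * \tr (Y j *m cogram s V (fun=> 1%:M) j) =
  pair_form V (fun i j M => \tr (Y j *m M *m M^T)).
Proof.
rewrite /pair_form exchange_big; apply: eq_bigr => j _.
rewrite /cogram mulmx_sumr raddf_sum mulr_sumr; apply: eq_bigr => i _ /=.
rewrite -scalemxAr mxtraceZ mulrA [X in X * _ = _]mulrC mulmx_sumr raddf_sum mulr_sumr.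
by apply: eq_bigr => a _; rewrite mulmx1 mulmxA.
Qed.

(** Since [p M p = M p] on a subrepresentation, minus its weight is the weighted sum of the squared
    norms of the blocks [p M (1 - p)]. Weight 0 kills these blocks, and then [p] commutes with the
    arrows. *)
Lemma geometric_subrep d (V : rep R Q d) U (p : forall x : vertex Q, 'M[R]_(d x)) :
    geometric_rep s V -> is_subrep V U -> (forall x, orth_proj (U x) (p x)) ->
  pairing Q s (subdim U) <= 0 /\
  (pairing Q s (subdim U) = 0 -> is_hom V V p).
Proof.
move=> [g1 g2] hU hp; have pV := orth_proj_subrep hp hU.
pose D i j (M : 'M[R]_(d (inr j), d (inl i))) := p (inr j) *m M *m (1%:M - p (inl i)).
have E : (\sum_j sigma_neg s j * \dim (U (inr j)))%:R -
    (\sum_i sigma_pos s i * \dim (U (inl i)))%:R =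
    pair_form V (fun i j M => \tr ((D i j M)^T *m D i j M)) :> R.
  have -> : (\sum_j sigma_neg s j * \dim (U (inr j)))%:R =
      pair_form V (fun i j M => \tr (p (inr j) *m M *m M^T)).
    rewrite -tr_cogram1 natr_sum; apply: eq_bigr => j _.
    by rewrite g2 mulmx1 natrM; case: (hp (inr j)) => _ _ _ ->.
  have -> : (\sum_i sigma_pos s i * \dim (U (inl i)))%:R =
      pair_form V (fun i j M => \tr (M^T *m M *m p (inl i))).
    rewrite -(tr_gram1 V (fun i => p (inl i))) natr_sum; apply: eq_bigr => i _.
    by rewrite g1 mul1mx natrM; case: (hp (inl i)) => _ _ _ ->.
  rewrite /pair_form -sumrB; apply: eq_bigr => i _; rewrite -sumrB; apply: eq_bigr => j _.
  rewrite -sumrB; apply: eq_bigr => a _; rewrite -mulrBr; congr (_ * _).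
  have [ps pp _ _] := hp (inl i); have [qs qq _ _] := hp (inr j).
  set M := comp_mx V i j a.
  have MM : M^T *m M *m p (inl i) = M^T *m p (inr j) *m M *m p (inl i).
    by rewrite -!mulmxA; congr (_ *m _); rewrite mulmxA pV.
  have r1 : (1%:M - p (inl i))^T = 1%:M - p (inl i) by rewrite trmxB trmx1 ps.
  have r2 : (1%:M - p (inl i)) *m (1%:M - p (inl i)) = 1%:M - p (inl i).
    by rewrite mulmxBr mulmx1 mulmxBl mul1mx pp subrr subr0.
  rewrite /D !trmx_mul r1 qs.
  rewrite [RHS](_ : _ = \tr (M^T *m p (inr j) *m M *m (1%:M - p (inl i)))); last first.
    transitivity (\tr (M^T *m p (inr j) *m (p (inr j) *m M *m
      ((1%:M - p (inl i)) *m (1%:M - p (inl i)))))).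
      by rewrite -(mulmxA (1%:M - p (inl i))) mxtrace_mulC -!mulmxA.
    by rewrite r2 !mulmxA -(mulmxA M^T) qq.
  rewrite mulmxBr mulmx1 raddfB /= -MM; congr (_ - _).
  by rewrite -mulmxA mxtrace_mulC -!mulmxA mxtrace_mulC !mulmxA.
have term_ge0 i j a : 0 <= (sigma_pos s i)%:R * (sigma_neg s j)%:R *
    \tr ((D i j (comp_mx V i j a))^T *m D i j (comp_mx V i j a)).
  by rewrite mulr_ge0 ?mulr_ge0 ?ler0n ?tr_gram_ge0.
have pE := pairingE (Q := Q) s_pos s_neg (subdim U).
split.
  rewrite pE subr_le0 lez_nat -(ler_nat R) -subr_ge0 E.
  by do 3!(apply: sumr_ge0 => ? _).
rewrite pE => /subr0_eq []; rewrite /subdim => eqd.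
move: E; rewrite -eqd subrr => /esym/eqP; rewrite /pair_form.
rewrite psumr_eq0 => [/allP h|? _]; last by do 2!(apply: sumr_ge0 => ? _).
apply/is_hom_comp => i j a.
have := h i (mem_index_enum _); rewrite /= psumr_eq0 => [/allP h1|? _]; last first.
  by apply: sumr_ge0 => ? _.
have := h1 j (mem_index_enum _); rewrite /= psumr_eq0 // => /allP/(_ a (mem_index_enum _)).
rewrite !mulf_eq0 !pnatr_eq0 !gtn_eqF ?sigma_pos_gt0 ?sigma_neg_gt0 //=.
move=> /eqP/tr_gram_eq0; rewrite /D mulmxBr mulmx1 pV => /subr0_eq //.
Qed.

Lemma geometric_semistable d (V : rep R Q d) : pairing Q s d = 0 -> geometric_rep s V ->
  semistable Q s V.
Proof.
move=> sd0 g; split=> // U hU.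
have h x := orth_projP (U x).
by have [] := geometric_subrep g hU (fun x => svalP (cid (h x))).
Qed.
End Subrepresentations.

(** * Isomorphisms and direct sums *)

Section Isomorphisms.
Context {R : realType} {n m : nat} {Q : bipartite_quiver n m}.
Context (s : 'I_n + 'I_m -> int).
Implicit Type d : 'I_n + 'I_m -> nat.

Lemma isomorphic_refl d (V : rep R Q d) : isomorphic V V.
Proof. by exists (fun=> 1%:M), (fun=> 1%:M); split=> [a|x|x]; rewrite ?mul1mx ?mulmx1. Qed.

Lemma isomorphic_sym d e (V : rep R Q d) (W : rep R Q e) : isomorphic V W -> isomorphic W V.
Proof.
move=> [f [g [fh gf fg]]]; exists g, f; split=> // a.
by rewrite -[LHS]mulmx1 -(fg (tl a)) mulmxA -(mulmxA (g _)) -fh mulmxA gf mul1mx.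
Qed.

Lemma isomorphic_trans d e h (V : rep R Q d) (W : rep R Q e) (Z : rep R Q h) :
  isomorphic V W -> isomorphic W Z -> isomorphic V Z.
Proof.
move=> [f [g [fh gf fg]]] [f' [g' [fh' gf' fg']]].
exists (fun x => f' x *m f x), (fun x => g x *m g' x); split=> [a|x|x].
- by rewrite -mulmxA fh mulmxA fh' mulmxA.
- by rewrite mulmxA -(mulmxA (g x)) gf' mulmx1 gf.
- by rewrite mulmxA -(mulmxA (f' x)) fg mulmx1 fg'.
Qed.

Lemma isomorphic_act d (A : forall x : vertex Q, 'M[R]_(d x)) (V : rep R Q d) : GL A ->
  isomorphic V (act A V).
Proof.
move=> gA; exists A, (fun x => invmx (A x)); split=> [a|x|x].
- by rewrite /act mulmxKV.
- by rewrite mulVmx.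
- by rewrite mulmxV.
Qed.

Lemma isomorphic_dim d e (V : rep R Q d) (W : rep R Q e) : isomorphic V W -> d = e.
Proof.
move=> [f [g [_ gf fg]]]; apply/funext => x; apply/eqP; rewrite eqn_leq.
have := mulmx1_min (gf x); rewrite (mulmx1_min (fg x)) andbT; exact.
Qed.

Lemma isomorphic_dsum (V1 W1 V2 W2 : some_rep R Q) :
  isomorphic (projT2 V1) (projT2 W1) -> isomorphic (projT2 V2) (projT2 W2) ->
  isomorphic (projT2 (dsum V1 V2)) (projT2 (dsum W1 W2)).
Proof.
move=> [f [g [fh gf fg]]] [f' [g' [fh' gf' fg']]].
exists (fun x => block_mx (f x) 0 0 (f' x)), (fun x => block_mx (g x) 0 0 (g' x)).
split=> [a|x|x] /=; rewrite !mulmx_block !mulmx0 !mul0mx !addr0 !add0r.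
- by rewrite fh fh'.
- by rewrite gf gf' -scalar_mx_block.
- by rewrite fg fg' -scalar_mx_block.
Qed.

Lemma polystable_iso d e (V : rep R Q d) (W : rep R Q e) :
  isomorphic V W -> polystable Q s V -> polystable Q s W.
Proof.
move=> VW [k [Z [Zs VZ]]]; exists k, Z; split=> //.
exact: isomorphic_trans (isomorphic_sym VW) VZ.
Qed.

Lemma polystable_zero d (V : rep R Q d) : (forall x, d x = 0%N) -> polystable Q s V.
Proof.
move=> d0; exists 0%N, (fun i => zero_rep R Q); split=> [[]//|].
rewrite big_ord0 /=; exists (fun x => 0), (fun x => 0); split=> [a|x|x].
- by apply/matrixP => -[].
- by apply/matrixP => i; have := ltn_ord i; rewrite {2}d0.
- by apply/matrixP => -[].
Qed.

Lemma polystable_dsum (V1 V2 : some_rep R Q) : stable Q s (projT2 V1) ->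
  polystable Q s (projT2 V2) -> polystable Q s (projT2 (dsum V1 V2)).
Proof.
move=> st1 [k [W [Ws V2W]]].
exists k.+1, (fun i => oapp W V1 (unlift ord0 i)); split.
  by move=> i; case: (unliftP ord0 i) => [j _|_] //=.
rewrite big_ord_recl unlift_none /=.
rewrite (eq_bigr W) => [|i _]; last by rewrite liftK.
by apply: isomorphic_dsum => //; exact: isomorphic_refl.
Qed.
End Isomorphisms.

(** * Orthogonal splitting of geometric data *)

Section GeometricPolystable.
Context {R : realType} {n m : nat} {Q : bipartite_quiver n m}.
Context (s : 'I_n + 'I_m -> int).
Context (s_pos : forall i, 0 < s (inl i)) (s_neg : forall j, s (inr j) < 0).
Implicit Type d : 'I_n + 'I_m -> nat.

(** For isometries [B] this is [V] cut down to the column spaces, written in orthonormal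
    coordinates. *)
Definition compress d (V : rep R Q d) e (B : forall x : vertex Q, 'M[R]_(d x, e x)) : rep R Q e :=
  fun a => (B (hd a))^T *m V a *m B (tl a).

Lemma comp_mx_compress d (V : rep R Q d) e (B : forall x : vertex Q, 'M[R]_(d x, e x)) i j a :
  comp_mx (compress V B) i j a = (B (inr j))^T *m comp_mx V i j a *m B (inl i).
Proof.
move: i j a; apply: (@comp_mx_ind _ _ _ _ _ _ (compress V B) V
  (fun i j M N => M = (B (inr j))^T *m N *m B (inl i))) => // i j.
by rewrite mulmx0 mul0mx.
Qed.

(** As [B B^T] commutes with the arrows, it can be moved next to an outer factor [B] and absorbed
    there by [B^T B = 1]. *)
Lemma compress_geometric d (V : rep R Q d) e (B : forall x : vertex Q, 'M[R]_(d x, e x)) :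
    geometric_rep s V -> (forall x, (B x)^T *m B x = 1%:M) ->
    is_hom V V (fun x => B x *m (B x)^T) ->
  geometric_rep s (compress V B).
Proof.
move=> [g1 g2] BB /is_hom_comp hB; split=> [i|j].
  transitivity ((B (inl i))^T *m gram s V (fun=> 1%:M) i *m B (inl i)); last first.
    by rewrite g1 mulmx1.
  rewrite /gram mulmx_sumr mulmx_suml; apply: eq_bigr => j _.
  rewrite -scalemxAr -scalemxAl; congr (_ *: _).
  rewrite mulmx_sumr mulmx_suml; apply: eq_bigr => a _.
  rewrite comp_mx_compress !mulmx1 !trmx_mul !trmxK.
  transitivity ((B (inl i))^T *m (comp_mx V i j a)^T *m
    (B (inr j) *m (B (inr j))^T *m comp_mx V i j a) *m B (inl i)); first by rewrite !mulmxA.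
  by rewrite hB -!mulmxA BB mulmx1.
transitivity ((B (inr j))^T *m cogram s V (fun=> 1%:M) j *m B (inr j)); last first.
  by rewrite g2 mulmx1.
rewrite /cogram mulmx_sumr mulmx_suml; apply: eq_bigr => i _.
rewrite -scalemxAr -scalemxAl; congr (_ *: _).
rewrite mulmx_sumr mulmx_suml; apply: eq_bigr => a _.
rewrite comp_mx_compress !mulmx1 !trmx_mul !trmxK.
transitivity ((B (inr j))^T *m (comp_mx V i j a *m (B (inl i) *m (B (inl i))^T)) *m
    (comp_mx V i j a)^T *m B (inr j)); first by rewrite !mulmxA.
by rewrite -hB !mulmxA BB mul1mx.
Qed.

Lemma subrep_compress d (V : rep R Q d) e (B : forall x : vertex Q, 'M[R]_(d x, e x))
    (U : forall x : vertex Q, {vspace 'cV[R]_(e x)}) :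
    (forall x, (B x)^T *m B x = 1%:M) -> is_hom V V (fun x => B x *m (B x)^T) ->
    is_subrep (compress V B) U ->
  exists U' : forall x : vertex Q, {vspace 'cV[R]_(d x)},
    [/\ is_subrep V U', forall x, \dim (U' x) = \dim (U x) &
        forall x v, v \in U' x -> v = B x *m (B x)^T *m v].
Proof.
move=> BB hB hU.
pose f x := linfun (mulmx (B x) : 'cV[R]_(e x) -> 'cV[R]_(d x)).
have fE x u : f x u = B x *m u by rewrite lfunE.
exists (fun x => (f x @: U x)%VS); split.
- move=> a v /memv_imgP[u uU ->]; rewrite fE.
  have -> : V a *m (B (tl a) *m u) = f (hd a) (compress V B a *m u).
    rewrite fE /compress !mulmxA hB -!mulmxA (mulmxA (B (tl a))^T) BB mul1mx.
    by rewrite !mulmxA.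
  by apply: memv_img; exact: hU.
- move=> x; apply: limg_dim_eq; apply/eqP; rewrite -subv0; apply/subvP => u.
  rewrite memv_cap memv_ker memv0 => /andP[_]; rewrite fE => /eqP Bu0.
  by rewrite -[u]mul1mx -(BB x) -mulmxA Bu0 mulmx0.
- by move=> x v /memv_imgP[u _ ->]; rewrite fE !mulmxA -(mulmxA (B x)) BB mulmx1.
Qed.

Lemma subdim_full d : subdim (fun x : vertex Q => fullv : {vspace 'cV[R]_(d x)}) = d.
Proof. by apply/funext => x; rewrite /subdim dimvf /dim /= muln1. Qed.

Lemma compress_split d (V : rep R Q d) e1 e2 (B : forall x : vertex Q, 'M[R]_(d x, e1 x))
    (C : forall x : vertex Q, 'M[R]_(d x, e2 x)) :
    (forall x, (B x)^T *m B x = 1%:M) -> (forall x, (C x)^T *m C x = 1%:M) ->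
    (forall x, B x *m (B x)^T + C x *m (C x)^T = 1%:M) ->
    is_hom V V (fun x => B x *m (B x)^T) -> is_hom V V (fun x => C x *m (C x)^T) ->
  isomorphic V (projT2 (dsum (existT _ e1 (compress V B)) (existT _ e2 (compress V C)))).
Proof.
move=> BB CC BC hB hC.
have BtC x : (B x)^T *m C x = 0.
  have : (B x)^T *m (B x *m (B x)^T + C x *m (C x)^T) *m C x = (B x)^T *m C x.
    by rewrite BC mulmx1.
  rewrite mulmxDr mulmxDl !mulmxA BB mul1mx -!mulmxA CC mulmx1.
  by move=> h; apply: (addrI ((B x)^T *m C x)); rewrite addr0.
have CtB x : (C x)^T *m B x = 0.
  by have := congr1 trmx (BtC x); rewrite trmx_mul trmxK trmx0.
exists (fun x => col_mx (B x)^T (C x)^T), (fun x => row_mx (B x) (C x)); split.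
- move=> a /=; rewrite mul_col_mx mul_block_col !mul0mx addr0 add0r /compress.
  by congr col_mx; rewrite -!mulmxA -?hB -?hC !mulmxA ?BB ?CC mul1mx.
- by move=> x; rewrite mul_row_col BC.
- move=> x; rewrite mul_col_row BB CC BtC CtB -scalar_mx_block //.
Qed.

(** Induction on the total dimension: a smallest nonzero subrepresentation of weight 0 is split off
    orthogonally, and its complement is again geometric. *)
Theorem geometric_polystable d (V : rep R Q d) :
  pairing Q s d = 0 -> geometric_rep s V -> polystable Q s V.
Proof.
have [N] := ubnP (\sum_(x : vertex Q) d x)%N.
elim: N d V => // N IH d V ltN sd0 g.
have [d0|/existsNP[x0 dx0]] := pselect (forall x : vertex Q, d x = 0%N).
  exact: polystable_zero.
(* [V] itself satisfies the conditions, so a minimum exists; minimality is what makes the summand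
   stable. *)
pose P k := `[< exists U : forall x : vertex Q, {vspace 'cV[R]_(d x)},
  [/\ is_subrep V U, pairing Q s (subdim U) = 0, exists x, U x != 0%VS &
      (\sum_x \dim (U x))%N = k] >].
have exP : exists k, P k.
  exists (\sum_(x : vertex Q) d x)%N; apply/asboolP; exists (fun=> fullv); split.
  - by move=> a u _; exact: memvf.
  - by rewrite subdim_full.
  - by exists x0; rewrite -dimv_eq0 dimvf /dim /= muln1; exact/eqP.
  - by apply: eq_bigr => x _; rewrite dimvf /dim /= muln1.
have [k0 /asboolP[U [hU sU [x1 Ux1] Uk0]] kmin] := ex_minnP exP.
have [p hp] : exists p : forall x : vertex Q, 'M[R]_(d x), forall x, orth_proj (U x) (p x).
  by exists (fun x => sval (cid (orth_projP (U x)))) => x; exact: (svalP (cid _)).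
have [_ /(_ sU) phom] := geometric_subrep s_pos s_neg g hU hp.
have ps x : (p x)^T = p x by case: (hp x).
have pp x : p x *m p x = p x by case: (hp x).
pose q x := 1%:M - p x.
have qs x : (q x)^T = q x by rewrite trmxB trmx1 ps.
have qq x : q x *m q x = q x.
  by rewrite mulmxBr mulmx1 mulmxBl mul1mx pp subrr subr0.
pose B x := sval (cid (proj_factor (ps x) (pp x))).
pose C x := sval (cid (proj_factor (qs x) (qq x))).
have [BBt BB] : (forall x, B x *m (B x)^T = p x) /\ (forall x, (B x)^T *m B x = 1%:M).
  by split=> x; case: (svalP (cid (proj_factor (ps x) (pp x)))).
have [CCt CC] : (forall x, C x *m (C x)^T = q x) /\ (forall x, (C x)^T *m C x = 1%:M).
  by split=> x; case: (svalP (cid (proj_factor (qs x) (qq x)))).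
have r1E x : \rank (p x) = \dim (U x).
  have [_ _ _ trp] := hp x; apply/eqP; rewrite -(eqr_nat R) -trp -[in X in _ == X]BBt.
  by rewrite mxtrace_mulC BB mxtrace1.
have r2E x : (\rank (p x) + \rank (q x))%N = d x.
  have t1 : \tr (p x) = (\rank (p x))%:R.
    transitivity (\tr (B x *m (B x)^T)); first by rewrite BBt.
    by rewrite mxtrace_mulC BB mxtrace1.
  have t2 : \tr (q x) = (\rank (q x))%:R.
    transitivity (\tr (C x *m (C x)^T)); first by rewrite CCt.
    by rewrite mxtrace_mulC CC mxtrace1.
  apply/eqP; rewrite -(eqr_nat R) natrD -t1 -t2 -(mxtrace1 R (d x)).
  by rewrite -raddfD /= /q subrKC.
have hB : is_hom V V (fun x => B x *m (B x)^T) by move=> a; rewrite !BBt.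
have hC : is_hom V V (fun x => C x *m (C x)^T).
  by move=> a; rewrite !CCt mulmxBl mulmxBr mul1mx mulmx1 phom.
have split_V := compress_split BB CC _ hB hC.
apply: (polystable_iso (isomorphic_sym (split_V _))).
  by move=> x; rewrite BBt CCt subrKC.
have sr1 : pairing Q s (fun x => \rank (p x)) = 0.
  by rewrite -[RHS]sU; congr pairing; apply/funext => x; rewrite r1E.
apply: polystable_dsum => /=.
  (* A subrepresentation of the summand gives one of [V] with the same dimensions, hence of weight
     at most 0; weight 0 would contradict minimality. *)
  split=> // U' hU' [x2 Ux2] [x3 Ux3].
  have [U'' [hU'' dimU'' _]] := subrep_compress BB hB hU'.
  have -> : pairing Q s (subdim U') = pairing Q s (subdim U'').
    by congr pairing; apply/funext => x; rewrite /subdim dimU''.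
  have [_ /(_ _ hU'')] := geometric_semistable s_pos s_neg sd0 g.
  rewrite le_eqVlt => /orP[/eqP s0|//].
  have : P (\sum_x \dim (U'' x))%N.
    apply/asboolP; exists U''; split=> //; exists x2.
    by rewrite -dimv_eq0 dimU'' dimv_eq0.
  move=> /kmin; rewrite leqNgt -Uk0 => /negP[].
  have dimle x : (\dim (U' x) <= \rank (p x))%N.
    by have := dimvS (subvf (U' x)); rewrite dimvf /dim /= muln1.
  rewrite (bigD1 x3) //= [X in (_ < X)%N](bigD1 x3) //= dimU'' -!r1E -addSn leq_add //.
    rewrite ltn_neqAle dimle andbT; apply: contra Ux3 => /eqP e.
    by rewrite eqEdim subvf dimvf /dim /= muln1 e leqnn.
  by apply: leq_sum => x _; rewrite dimU'' -r1E.
apply: IH.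
- rewrite ltnS in ltN; apply: leq_trans ltN; rewrite (bigD1 x1) //= [X in (_ < X)%N](bigD1 x1) //=.
  rewrite -addSn leq_add //.
    by rewrite -[X in (_ < X)%N]r2E -[X in (X < _)%N]add0n ltn_add2r r1E lt0n dimv_eq0.
  by apply: leq_sum => x _; rewrite -[X in (_ <= X)%N]r2E leq_addl.
- apply: (addrI (pairing Q s (fun x => \rank (p x)))); rewrite [in RHS]sr1 addr0 -[RHS]sd0.
  rewrite /pairing -big_split; apply: eq_bigr => x _ /=.
  by rewrite -mulrDr -PoszD r2E.
- exact: compress_geometric.
Qed.
End GeometricPolystable.

(** * Norm of orbits of semi-stable representations *)

Section Dominance.
Context {R : realType} {I : finType}.

(* Layer-cake form of Abel summation. *)
Lemma level_set_dominance (e v : I -> R) :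
  \sum_t e t = 0 -> (forall c, \sum_(t | v t <= c) e t <= 0) -> 0 <= \sum_t e t * v t.
Proof.
move=> e0 lev.
(* The values are truncated at a level [c], and the induction is on the number of values below
   it. *)
suff main N c : (#|[pred t | (v t < c)%R]| < N)%N -> 0 <= \sum_t e t * Num.min (v t) c.
  have [M vM] : exists M, forall t, v t <= M.
    exists (\sum_t `|v t|) => t; apply: le_trans (ler_norm _) _.
    by rewrite (bigD1 t) //= lerDl sumr_ge0.
  have := main _ M (ltnSn _); congr (0 <= _); apply: eq_bigr => t _.
  by rewrite min_l.
elim: N c => // N IH c ltN.
have [[t0 t0c]|none] := pselect (exists t, v t < c); last first.
  rewrite (eq_bigr (fun t => e t * c)) => [|t _]; first by rewrite -mulr_suml e0 mul0r.
  by rewrite min_r // leNgt; apply/negP => tc; apply: none; exists t.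
have [/= t1 t1c t1max] := @arg_maxP _ _ _ t0 (fun t => v t < c) v t0c.
have := IH (v t1); have lt1 : (#|[pred t | (v t < v t1)%R]| < N)%N.
  rewrite -ltnS; apply: leq_ltn_trans ltN; apply: proper_card; apply/properP; split.
    by apply/fintype.subsetP => t; rewrite !inE => /lt_trans; apply.
  by exists t1; rewrite !inE ?ltxx.
move=> /(_ lt1) IH1.
(* Raising the truncation from [v t1] to [c] adds [c - v t1] exactly off a sublevel set, where [e]
   has nonnegative sum. *)
have -> : \sum_t e t * Num.min (v t) c =
    \sum_t e t * Num.min (v t) (v t1) + (c - v t1) * \sum_(t | ~~ (v t <= v t1)) e t.
  rewrite [X in (_ - _) * X]big_mkcond mulr_sumr -big_split; apply: eq_bigr => t _ /=.
  have [le1|gt1] /= := leP (v t) (v t1).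
    by rewrite min_l ?(le_trans le1 (ltW t1c)) // mulr0 addr0.
  rewrite min_r; first by ring.
  by rewrite leNgt; apply/negP => tc; have := t1max t tc; rewrite leNgt gt1.
rewrite addr_ge0 // mulr_ge0 ?subr_ge0 ?(ltW t1c) //.
by move: e0; rewrite (bigID (fun t => v t <= v t1)) /= => /eqP; rewrite addrC addr_eq0 => /eqP ->;
  rewrite oppr_ge0.
Qed.
End Dominance.

Section HilbertMumford.
Context {R : realType} {n m : nat} {Q : bipartite_quiver n m}.
Context (s : 'I_n + 'I_m -> int).
Context (s_pos : forall i, 0 < s (inl i)) (s_neg : forall j, s (inr j) < 0).
Implicit Type d : 'I_n + 'I_m -> nat.

Lemma proj_vspace k (p : 'M[R]_k) : p^T = p -> p *m p = p -> exists U, orth_proj U p.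
Proof.
move=> ps pp; pose U := limg (linfun (mulmx p : 'cV[R]_k -> 'cV[R]_k)).
have memU u : (u \in U) = (p *m u == u).
  apply/memv_imgP/eqP => [[v _ ->]|<-]; first by rewrite !lfunE /= mulmxA pp.
  by exists u; rewrite ?memvf // lfunE.
exists U; have [p' [ps' pp' mem' tr']] := orth_projP U.
have col_eq (a b : 'M[R]_k) : a *m a = a -> (forall u : 'cV[R]_k, (a *m u == u) -> (b *m u == u)) -> b *m a = a.
  move=> aa ab; apply/matrixP => k1 l; have := ab (a *m delta_mx l 0).
  rewrite mulmxA aa eqxx => /(_ isT)/eqP/matrixP/(_ k1 0).
  by rewrite mulmxA -!colE !mxE.
have pE : p = p'.
  have h1 : p' *m p = p by apply: col_eq => // u; rewrite -memU mem'.
  have h2 : p *m p' = p' by apply: col_eq => // u; rewrite -mem' memU.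
  by rewrite -[LHS]ps -h1 trmx_mul ps ps'.
by split=> //; rewrite pE.
Qed.

(* The Hilbert-Mumford inequality for the diagonal one-parameter subgroup with weights [v] in
   the frames [F]: the sublevel sets of [v] span subrepresentations. *)
Lemma hilbert_mumford d (V : rep R Q d) (F : forall x : vertex Q, 'M[R]_(d x))
    (v : forall x : vertex Q, 'I_(d x) -> R) :
    semistable Q s V -> (forall x, F x *m (F x)^T = 1%:M) ->
    (forall i j a k l, (F (inr j) *m comp_mx V i j a *m (F (inl i))^T) k l != 0 ->
       v (inr j) k <= v (inl i) l) ->
  0 <= \sum_x (s x)%:~R * \sum_l v x l.
Proof.
move=> [sd0 ss] FF hv.
pose I := {x : vertex Q & 'I_(d x)}.
pose e (t : I) : R := (s (tag t))%:~R; pose w (t : I) := v (tag t) (tagged t).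
have sumE (P : forall x, pred 'I_(d x)) (f : forall x, 'I_(d x) -> R) :
    \sum_(t : I | P (tag t) (tagged t)) f (tag t) (tagged t) = \sum_x \sum_(l | P x l) f x l.
  by rewrite (sig_big_dep xpredT P f).
have := @level_set_dominance R I e w.
rewrite (sumE (fun=> xpredT) (fun x l => (s x)%:~R * v x l)).
rewrite [X in _ -> _ -> 0 <= X](eq_bigr (fun x => (s x)%:~R * \sum_l v x l)); last first.
  by move=> x _; rewrite mulr_sumr.
apply.
  rewrite (sumE (fun=> xpredT) (fun x l => (s x)%:~R)).
  transitivity ((pairing Q s d)%:~R : R); last by rewrite sd0.
  rewrite /pairing rmorph_sum; apply: eq_bigr => x _ /=.
  by rewrite sumr_const card_ord intrM -mulr_natr pmulrn.
move=> c; rewrite (sumE (fun x l => v x l <= c) (fun x l => (s x)%:~R)).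
pose D x : 'rV[R]_(d x) := \row_l (v x l <= c)%R%:R.
(* The orthogonal projection onto the span of the frame vectors of value at most [c]. *)
pose p x := (F x)^T *m diag_mx (D x) *m F x.
have ps x : (p x)^T = p x by rewrite /p !trmx_mul trmxK tr_diag_mx mulmxA.
have DD x : diag_mx (D x) *m diag_mx (D x) = diag_mx (D x).
  rewrite mulmx_diag; congr diag_mx; apply/rowP => l; rewrite !mxE.
  by case: (v x l <= c); rewrite ?mulr1 ?mulr0.
have pp x : p x *m p x = p x.
  rewrite /p !mulmxA -(mulmxA _ (F x) (F x)^T) FF mulmx1.
  by rewrite -(mulmxA (F x)^T) DD.
have [U hU] : exists U : forall x : vertex Q, {vspace 'cV[R]_(d x)}, forall x, orth_proj (U x) (p x).
  exists (fun x => sval (cid (proj_vspace (ps x) (pp x)))) => x.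
  exact: (svalP (cid (proj_vspace (ps x) (pp x)))).
have trp x : \tr (p x) = \sum_(l | v x l <= c) 1.
  rewrite tr_spectral // [RHS]big_mkcond; apply: eq_bigr => l _; rewrite mxE.
  by case: (v x l <= c).
suff sub : is_subrep V U.
  have := ss U sub; rewrite -(ler_int R) rmorph_sum; congr (_ <= 0).
  apply: eq_bigr => x _ /=; have [_ _ _ trE] := hU x.
  by rewrite intrM /subdim -[X in _ * X]/((\dim (U x))%:R) -trE trp mulr_sumr;
     apply: eq_bigr => l _; rewrite mulr1.
have F'F x : (F x)^T *m F x = 1%:M by exact: mulmx1C.
apply/is_subrep_comp => i j a u.
have [_ _ -> _] := hU (inl i); have [_ _ -> _] := hU (inr j).
set M := comp_mx V i j a => /eqP <-; rewrite mulmxA.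
(* A nonzero entry leads to a sink vector whose value does not exceed that of the source vector, so
   the arrows preserve the sublevel spans. *)
have DM : diag_mx (D (inr j)) *m (F (inr j) *m M *m (F (inl i))^T) *m diag_mx (D (inl i)) =
    (F (inr j) *m M *m (F (inl i))^T) *m diag_mx (D (inl i)).
  apply/matrixP => k l; rewrite -mulmxA mul_diag_mx.
  have := hv i j a k l; rewrite -/M; move: (_ *m (F (inl i))^T) => G hG.
  rewrite !mul_mx_diag !mxE; have [lc|] := boolP (v (inl i) l <= c); last by rewrite !mulr0.
  have [->|/hG kl] := eqVneq (G k l) 0.
    by rewrite mul0r mulr0.
  by rewrite (le_trans kl lc) mul1r.
suff : p (inr j) *m M *m p (inl i) = M *m p (inl i).
  by move=> E; rewrite !(mulmxA _ _ u) E.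
transitivity ((F (inr j))^T *m (diag_mx (D (inr j)) *m (F (inr j) *m M *m (F (inl i))^T) *m
    diag_mx (D (inl i))) *m F (inl i)); first by rewrite /p !mulmxA.
by rewrite DM /p !mulmxA F'F mul1mx.
Qed.
End HilbertMumford.

Section NormDecay.
Context {R : realType} {n m : nat} {Q : bipartite_quiver n m}.
Context (s : 'I_n + 'I_m -> int).
Context (s_pos : forall i, 0 < s (inl i)) (s_neg : forall j, s (inr j) < 0).
Implicit Type d : 'I_n + 'I_m -> nat.

Definition wnorm d (V : rep R Q d) : R := pair_form s V (fun i j M => \tr (M^T *m M)).

Lemma wnorm_ge0 d (V : rep R Q d) : 0 <= wnorm V.
Proof. by do 3!(apply: sumr_ge0 => ? _); rewrite mulr_ge0 ?mulr_ge0 ?ler0n ?tr_gram_ge0. Qed.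

Lemma wnorm_gram1 d (V : rep R Q d) :
  \sum_i (sigma_pos s i)%:R * \tr (gram s V (fun=> 1%:M) i) = wnorm V.
Proof.
transitivity (\sum_i (sigma_pos s i)%:R * \tr (gram s V (fun=> 1%:M) i *m 1%:M)).
  by apply: eq_bigr => i _; rewrite mulmx1.
rewrite tr_gram1; do 3!(apply: eq_bigr => ? _).
by rewrite mulmx1.
Qed.

Lemma wnorm_cogram1 d (V : rep R Q d) :
  \sum_j (sigma_neg s j)%:R * \tr (cogram s V (fun=> 1%:M) j) = wnorm V.
Proof.
transitivity (\sum_j (sigma_neg s j)%:R * \tr (1%:M *m cogram s V (fun=> 1%:M) j)).
  by apply: eq_bigr => j _; rewrite mul1mx.
rewrite (tr_cogram1 _ _ (fun=> 1%:M)); do 3!(apply: eq_bigr => ? _).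
by rewrite mul1mx mxtrace_mulC.
Qed.

Lemma cvg_wnorm T (F : set_system T) {FF : Filter F} d (V : T -> rep R Q d) (W : rep R Q d) :
  (forall i j a, mx_cvg F (fun t => comp_mx (V t) i j a) (comp_mx W i j a)) ->
  (fun t => wnorm (V t)) @ F --> wnorm W.
Proof.
move=> VW; do 3!(apply: cvg_bigsum => ? _); apply: cvgM; first exact: cvg_cst.
by apply: cvg_mxtrace; apply: mx_cvgM => //; exact: mx_cvgT.
Qed.

Lemma tr_frame p q (F : 'M[R]_p) (E : 'M[R]_q) (y : 'rV[R]_p) (z : 'rV[R]_q) (M : 'M[R]_(p, q)) :
  \tr (M^T *m (F^T *m diag_mx y *m F) *m M *m (E^T *m diag_mx z *m E)) =
  \sum_k \sum_l y 0 k * z 0 l * (F *m M *m E^T) k l ^+ 2.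
Proof.
pose G := F *m M *m E^T.
transitivity (\tr (G^T *m diag_mx y *m G *m diag_mx z)).
  rewrite !mulmxA mxtrace_mulC /G !trmx_mul trmxK !mulmxA //.
rewrite [RHS]exchange_big; apply: eq_bigr => l _; rewrite mul_mx_diag mxE -mulmxA mxE mulr_suml.
apply: eq_bigr => k _; rewrite mul_diag_mx !mxE -/G; ring.
Qed.

Lemma diag_mxV k (y : 'rV[R]_k) : (forall l, y 0 l != 0) ->
  diag_mx y *m diag_mx (\row_l (y 0 l)^-1) = 1%:M.
Proof.
move=> y0; rewrite mulmx_diag -diag_const_mx; congr diag_mx.
by apply/rowP => l; rewrite !mxE mulfV.
Qed.

(** Up to orthogonal factors, [A] is diagonal in the eigenframes of [A^T A]; it therefore scales
    each squared entry of [V] by a quotient of eigenvalues. *)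
Lemma wnorm_act_frame d (V : rep R Q d) (A : forall x : vertex Q, 'M[R]_(d x)) : GL A ->
  let X x := (A x)^T *m A x in
  wnorm (act A V) = \sum_i \sum_j \sum_k \sum_l
    (sigma_pos s i)%:R * (sigma_neg s j)%:R *
    (eigen_value (X (inr j)) k / eigen_value (X (inl i)) l *
     frame_wt V (fun j => eigen_frame (X (inr j))) (fun i => eigen_frame (X (inl i))) i j k l).
Proof.
move=> gA X; have Xp x : posdef (X x) by apply: posdef_gram; exact: gA.
have Xs x : (X x)^T = X x by case: (Xp x).
pose y x := \row_k eigen_value (X x) k.
pose z x := \row_k (eigen_value (X x) k)^-1.
have XE x : X x = (eigen_frame (X x))^T *m diag_mx (y x) *m eigen_frame (X x).
  exact: eigen_frameE.
have XV x : invmx (A x) *m (invmx (A x))^T =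
    (eigen_frame (X x))^T *m diag_mx (z x) *m eigen_frame (X x).
  have -> : invmx (A x) *m (invmx (A x))^T = invmx (X x).
    apply/esym/invmx_uniq; rewrite /X mulmxA -(mulmxA (A x)^T) mulmxV // mulmx1.
    by rewrite -trmx_mul mulVmx // trmx1.
  apply: invmx_uniq; rewrite {1}XE; have FF := eigen_frameP (Xs x).
  rewrite !mulmxA -(mulmxA _ (eigen_frame _)) FF mulmx1 -(mulmxA _ (diag_mx (y x))).
  rewrite (_ : z x = \row_l (y x 0 l)^-1); last by apply/rowP => l; rewrite !mxE.
  rewrite diag_mxV ?mulmx1; first exact: mulmx1C.
  by move=> l; rewrite mxE gt_eqF // eigen_value_gt0.
apply: eq_bigr => i _; apply: eq_bigr => j _.
under [RHS]eq_bigr do rewrite -mulr_sumr; rewrite -[in RHS]mulr_sumr -mulr_sumr.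
congr (_ * _).
transitivity (\sum_a \sum_k \sum_l eigen_value (X (inr j)) k / eigen_value (X (inl i)) l *
    (eigen_frame (X (inr j)) *m comp_mx V i j a *m (eigen_frame (X (inl i)))^T) k l ^+ 2).
  apply: eq_bigr => a _; set M := comp_mx V i j a; rewrite comp_mx_act -/M !trmx_mul.
  transitivity (\tr (M^T *m X (inr j) *m M *m (invmx (A (inl i)) *m (invmx (A (inl i)))^T))).
    by rewrite /X -!mulmxA mxtrace_mulC !mulmxA.
  rewrite XV [in X in _ *m X *m M *m _]XE tr_frame.
  by apply: eq_bigr => k _; apply: eq_bigr => l _; rewrite !mxE.
rewrite exchange_big; apply: eq_bigr => k _; rewrite exchange_big; apply: eq_bigr => l _.
by rewrite /frame_wt mulr_sumr.
Qed.

(** The logarithm of [chi(A)^2 = 1]. It says that the weights prepared for [hilbert_mumford], before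
    their shift, pair to 0 with [s]. *)
Lemma ln_chi_sqr d (A : forall x : vertex Q, 'M[R]_(d x)) : GL A -> chi Q s A = 1 ->
  \sum_x (s x)%:~R * \sum_l ln (eigen_value ((A x)^T *m A x) l) = 0.
Proof.
move=> gA chi1; have Xp x : posdef ((A x)^T *m A x) by apply: posdef_gram; exact: gA.
pose D x := \det ((A x)^T *m A x).
have D0 x : 0 < D x by exact: posdef_det_gt0.
have lnD x : \sum_l ln (eigen_value ((A x)^T *m A x) l) = ln (D x).
  rewrite /D eigen_det; last by case: (Xp x).
  by rewrite ln_prod // => l; exact: eigen_value_gt0.
under eq_bigr do rewrite lnD.
have chiD : chi Q s (fun x => (A x)^T *m A x) = 1.
  rewrite /chi; transitivity (chi Q s A ^+ 2); last by rewrite chi1 expr1n.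
  rewrite expr2 -big_split; apply: eq_bigr => x _; rewrite det_mulmx det_tr expfzMl //.
move: chiD; rewrite chiE // => chiD.
rewrite big_sumType /=.
under eq_bigr do rewrite sigma_posE // -pmulrn mulr_natl -lnXn //.
under [X in _ + X]eq_bigr do rewrite sigma_negE // rmorphN mulNr /= -pmulrn mulr_natl -lnXn //.
rewrite sumrN -!ln_prod; try by move=> ?; rewrite exprn_gt0.
rewrite -ln_div ?posrE ?prodr_gt0 //; try by move=> ? _; rewrite exprn_gt0.
by rewrite chiD ln1.
Qed.

(* If the norm decayed, the logarithms of the eigenvalues of [A^T A], increased by 1 at the
   sinks, would contradict [hilbert_mumford] in the limit frames. *)
Lemma wnorm_no_decay T (F : set_system T) {FF : UltraFilter F} d (V : rep R Q d)
    (A : T -> forall x : vertex Q, 'M[R]_(d x)) :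
    semistable Q s V -> (0 < \sum_j sigma_neg s j * d (inr j))%N ->
    (forall t, GL (A t)) -> (forall t, chi Q s (A t) = 1) ->
  ~ ((fun t => wnorm (act (A t) V)) @ F --> (0 : R)).
Proof.
move=> ss N0 gA chi1 lim0.
pose X t (x : vertex Q) := (A t x)^T *m A t x.
have Xp t x : posdef (X t x) by apply: posdef_gram; exact: gA.
have Xs t x : (X t x)^T = X t x by case: (Xp t x).
have [F0 F0lim F0F] : exists2 F0 : forall x : vertex Q, 'M[R]_(d x),
    forall x, mx_cvg F (fun t => eigen_frame (X t x)) (F0 x) & forall x, F0 x *m (F0 x)^T = 1%:M.
  have h x := @ultra_orthogonal_cvg R T F FF (d x) _ (fun t => eigen_frameP (Xs t x)).
  by exists (fun x => s2val (cid2 (h x))) => x; [exact: (s2valP (cid2 (h x)))|exact: (s2valP' (cid2 (h x)))].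
pose w0 i j k l := frame_wt V (fun j => F0 (inr j)) (fun i => F0 (inl i)) i j k l.
pose wt t i j k l := frame_wt V (fun j => eigen_frame (X t (inr j)))
  (fun i => eigen_frame (X t (inl i))) i j k l.
have near_le i j k l : \forall t \near F, 0 < w0 i j k l ->
    ln (eigen_value (X t (inr j)) k) + 1 <= ln (eigen_value (X t (inl i)) l).
  have [w00|h] := ltP 0 (w0 i j k l); last exact: nearW.
  have wlim : (fun t => wt t i j k l) @ F --> w0 i j k l.
    by apply: cvg_frame_wt => //= i' j' a; exact: mx_cvg_cst.
  (* The weights eventually exceed half their limit; a norm below this threshold then forces the
     quotient of eigenvalues under [exp (-1)], that is, a gap of at least 1 between their
     logarithms. *)
  have e0 : 0 < expR (-1) * (w0 i j k l / 2) by rewrite mulr_gt0 ?expR_gt0 ?divr_gt0.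
  near=> t.
  have wt1 : w0 i j k l / 2 < wt t i j k l.
    by near: t; apply: (cvgr_gt _ wlim); rewrite ltr_pdivrMr // ltr_pMr // ltr1n.
  have nt1 : wnorm (act (A t) V) < expR (-1) * (w0 i j k l / 2).
    by near: t; exact: (cvgr_lt _ lim0).
  have ev0 x z : 0 < eigen_value (X t x) z by exact: eigen_value_gt0.
  have term : eigen_value (X t (inr j)) k / eigen_value (X t (inl i)) l * wt t i j k l <=
      wnorm (act (A t) V).
    rewrite wnorm_act_frame //.
    have ge0 i' j' k' l' : 0 <= (sigma_pos s i')%:R * (sigma_neg s j')%:R *
      (eigen_value (X t (inr j')) k' / eigen_value (X t (inl i')) l' * wt t i' j' k' l').
      by rewrite !mulr_ge0 ?ler0n ?frame_wt_ge0 ?invr_ge0 ?ltW // ltW.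
    rewrite (bigD1 i) //= (bigD1 j) //= (bigD1 k) //= (bigD1 l) //= -!addrA.
    rewrite ler_wpDr //; last first.
      apply: ler_peMl.
        by rewrite !mulr_ge0 ?frame_wt_ge0 ?invr_ge0 ?ltW.
      by rewrite -natrM ler1n muln_gt0 sigma_pos_gt0 ?sigma_neg_gt0.
    by do ?(apply: addr_ge0); do ?(apply: sumr_ge0 => ? _).
  have lt1 : eigen_value (X t (inr j)) k / eigen_value (X t (inl i)) l < expR (-1).
    rewrite -(@ltr_pM2r _ (wt t i j k l)) ?(lt_trans _ wt1) ?divr_gt0 //.
    apply: lt_trans (le_lt_trans term nt1) _; rewrite ltr_pM2l ?expR_gt0 //.
  move=> _; rewrite -lerBrDr -(@ler_expR R) expRD !lnK ?posrE //.
  by rewrite mulrC -ler_pdivrMr // ltW.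
have near_all : \forall t \near F, forall i j k l, 0 < w0 i j k l ->
    ln (eigen_value (X t (inr j)) k) + 1 <= ln (eigen_value (X t (inl i)) l).
  by do 4!(apply: filter_forall => ?); exact: near_le.
have [t ht] := filter_ex near_all.
(* The gap leaves room for the shift by 1 at the sinks, which lowers the pairing with [s] from 0 to
   a negative number. *)
pose v (x : vertex Q) (l : 'I_(d x)) : R :=
  ln (eigen_value (X t x) l) + (if x is inr _ then 1 else 0).
have := @hilbert_mumford _ _ _ _ s d V F0 v ss F0F.
have -> : \sum_x (s x)%:~R * (\sum_l v x l) = - (\sum_j sigma_neg s j * d (inr j))%:R.
  rewrite (eq_bigr (fun x => (s x)%:~R * (\sum_l ln (eigen_value (X t x) l)) +
      (s x)%:~R * (\sum_(l < d x) if x is inr _ then 1 else 0))); last first.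
    by move=> x _; rewrite -mulrDr -big_split.
  rewrite big_split /= ln_chi_sqr // add0r.
  rewrite big_sumType /= big1 ?add0r => [|i _]; last by rewrite big1 ?mulr0.
  rewrite natr_sum -sumrN; apply: eq_bigr => j _.
  by rewrite sigma_negE // rmorphN mulNr sumr_const card_ord natrM.
rewrite oppr_ge0 leNgt ltr0n N0 => h; apply/notF/h.
move=> i j a k l kl; rewrite /v addr0; apply: ht.
rewrite /w0 /frame_wt (bigD1 a) //= ltr_wpDr ?sumr_ge0 // => [b _|]; first by rewrite sqr_ge0.
by rewrite exprn_even_gt0.
Unshelve. all: by end_near. Qed.
End NormDecay.

(** * Minimal vectors *)

Section MinimalVectors.
Context {R : realType} {n m : nat} {Q : bipartite_quiver n m}.
Context (s : 'I_n + 'I_m -> int).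
Context (s_pos : forall i, 0 < s (inl i)) (s_neg : forall j, s (inr j) < 0).
Implicit Type d : 'I_n + 'I_m -> nat.

Lemma cvg_comp_mx T (F : set_system T) {FF : Filter F} d (V : T -> rep R Q d) (W : rep R Q d) :
  (forall a : barrow Q, mx_cvg F (fun t => V t a) (W a)) ->
  forall i j a, mx_cvg F (fun t => comp_mx (V t) i j a) (comp_mx W i j a).
Proof.
move=> VW i j a; have [|na] := boolP (a \in arrows_between Q i j); last first.
  by rewrite /comp_mx (negbTE na); exact: mx_cvg_cst.
rewrite inE => /andP[/eqP <- /eqP <-]; rewrite comp_mx_arrow.
rewrite (_ : (fun t => _) = (fun t => V t a)); first exact: VW.
by apply: functional_extensionality_dep => t; rewrite comp_mx_arrow.
Qed.

(** All weights are integers at least 1. A bound on the norm thus bounds the entries, as the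
    extraction of limits requires. *)
Lemma entry_le_wnorm d (V : rep R Q d) (a : barrow Q) k l : V a k l ^+ 2 <= wnorm s V.
Proof.
have ge0 i j b : 0 <= (sigma_pos s i)%:R * (sigma_neg s j)%:R *
    \tr ((comp_mx V i j b)^T *m comp_mx V i j b) by rewrite !mulr_ge0 ?ler0n ?tr_gram_ge0.
rewrite /wnorm /pair_form (bigD1 (src a)) //= (bigD1 (snk a)) //= (bigD1 a) //= -!addrA.
rewrite ler_wpDr //; last first.
  rewrite comp_mx_arrow tr_gramE (le_trans _ (ler_peMl _ _)) //.
  - by rewrite (bigD1 l) //= (bigD1 k) //= -addrA lerDl addr_ge0 //;
       do ?(apply: sumr_ge0 => ? _); rewrite ?sqr_ge0.
  - by do ?(apply: sumr_ge0 => ? _); rewrite sqr_ge0.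
  - by rewrite -natrM ler1n muln_gt0 sigma_pos_gt0 ?sigma_neg_gt0.
by do ?(apply: addr_ge0); do ?(apply: sumr_ge0 => ? _).
Qed.

Lemma GL1 d : GL (fun x : vertex Q => 1%:M : 'M[R]_(d x)).
Proof. by move=> x; exact: unitmx1. Qed.

Lemma chi1 d : chi Q s (fun x : vertex Q => 1%:M : 'M[R]_(d x)) = 1.
Proof. by rewrite /chi big1 // => x _; rewrite det1 exp1rz. Qed.

Lemma minimal_limit d (V : rep R Q d) :
    semistable Q s V -> (0 < \sum_j sigma_neg s j * d (inr j))%N ->
  exists (F : set_system nat) (A : nat -> forall x : vertex Q, 'M[R]_(d x)) (W : rep R Q d),
    [/\ UltraFilter F, forall t, GL (A t) /\ chi Q s (A t) = 1,
        forall a : barrow Q, mx_cvg F (fun t => act (A t) V a) (W a),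
        0 < wnorm s W &
        forall B, GL B -> chi Q s B = 1 -> wnorm s W <= wnorm s (act B W)].
Proof.
move=> ss N0.
pose E := [set wnorm s (act A V) | A in [set A | GL A /\ chi Q s A = 1]].
have E0 : E !=set0.
  by exists (wnorm s (act (fun x : vertex Q => 1%:M) V)), (fun=> 1%:M) => //; split; [exact: GL1|exact: chi1].
have Elb : has_lbound E by exists 0 => _ [A _ <-]; exact: wnorm_ge0.
pose c := inf E.
have cle A : GL A -> chi Q s A = 1 -> c <= wnorm s (act A V).
  by move=> gA cA; apply: ge_inf => //; exists A.
have ex t : exists A, (GL A /\ chi Q s A = 1) /\ wnorm s (act A V) < c + harmonic t.
  by have [_ [A hA <-] lt] := inf_adherent (harmonic_gt0 t) (conj E0 Elb); exists A.
pose A t := sval (cid (ex t)).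
have gA t : GL (A t) /\ chi Q s (A t) = 1 by case: (svalP (cid (ex t))).
have Alt t : wnorm s (act (A t) V) < c + harmonic t by case: (svalP (cid (ex t))).
have [F [UF Foo]] := ultraFilterLemma (_ : ProperFilter \oo).
have lim_c : (fun t => wnorm s (act (A t) V)) @ F --> c.
  have : (fun t => wnorm s (act (A t) V)) @ \oo --> c.
    have hlim : (fun t => c + harmonic t) @ \oo --> c.
      by rewrite -[X in _ --> X]addr0; apply: cvgD; [exact: cvg_cst|exact: cvg_harmonic].
    apply: (squeeze_cvgr _ (cvg_cst c) hlim); apply: nearW => t.
    by rewrite cle ?ltW //; case: (gA t).
  by move=> h; apply: cvg_trans h; exact: cvg_app.
(* A crude bound: the norms are at most [c + 1], and the square of [c + 2] is larger. *)
have bound t (a : barrow Q) k l : `|act (A t) V a k l| <= c + 2.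
  have c0 : 0 <= c by apply: lb_le_inf => // _ [B _ <-]; exact: wnorm_ge0.
  have h1 : harmonic t <= 1 :> R by rewrite /harmonic /= invf_le1 ?ltr0n // ler1n.
  rewrite -(@ler_pXn2r _ 2) ?nnegrE ?addr_ge0 // -normrX ger0_norm ?sqr_ge0 //.
  apply: (le_trans (entry_le_wnorm (act (A t) V) k l)); apply: le_trans (ltW (Alt t)) _.
  by nra.
have exW (a : barrow Q) : exists Wa, mx_cvg F (fun t => act (A t) V a) Wa.
  by apply: (@ultra_bounded_mx_cvg _ _ F UF _ _ _ (c + 2)) => t k l; exact: bound.
pose W : rep R Q d := fun a => sval (cid (exW a)).
have WE (a : barrow Q) : mx_cvg F (fun t => act (A t) V a) (W a) by exact: (svalP (cid (exW a))).
have Wc : wnorm s W = c.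
  have h : (fun t => wnorm s (act (A t) V)) @ F --> wnorm s W.
    by apply: cvg_wnorm; exact: cvg_comp_mx.
  exact: (cvg_unique _ h lim_c).
exists F, A, W; split=> //.
  rewrite lt_def wnorm_ge0 andbT Wc; apply/eqP => c0; rewrite c0 in lim_c.
  by apply: (wnorm_no_decay s_pos s_neg ss N0 _ _ lim_c) => t; case: (gA t).
move=> B gB chiB.
(* Moving by [B] stays in the orbit of [V], whose infimum [c] is the norm of [W]; hence [W] is
   minimal in its own orbit. *)
have lim : (fun t => wnorm s (act B (act (A t) V))) @ F --> wnorm s (act B W).
  apply: cvg_wnorm; apply: cvg_comp_mx => a; apply: mx_cvgM; last exact: mx_cvg_cst.
  by apply: mx_cvgM => //; exact: mx_cvg_cst.
apply: (cvgr_to_ge lim); apply: nearW => t; have [gAt chiAt] := gA t.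
rewrite Wc -act_mul // cle //; first exact: GL_mul.
by rewrite chi_mul chiB chiAt mulr1.
Qed.

(* Kempf-Ness: acting on the sources only, then on the sinks only, minimality is the
   hypothesis of [matrix_opt]. *)
Lemma minimal_geometric d (W : rep R Q d) :
    pairing Q s d = 0 -> (0 < \sum_j sigma_neg s j * d (inr j))%N -> 0 < wnorm s W ->
    (forall B, GL B -> chi Q s B = 1 -> wnorm s W <= wnorm s (act B W)) ->
  exists2 B, GL B & geometric_rep s (act B W).
Proof.
move=> sd0 N0 W0 Wmin.
have eqN : (\sum_i sigma_pos s i * d (inl i) = \sum_j sigma_neg s j * d (inr j))%N.
  by rewrite -total_row_dimE (total_dimE s_pos s_neg sd0) total_col_dimE.
set N := (\sum_j _)%N in N0 eqN.
(* The factor that brings the weighted traces of [gram] and [cogram] to [N], as [matrix_opt]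
   requires. *)
pose r := (N%:R / wnorm s W : R).
have r0 : 0 < r by rewrite divr_gt0 // ltr0n.
have rW : r * wnorm s W = N%:R by rewrite /r divfK // gt_eqF.
have gram1 i : r *: gram s W (fun=> 1%:M) i = 1%:M.
  apply: (@matrix_opt _ _ (sigma_pos s) (fun i => d (inl i))
    (fun i => r *: gram s W (fun=> 1%:M) i) _ _ _ i (sigma_pos_gt0 s_pos i)) => [k||C Cp C1].
  - by apply: psdZ; [exact: ltW|apply: psd_gram_rep => j; exact/posdef_psd/posdef1].
  - rewrite eqN -rW -wnorm_gram1 mulr_sumr; apply: eq_bigr => k _.
    by rewrite mxtraceZ mulrCA.
  (* The test tuple [C = S S^T] is realised by [S^-1] at the sources, which turns the trace in
     [matrix_opt] into the norm of [B W]. Roots with positive determinant are taken so that [chi] is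
     1 rather than -1. *)
  have Sex k := posdef_sqrt_det (Cp k).
  pose S k := (s2val (cid2 (Sex k)))^T.
  have S0 k : 0 < \det (S k) by rewrite det_tr; exact: (s2valP (cid2 (Sex k))).
  have SS k : S k *m (S k)^T = C k by rewrite trmxK; exact: (s2valP' (cid2 (Sex k))).
  have Su k : S k \in unitmx by rewrite unitmxE unitfE gt_eqF.
  pose B (x : vertex Q) : 'M[R]_(d x) := match x with inl i => invmx (S i) | inr j => 1%:M end.
  have gB : GL B by case=> k; rewrite /= ?unitmx1 // unitmx_inv.
  have detS : \prod_k \det (S k) ^+ sigma_pos s k = 1.
    apply/eqP; rewrite -(@pexpr_eq1 _ _ 2) //; last by apply: prodr_ge0 => k _; rewrite exprn_ge0 ?ltW.
    apply/eqP; rewrite -[RHS]C1 -prodrXl; apply: eq_bigr => k _.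
    by rewrite -SS det_mulmx [\det (S k)^T]det_tr -expr2 -!exprM mulnC.
  have chiB : chi Q s B = 1.
    rewrite (chiE s_pos s_neg) [X in _ / X]big1 ?divr1 => [|j _]; last by rewrite det1 expr1n.
    transitivity ((\prod_k \det (S k) ^+ sigma_pos s k)^-1); last by rewrite detS invr1.
    by rewrite -prodfV; apply: eq_bigr => k _; rewrite /B det_inv exprVn.
  have -> : \sum_i (sigma_pos s i)%:R * \tr (r *: gram s W (fun=> 1%:M) i *m C i) =
      r * wnorm s (act B W).
    transitivity (r * \sum_i (sigma_pos s i)%:R * \tr (gram s W (fun=> 1%:M) i *m C i)).
      by rewrite mulr_sumr; apply: eq_bigr => k _; rewrite -scalemxAl mxtraceZ mulrCA.
    rewrite tr_gram1; congr (_ * _); apply: eq_bigr => k _; apply: eq_bigr => j _.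
    apply: eq_bigr => a _; congr (_ * _); rewrite comp_mx_act /= invmxK mul1mx -SS.
    by rewrite trmx_mul !mulmxA mxtrace_mulC !mulmxA.
  by rewrite eqN -rW ler_pM2l // Wmin.
have cogram1 j : r *: cogram s W (fun=> 1%:M) j = 1%:M.
  apply: (@matrix_opt _ _ (sigma_neg s) (fun j => d (inr j))
    (fun j => r *: cogram s W (fun=> 1%:M) j) _ _ _ j (sigma_neg_gt0 s_neg j)) => [k||C Cp C1].
  - by apply: psdZ; [exact: ltW|apply: cogram_psd => i; exact/posdef_psd/posdef1].
  - rewrite -/N -rW -wnorm_cogram1 mulr_sumr; apply: eq_bigr => k _.
    by rewrite mxtraceZ mulrCA.
  have Sex k := posdef_sqrt_det (Cp k).
  pose S k := s2val (cid2 (Sex k)).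
  have S0 k : 0 < \det (S k) by exact: (s2valP (cid2 (Sex k))).
  have SS k : (S k)^T *m S k = C k by exact: (s2valP' (cid2 (Sex k))).
  have Su k : S k \in unitmx by rewrite unitmxE unitfE gt_eqF.
  pose B (x : vertex Q) : 'M[R]_(d x) := match x with inl i => 1%:M | inr j => S j end.
  have gB : GL B by case=> k; rewrite /= ?unitmx1.
  have detS : \prod_k \det (S k) ^+ sigma_neg s k = 1.
    apply/eqP; rewrite -(@pexpr_eq1 _ _ 2) //; last by apply: prodr_ge0 => k _; rewrite exprn_ge0 ?ltW.
    apply/eqP; rewrite -[RHS]C1 -prodrXl; apply: eq_bigr => k _.
    by rewrite -SS det_mulmx det_tr -expr2 -!exprM mulnC.
  have chiB : chi Q s B = 1.
    rewrite (chiE s_pos s_neg) [X in X / _]big1 => [|i _]; last by rewrite det1 expr1n.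
    by rewrite detS invr1 mulr1.
  have -> : \sum_j (sigma_neg s j)%:R * \tr (r *: cogram s W (fun=> 1%:M) j *m C j) =
      r * wnorm s (act B W).
    transitivity (r * \sum_j (sigma_neg s j)%:R * \tr (C j *m cogram s W (fun=> 1%:M) j)).
      rewrite mulr_sumr; apply: eq_bigr => k _.
      by rewrite mxtrace_mulC -scalemxAr mxtraceZ mulrCA.
    rewrite tr_cogram1; congr (_ * _); apply: eq_bigr => k _; apply: eq_bigr => l _.
    apply: eq_bigr => a _; congr (_ * _); rewrite comp_mx_act /= invmx1 mulmx1 -SS.
    by rewrite trmx_mul !mulmxA mxtrace_mulC !mulmxA.
  by rewrite -/N -rW ler_pM2l // Wmin.
(* Scaling the sinks by the root of [r] multiplies both [gram] and [cogram] by [r]; the conclusion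
   leaves [chi] free. *)
pose B (x : vertex Q) : 'M[R]_(d x) :=
  match x with inl i => 1%:M | inr j => (Num.sqrt r)%:M end.
have gB : GL B.
  case=> k; rewrite /= ?unitmx1 // unitmxE det_scalar unitfE expf_neq0 //.
  by rewrite gt_eqF ?sqrtr_gt0.
exists B => //; split=> [i|j].
  rewrite gram_act /= invmx1 trmx1 mul1mx mulmx1 -gram1 /gram scaler_sumr.
  apply: eq_bigr => j _; rewrite scalerA mulrC -scalerA; congr (_ *: _).
  rewrite scaler_sumr; apply: eq_bigr => a _.
  rewrite mulmx1 tr_scalar_mx -scalar_mxM -expr2 sqr_sqrtr ?ltW //.
  by rewrite mul_mx_scalar mulmx1 -scalemxAl.
rewrite cogram_act /= tr_scalar_mx mul_scalar_mx mul_mx_scalar scalerA -expr2 sqr_sqrtr ?ltW //.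
rewrite -[RHS]cogram1; congr (_ *: _); rewrite /cogram; apply: eq_bigr => i _; congr (_ *: _).
by apply: eq_bigr => a _; rewrite invmx1 trmx1 !mulmx1.
Qed.
End MinimalVectors.

(** * Polystable representations have geometric data *)

Section Geometrizers.
Context {R : realType} {n m : nat} {Q : bipartite_quiver n m}.
Context (s : 'I_n + 'I_m -> int).
Context (s_pos : forall i, 0 < s (inl i)) (s_neg : forall j, s (inr j) < 0).
Implicit Type d : 'I_n + 'I_m -> nat.

Lemma geometric_zero d (V : rep R Q d) : pairing Q s d = 0 ->
  (\sum_j sigma_neg s j * d (inr j))%N = 0%N -> geometric_rep s V.
Proof.
move=> sd0 N0; have := total_dimE s_pos s_neg sd0; rewrite total_row_dimE total_col_dimE N0.
move=> /esym/eqP; rewrite sum_nat_eq0 => /forallP d0.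
move/eqP: N0; rewrite sum_nat_eq0 => /forallP d0'.
have dl i : d (inl i) = 0%N.
  by have := d0 i; rewrite /= muln_eq0 gtn_eqF ?sigma_pos_gt0 // => /eqP.
have dr j : d (inr j) = 0%N.
  by have := d0' j; rewrite /= muln_eq0 gtn_eqF ?sigma_neg_gt0 // => /eqP.
by split=> i; apply/matrixP => k; have := ltn_ord k; rewrite ?[X in (_ < X)%N]dl ?[X in (_ < X)%N]dr.
Qed.

Lemma semistable_degeneration d (V : rep R Q d) : semistable Q s V ->
  exists (F : set_system nat) (A : nat -> forall x : vertex Q, 'M[R]_(d x)) (W : rep R Q d)
      (B : forall x : vertex Q, 'M[R]_(d x)),
    [/\ UltraFilter F, forall t, GL (A t) /\ chi Q s (A t) = 1,
        forall a : barrow Q, mx_cvg F (fun t => act (A t) V a) (W a),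
        GL B & geometric_rep s (act B W)].
Proof.
move=> ss; have sd0 : pairing Q s d = 0 by case: ss.
have [N0|N0] := posnP (\sum_j sigma_neg s j * d (inr j))%N.
  (* All spaces vanish here, and a constant family along a principal ultrafilter serves. *)
  exists (principal_filter 0%N), (fun=> fun x => 1%:M), V, (fun x => 1%:M); split.
  - exact: principal_filter_ultra.
  - by move=> t; split; [exact: GL1|exact: chi1].
  - move=> a; rewrite (_ : (fun t => _) = (fun=> V a)); first exact: mx_cvg_cst.
    by apply: functional_extensionality_dep => t; rewrite /act mul1mx invmx1 mulmx1.
  - exact: GL1.
  - exact: geometric_zero.
have [F [A [W [UF gA AW W0 Wmin]]]] := minimal_limit s_pos s_neg ss N0.
have [B gB geoB] := minimal_geometric s_pos s_neg sd0 N0 W0 Wmin.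
by exists F, A, W, B.
Qed.

Lemma stable_semistable d (V : rep R Q d) : stable Q s V -> semistable Q s V.
Proof.
move=> [sd0 st]; split=> // U hU.
have [U0|] := pselect (exists x, U x != 0%VS); last first.
  move=> h; rewrite /pairing big1 // => x _; rewrite /subdim.
  suff -> : U x = 0%VS by rewrite dimv0 mulr0.
  by apply/eqP; apply/negPn/negP => Ux; apply: h; exists x.
have [U1|] := pselect (exists x, U x != fullv); first by rewrite ltW // st.
move=> h; rewrite -sd0 le_eqVlt; apply/orP; left; apply/eqP; congr pairing.
rewrite -[RHS](@subdim_full R n m Q); apply/funext => x; rewrite /subdim.
suff -> : U x = fullv by [].
by apply/eqP; apply/negPn/negP => Ux; apply: h; exists x.
Qed.

Lemma unitmx_ker0 k (M : 'M[R]_k) : (forall u : 'cV[R]_k, M *m u = 0 -> u = 0) -> M \in unitmx.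
Proof.
move=> M0; rewrite -unitmx_tr -row_free_unit -kermx_eq0; apply/eqP/row_matrixP => i.
rewrite row0; apply: (@trmx_inj R); rewrite trmx0; apply: M0.
transitivity ((row i (kermx M^T) *m M^T)^T); first by rewrite trmx_mul trmxK.
by rewrite -row_mul mulmx_ker row0 trmx0.
Qed.

(* Schur-type argument: the kernel of the homomorphism has nonnegative weight. *)
Lemma stable_hom_unit d (V W : rep R Q d) (f : forall x : vertex Q, 'M[R]_(d x)) :
  stable Q s V -> semistable Q s W -> is_hom V W f -> (exists x, f x != 0) -> GL f.
Proof.
move=> [sd0 st] [_ ss] hf [x0 fx0].
pose F x := linfun (mulmx (f x) : 'cV[R]_(d x) -> 'cV[R]_(d x)).
have FE x u : F x u = f x *m u by rewrite lfunE.
pose K : forall x : vertex Q, {vspace 'cV[R]_(d x)} := fun x => lker (F x).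
pose I : forall x : vertex Q, {vspace 'cV[R]_(d x)} := fun x => limg (F x).
have hK : is_subrep V K.
  by move=> a u; rewrite !memv_ker !FE mulmxA hf -mulmxA => /eqP ->; rewrite mulmx0.
have hI : is_subrep W I.
  move=> a u /memv_imgP[v _ ->]; rewrite FE mulmxA -hf -mulmxA -FE.
  by apply: memv_img; exact: memvf.
(* Rank-nullity: kernel and image have opposite weights, and semi-stability of [W] bounds that of
   the image by 0. *)
have dimE : pairing Q s (subdim K) + pairing Q s (subdim I) = 0.
  rewrite -[RHS]sd0 /pairing -big_split; apply: eq_bigr => x _ /=.
  rewrite -mulrDr -PoszD; congr (_ * Posz _).
  have := limg_ker_dim (F x) fullv; rewrite capfv dimvf /dim /= muln1; exact.
have [K0 x|/existsNP[x1 Kx1]] := pselect (forall x, K x = 0%VS).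
  apply: unitmx_ker0 => u fu; apply/eqP; rewrite -memv0 -(K0 x) memv_ker FE fu //.
have K1 : exists x, K x != fullv.
  exists x0; apply: contra fx0 => /eqP Kf; apply/eqP/matrixP => k l; rewrite mxE.
  have : delta_mx l 0 \in K x0 by rewrite Kf memvf.
  by rewrite memv_ker FE -colE => /eqP/matrixP/(_ k 0); rewrite !mxE.
have := st K hK (ex_intro _ x1 (introN eqP Kx1)) K1.
by rewrite ltNge -oppr_le0 (addr0_eq dimE) ss.
Qed.

Lemma act_is_hom d (V W : rep R Q d) (f : forall x : vertex Q, 'M[R]_(d x)) :
  GL f -> is_hom V W f -> W = act f V.
Proof.
move=> gf hf; apply: functional_extensionality_dep => a.
by rewrite /act hf mulmxK // gf.
Qed.

(* The group elements degenerating [V] to [W], once normalised, converge to a nonzero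
   homomorphism from [V] to [W]. *)
Lemma stable_geometric d (V : rep R Q d) : stable Q s V ->
  exists2 A, GL A & geometric_rep s (act A V).
Proof.
move=> st; have ss := stable_semistable st; have sd0 : pairing Q s d = 0 by case: ss.
have [d0|/existsNP[x0 dx0]] := pselect (forall x : vertex Q, d x = 0%N).
  exists (fun=> 1%:M); first exact: GL1.
  by apply: geometric_zero => //; rewrite big1 // => j _; rewrite d0 muln0.
have [F [A [W [B [UF gA AW gB geoB]]]]] := semistable_degeneration ss.
pose nrm (M : forall x : vertex Q, 'M[R]_(d x)) := \sum_x \sum_k \sum_l `|M x k l|.
have nrm_ge (M : forall x : vertex Q, 'M[R]_(d x)) x k l : `|M x k l| <= nrm M.
  rewrite /nrm (bigD1 x) //= (bigD1 k) //= (bigD1 l) //= -!addrA lerDl.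
  by do ?(apply: addr_ge0); do ?(apply: sumr_ge0 => ? _).
have nrm0 (M : forall x : vertex Q, 'M[R]_(d x)) x : nrm M = 0 -> M x = 0.
  move=> M0; apply/matrixP => k l; rewrite mxE; apply/eqP; rewrite -normr_le0 -M0.
  exact: nrm_ge.
have nrm_gt0 t : 0 < nrm (A t).
  rewrite lt_def; apply/andP; split; last by do ?(apply: sumr_ge0 => ? _).
  apply/eqP => /(nrm0 _ x0) A0; have [gAt _] := gA t.
  have := GL_det_neq0 x0 gAt; rewrite A0 -(prednK (_ : 0 < d x0)%N) ?det0 ?eqxx //.
  by rewrite lt0n; exact/eqP.
(* Bounded entries give a limit along the ultrafilter, and norm exactly 1 keeps this limit from
   being 0. *)
pose C t x := (nrm (A t))^-1 *: A t x.
have nrmC t : nrm (C t) = 1.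
  transitivity ((nrm (A t))^-1 * nrm (A t)); last by rewrite mulVf // gt_eqF.
  rewrite /nrm mulr_sumr; apply: eq_bigr => x _; rewrite mulr_sumr; apply: eq_bigr => k _.
  rewrite mulr_sumr; apply: eq_bigr => l _.
  by rewrite /C mxE normrM ger0_norm // invr_ge0 ltW.
have exf x : exists f, mx_cvg F (fun t => C t x) f.
  by apply: (@ultra_bounded_mx_cvg _ _ F UF _ _ _ 1) => t k l; rewrite -(nrmC t); exact: nrm_ge.
pose f x := sval (cid (exf x)).
have Cf x : mx_cvg F (fun t => C t x) (f x) by exact: (svalP (cid (exf x))).
have nrmf : nrm f = 1.
  have h : (fun t => nrm (C t)) @ F --> nrm f.
    by do 3!(apply: cvg_bigsum => ? _); apply: cvg_norm; exact: Cf.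
  have h1 : (fun t => nrm (C t)) @ F --> (1 : R).
    by under eq_fun do rewrite nrmC; exact: cvg_cst.
  exact: (cvg_unique _ h h1).
(* Each [C t] is a homomorphism from [V] to its translate by [A t]; the relation passes to the
   limit. *)
have hf : is_hom V W f.
  move=> a; apply: (@mx_cvg_unique _ _ F _ _ _ (fun t => C t (hd a) *m V a)).
    by apply: mx_cvgM; [exact: Cf|exact: mx_cvg_cst].
  rewrite (_ : (fun t => _) = (fun t => act (A t) V a *m C t (tl a))).
    by apply: mx_cvgM; [exact: AW|exact: Cf].
  apply: functional_extensionality_dep => t; have [gAt _] := gA t.
  by rewrite /C -scalemxAl -scalemxAr /act mulmxKV // gAt.
(* The new target, [W] moved by [B], is geometric and hence semi-stable, as [stable_hom_unit]
   asks. *)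
pose g x := B x *m f x.
have hg : is_hom V (act B W) g.
  by move=> a; rewrite /g /act -mulmxA hf mulmxA mulmxA mulmxKV // gB.
have gg : GL g.
  apply: (stable_hom_unit st _ hg); first exact: geometric_semistable.
  have [f0|/existsNP[x fx]] := pselect (forall x, f x = 0).
    exfalso; have := nrmf; rewrite /nrm big1 => [/esym/eqP|x _]; first by rewrite oner_eq0.
    by rewrite f0 big1 // => k _; rewrite big1 // => l _; rewrite mxE normr0.
  exists x; apply/eqP => gx; apply: fx.
  by rewrite -[LHS](mulKmx (gB x)) -/(g x) gx mulmx0.
by exists g => //; rewrite -(act_is_hom gg hg).
Qed.

Lemma sum_block_diag (I J : finType) p1 q1 p2 q2 (c : I -> R)
    (M : I -> J -> 'M[R]_(p1, q1)) (N : I -> J -> 'M[R]_(p2, q2)) :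
  \sum_i c i *: \sum_j block_mx (M i j) 0 0 (N i j) =
  block_mx (\sum_i c i *: \sum_j M i j) 0 0 (\sum_i c i *: \sum_j N i j).
Proof.
elim/big_rec3: _ => [|i x y z _ ->]; first by rewrite block_mx0.
have -> : \sum_j block_mx (M i j) 0 0 (N i j) = block_mx (\sum_j M i j) 0 0 (\sum_j N i j).
  elim/big_rec3: _ => [|j x' y' z' _ ->]; first by rewrite block_mx0.
  by rewrite add_block_mx !addr0.
by rewrite scale_block_mx !scaler0 add_block_mx !addr0.
Qed.

Lemma comp_mx_dsum (V1 V2 : some_rep R Q) i j a :
  comp_mx (projT2 (dsum V1 V2)) i j a =
  block_mx (comp_mx (projT2 V1) i j a) 0 0 (comp_mx (projT2 V2) i j a).
Proof.
have [|na] := boolP (a \in arrows_between Q i j); last first.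
  by rewrite /comp_mx (negbTE na) block_mx0.
by rewrite inE => /andP[/eqP <- /eqP <-]; rewrite !comp_mx_arrow.
Qed.

Lemma geometric_dsum (V1 V2 : some_rep R Q) :
  geometric_rep s (projT2 V1) -> geometric_rep s (projT2 V2) ->
  geometric_rep s (projT2 (dsum V1 V2)).
Proof.
move=> [g1 h1] [g2 h2]; split=> [i|j].
  transitivity (block_mx (gram s (projT2 V1) (fun=> 1%:M) i) 0 0
    (gram s (projT2 V2) (fun=> 1%:M) i)); last by rewrite g1 g2 -scalar_mx_block.
  rewrite /gram -sum_block_diag; apply: eq_bigr => j _; congr (_ *: _).
  apply: eq_bigr => a _; rewrite comp_mx_dsum tr_block_mx !trmx0 !mulmx1.
  by rewrite mulmx_block !mulmx0 !mul0mx !addr0 !add0r.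
transitivity (block_mx (cogram s (projT2 V1) (fun=> 1%:M) j) 0 0
  (cogram s (projT2 V2) (fun=> 1%:M) j)); last by rewrite h1 h2 -scalar_mx_block.
rewrite /cogram -sum_block_diag; apply: eq_bigr => i _; congr (_ *: _).
apply: eq_bigr => a _; rewrite comp_mx_dsum tr_block_mx !trmx0 !mulmx1.
by rewrite mulmx_block !mulmx0 !mul0mx !addr0 !add0r.
Qed.

Lemma iso_geometric d e (V : rep R Q d) (W : rep R Q e) : isomorphic V W ->
  geometric_rep s W -> exists2 A, GL A & geometric_rep s (act A V).
Proof.
move=> VW gW; have de := isomorphic_dim VW; subst e.
have [f [g [hf gf _]]] := VW.
have gf' : GL f by move=> x; case: (mulmx1_unit (gf x)).
by exists f => //; rewrite -(act_is_hom gf' hf).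
Qed.

Lemma polystable_geometric d (V : rep R Q d) : polystable Q s V ->
  exists2 A, GL A & geometric_rep s (act A V).
Proof.
move=> [k [W [Ws VW]]].
suff [Z gZ WZ] : exists2 Z : some_rep R Q, geometric_rep s (projT2 Z) &
    isomorphic (projT2 (\big[@dsum R Q/zero_rep R Q]_(i < k) W i)) (projT2 Z).
  exact: iso_geometric (isomorphic_trans VW WZ) gZ.
elim: k W Ws {VW} => [|k IH] W Ws.
  rewrite big_ord0; exists (zero_rep R Q); last exact: isomorphic_refl.
  by split=> i; apply/matrixP => -[].
rewrite big_ord_recl; have [Z gZ WZ] := IH _ (fun i => Ws (lift ord0 i)).
have [A gA geoA] := stable_geometric (Ws ord0).
exists (dsum (existT _ _ (act A (projT2 (W ord0)))) Z); first exact: geometric_dsum.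
by apply: isomorphic_dsum => //; exact: isomorphic_act.
Qed.
End Geometrizers.

(** * Orbit closures *)

Section OrbitClosure.
Context {R : realType} {n m : nat} {Q : bipartite_quiver n m}.
Implicit Type d : 'I_n + 'I_m -> nat.

Let rep_top d := prod_topology (fun a : arrow Q => 'M[R]_(d (hd a), d (tl a))).

Lemma cvg_rep T (F : set_system T) {FF : Filter F} d (V : T -> rep R Q d) (W : rep R Q d) :
  (forall a : barrow Q, mx_cvg F (fun t => V t a) (W a)) -> V @ F --> (W : rep_top d).
Proof.
move=> VW; apply/cvg_sup => a A /= [_ [[B Bop <-] BW sBA]].
have [P WP PB] : nbhs (W a) B by exact: open_nbhs_nbhs.
suff : \forall t \near F, forall k l, P k l (V t a k l).
  by apply: filterS => t Pt; apply: sBA; apply: PB => k l; exact: Pt.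
by do 2!(apply: filter_forall => ?); apply: VW; exact: WP.
Qed.

Lemma rep_cvg_mx T (F : set_system T) {FF : Filter F} d (V : T -> rep R Q d) (W : rep R Q d)
    (a : barrow Q) : V @ F --> (W : rep_top d) -> mx_cvg F (fun t => V t a) (W a).
Proof.
move=> VW k l B /= WB.
have /VW : nbhs (W : rep_top d) [set Z : rep_top d | B (fun_of_matrix (Z a) k l)].
  apply: (@proj_continuous _ (fun a : arrow Q => 'M[R]_(d (hd a), d (tl a))) a W
    [set M | B (fun_of_matrix M k l)]); exists (fun k' l' => if (k' == k) && (l' == l) then B else setT).
    by move=> k' l'; case: ifP => [/andP[/eqP -> /eqP ->]|_] //; exact: filterT.
  by move=> M /(_ k l); rewrite !eqxx.
exact.
Qed.

Lemma orbit_closure_limit (s : 'I_n + 'I_m -> int) T (F : set_system T) {FF : ProperFilter F} d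
    (V W : rep R Q d) (A : T -> forall x : vertex Q, 'M[R]_(d x)) :
  (forall t, GL (A t) /\ chi Q s (A t) = 1) ->
  (forall a : barrow Q, mx_cvg F (fun t => act (A t) V a) (W a)) ->
  in_orbit_closure Q s V W.
Proof.
move=> gA AW B WB; have : (fun t => act (A t) V) @ F --> (W : rep_top d) by exact: cvg_rep.
move=> /(_ B WB) FB; have [t Bt] := @filter_ex _ F _ _ FB.
by exists (act (A t) V); split=> //; exists (A t).
Qed.

(** The neighbourhoods of [W], pulled back to the group, generate a filter that is proper because
    [W] lies in the closure; no sequence has to be extracted. *)
Lemma orbit_closure_filter (s : 'I_n + 'I_m -> int) d (V W : rep R Q d) :
  in_orbit_closure Q s V W ->
  exists (T : Type) (F : set_system T) (A : T -> forall x : vertex Q, 'M[R]_(d x)),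
    [/\ ProperFilter F, forall t, GL (A t) /\ chi Q s (A t) = 1 &
        forall a : barrow Q, mx_cvg F (fun t => act (A t) V a) (W a)].
Proof.
move=> VW; pose T := {A : forall x : vertex Q, 'M[R]_(d x) | GL A /\ chi Q s A = 1}.
pose f (t : T) : rep R Q d := act (sval t) V.
pose F : set_system T := filter_from (nbhs (W : rep_top d)) (fun B => f @^-1` B).
have PF : ProperFilter F.
  apply: filter_from_proper => [|B WB].
    apply: filter_from_filter => [|B C WB WC]; first by exists setT; exact: filterT.
    by exists (B `&` C) => //; exact: filterI.
  by have [_ [[A gA <-] BA]] := VW B WB; exists (exist _ A gA).
exists T, F, sval; split=> //; first by move=> t; exact: (svalP t).
by move=> a; apply: (rep_cvg_mx (V := f)) => B WB; exists B.
Qed.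
End OrbitClosure.

(** * Capacity along degenerations *)

Section CapacityLimit.
Context {R : realType} {n m : nat} {Q : bipartite_quiver n m}.
Context (s : 'I_n + 'I_m -> int).
Context (s_pos : forall i, 0 < s (inl i)) (s_neg : forall j, s (inr j) < 0).
Implicit Type d : 'I_n + 'I_m -> nat.

Lemma capacity_geometrizing d (W : rep R Q d) (A : forall x : vertex Q, 'M[R]_(d x)) :
  pairing Q s d = 0 -> GL A -> geometric_rep s (act A W) -> capacity s W = chi Q s A ^+ 2.
Proof.
move=> sd0 gA gW; have := capacity_geometric s_pos s_neg sd0 gW.
rewrite (capacity_act s_pos s_neg) // => /divr1_eq //.
Qed.

(** The capacity is constant along the orbit. Moving the degeneration by a geometrizing element [B]
    of [W] makes its limit geometric, and [capacity_limit_geometric] shows that the constant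
    [capacity V / chi(B)^2] is 1. *)
Lemma capacity_orbit_closure d (V W : rep R Q d) : pairing Q s d = 0 ->
  polystable Q s W -> in_orbit_closure Q s V W -> capacity s V = capacity s W.
Proof.
move=> sd0 pW /orbit_closure_filter[T [F [A [PF gA AW]]]].
have [B gB geoB] := polystable_geometric s_pos s_neg pW.
have := @capacity_limit_geometric _ _ _ _ s s_pos s_neg T F PF d
  (fun t => act B (act (A t) V)) (act B W) (capacity s V / chi Q s B ^+ 2) sd0 geoB.
rewrite (capacity_geometrizing sd0 gB geoB) => h; apply: divr1_eq; apply: h.
  apply: cvg_comp_mx => a; apply: mx_cvgM; last exact: mx_cvg_cst.
  by apply: mx_cvgM => //; exact: mx_cvg_cst.
move=> t; have [gAt cA] := gA t.
by rewrite !(capacity_act s_pos s_neg) // cA expr1n divr1.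
Qed.
End CapacityLimit.

(** * Block triangular representations *)

Section BlockDeterminants.
Context {R : realType} {p q : nat}.
Implicit Types (P : 'M[R]_p) (K : 'M[R]_(p, q)) (H : 'M[R]_q).

Definition unipotent_mx K : 'M[R]_(p + q) := block_mx 1%:M K 0 1%:M.

Lemma det_unipotent K : \det (unipotent_mx K) = 1.
Proof. by rewrite det_ublock !det1 mulr1. Qed.

Lemma unipotent_unit K : unipotent_mx K \in unitmx.
Proof. by rewrite unitmxE det_unipotent unitr1. Qed.

Lemma schur_complement P K H : P \in unitmx -> P^T = P ->
  block_mx P K K^T H = (unipotent_mx (invmx P *m K))^T *m
    block_mx P 0 0 (H - K^T *m invmx P *m K) *m unipotent_mx (invmx P *m K).
Proof.
move=> Pu Ps; rewrite tr_block_mx !trmx1 trmx0 !mulmx_block !trmx_mul trmx_inv Ps.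
rewrite !mulmx0 !mul0mx !mul1mx !mulmx1 !addr0 !add0r mulmxA mulmxV // mul1mx mulmxKV //.
by rewrite mulmxA subrKC.
Qed.

Lemma block_sym (X : 'M[R]_(p + q)) : X^T = X ->
  X = block_mx (ulsubmx X) (ursubmx X) (ursubmx X)^T (drsubmx X).
Proof. by move=> Xs; rewrite -{1}(submxK X) trmx_ursub Xs. Qed.

Lemma quad_block P H (u : 'cV[R]_p) (v : 'cV[R]_q) :
  ((col_mx u v)^T *m block_mx P 0 0 H *m col_mx u v) 0 0 =
  (u^T *m P *m u) 0 0 + (v^T *m H *m v) 0 0.
Proof.
by rewrite tr_col_mx mul_row_block !mulmx0 addr0 add0r mul_row_col mxE.
Qed.

Lemma posdef_block_diag P H : posdef (block_mx P 0 0 H) <-> posdef P /\ posdef H.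
Proof.
split=> [[/eqP Xs Xp]|[[Ps Pp] [Hs Hp]]].
  move: Xs; rewrite tr_block_mx => /eqP/eq_block_mx[Ps _ _ Hs].
  split; split=> // u u0.
    have := Xp (col_mx u 0); rewrite col_mx_eq0 negb_and u0 => /(_ isT).
    by rewrite quad_block mulmx0 [X in _ + X]mxE addr0.
  have := Xp (col_mx 0 u); rewrite col_mx_eq0 negb_and u0 orbT => /(_ isT).
  by rewrite quad_block mulmx0 [X in X + _]mxE add0r.
split=> [|w]; first by rewrite tr_block_mx !trmx0 Ps Hs.
rewrite -[w]vsubmxK col_mx_eq0 negb_and quad_block.
have Pge : 0 <= ((usubmx w)^T *m P *m usubmx w) 0 0.
  by have [->|/Pp/ltW//] := eqVneq (usubmx w) 0; rewrite mulmx0 mxE.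
have Hge : 0 <= ((dsubmx w)^T *m H *m dsubmx w) 0 0.
  by have [->|/Hp/ltW//] := eqVneq (dsubmx w) 0; rewrite mulmx0 mxE.
case/orP => [/Pp|/Hp] h; [exact: ltr_wpDr|exact: ltr_wpDl].
Qed.

Lemma psd_ul_dr (X : 'M[R]_(p + q)) : psd X -> psd (ulsubmx X) /\ psd (drsubmx X).
Proof.
move=> [Xs Xp]; split; split=> [|u].
- by rewrite -[in RHS]Xs trmx_ulsub.
- have := Xp (col_mx u 0); rewrite (block_sym Xs) tr_col_mx trmx0 mul_row_block.
  by rewrite !mul0mx !addr0 mul_row_col mulmx0 addr0 block_mxKul.
- by rewrite -[in RHS]Xs trmx_drsub.
- have := Xp (col_mx 0 u); rewrite (block_sym Xs) tr_col_mx trmx0 mul_row_block.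
  by rewrite !mul0mx !add0r mul_row_col mulmx0 add0r block_mxKdr.
Qed.

Lemma posdef_ul (X : 'M[R]_(p + q)) : posdef X -> posdef (ulsubmx X).
Proof.
move=> [Xs Xp]; split=> [|u u0]; first by rewrite -[in RHS]Xs trmx_ulsub.
have := Xp (col_mx u 0); rewrite col_mx_eq0 negb_and u0 => /(_ isT).
rewrite (block_sym Xs) tr_col_mx trmx0 mul_row_block.
by rewrite !mul0mx !addr0 mul_row_col mulmx0 addr0 block_mxKul.
Qed.

Lemma posdef_block_factor (X : 'M[R]_(p + q)) : posdef X ->
  exists K Y1 Y2, [/\ posdef Y1, posdef Y2 &
    X = (unipotent_mx K)^T *m block_mx Y1 0 0 Y2 *m unipotent_mx K].
Proof.
move=> Xp; have Xs : X^T = X by case: Xp.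
have Pp := posdef_ul Xp; have Ps : (ulsubmx X)^T = ulsubmx X by case: Pp.
set P := ulsubmx X in Pp Ps; set K := ursubmx X; set H := drsubmx X.
have XE := schur_complement K H (posdef_unit Pp) Ps; rewrite -(block_sym Xs) in XE.
exists (invmx P *m K), P, (H - K^T *m invmx P *m K).
set L := unipotent_mx _ in XE *; set D := block_mx _ _ _ _ in XE *.
suff /posdef_block_diag[] : posdef D by split.
have Lu : L \in unitmx by exact: unipotent_unit.
have -> : D = (invmx L)^T *m X *m invmx L.
  by rewrite XE !mulmxA -trmx_mul mulmxK // mulmxV // trmx1 mul1mx.
by apply: posdef_conj; rewrite ?unitmx_inv.
Qed.

(** Adding [H] to the lower right corner adds it to the Schur complement [S >= 0] of the upper left
    block, and [det (S + H) >= det H]. For a singular upper left block the left-hand side is 0. *)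
Lemma det_block_ge (X : 'M[R]_(p + q)) H : psd X -> psd H ->
  \det (ulsubmx X) * \det H <= \det (X + block_mx 0 0 0 H).
Proof.
move=> Xp Hp; have [Xs _] := Xp; have [Pp _] := psd_ul_dr Xp.
have XHp : psd (X + block_mx 0 0 0 H).
  apply: psdD => //; split=> [|u]; first by case: Hp => Hs _; rewrite tr_block_mx !trmx0 Hs.
  rewrite -[u]vsubmxK quad_block mulmx0 mul0mx [X in X + _]mxE add0r.
  by case: Hp.
have [->|P0] := eqVneq (\det (ulsubmx X)) 0; first by rewrite mul0r psd_det_ge0.
have {}Pp := psd_det_neq0 Pp P0; have Ps : (ulsubmx X)^T = ulsubmx X by case: Pp.
rewrite {2}(block_sym Xs); set P := ulsubmx X in Pp Ps P0 *; set K := ursubmx X; set H0 := drsubmx X.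
have Pu := posdef_unit Pp.
have XE := schur_complement K H0 Pu Ps; rewrite -(block_sym Xs) in XE.
set S := H0 - _ in XE.
have Sp : psd S.
  set L := unipotent_mx _ in XE; have Lu : L \in unitmx by exact: unipotent_unit.
  have DE : block_mx P 0 0 S = (invmx L)^T *m X *m invmx L.
    by rewrite XE !mulmxA -trmx_mul mulmxK // mulmxV // trmx1 mul1mx.
  have [_] := psd_ul_dr (psd_conj (invmx L) Xp).
  by rewrite -DE block_mxKdr.
rewrite add_block_mx !addr0 schur_complement // !det_mulmx det_tr det_unipotent mul1r mulr1.
rewrite det_ublock ler_pM2l ?posdef_det_gt0 //; apply: det_le => //.
by rewrite addrAC -/S addrK.
Qed.
End BlockDeterminants.

Section BlockTriangular.
Context {R : realType} {n m : nat} {Q : bipartite_quiver n m}.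
Context (s : 'I_n + 'I_m -> int).
Context (s_pos : forall i, 0 < s (inl i)) (s_neg : forall j, s (inr j) < 0).
Context (d1 d2 : 'I_n + 'I_m -> nat) (sd1 : pairing Q s d1 = 0) (sd2 : pairing Q s d2 = 0).
Context (V1 : rep R Q d1) (V2 : rep R Q d2).

Let d x := (d1 x + d2 x)%N.
Implicit Types (V : rep R Q d) (Z : forall i j, barrow Q -> 'M[R]_(d1 (inr j), d2 (inl i))).

(** The corner [Z] is a parameter because the group elements used below change it and leave the
    diagonal blocks alone. *)
Definition extension V Z : Prop :=
  forall i j a, comp_mx V i j a = block_mx (comp_mx V1 i j a) (Z i j a) 0 (comp_mx V2 i j a).

Definition block_tuple (Y1 : forall j, 'M[R]_(d1 (inr j))) (Y2 : forall j, 'M[R]_(d2 (inr j))) j : 'M[R]_(d (inr j)) := block_mx (Y1 j) 0 0 (Y2 j).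

(** What the upper block rows of an extension contribute to its gram matrix at a block diagonal
    tuple; the corner [Z] enters only here. *)
Definition top_gram Z (Y1 : forall j, 'M[R]_(d1 (inr j))) i : 'M[R]_(d (inl i)) :=
  \sum_j (sigma_neg s j)%:R *:
    \sum_a (row_mx (comp_mx V1 i j a) (Z i j a))^T *m Y1 j *m row_mx (comp_mx V1 i j a) (Z i j a).

Lemma scaled_sum0 (I J : finType) p q (c : I -> R) :
  \sum_i c i *: \sum_(j : J) (0 : 'M[R]_(p, q)) = 0.
Proof. by rewrite big1 // => i _; rewrite big1 ?scaler0. Qed.

Lemma gram_extension V Z Y1 Y2 i : extension V Z ->
  gram s V (block_tuple Y1 Y2) i = top_gram Z Y1 i + block_mx 0 0 0 (gram s V2 Y2 i).
Proof.
move=> VE; rewrite /gram /top_gram.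
have -> : block_mx 0 0 0 (\sum_j (sigma_neg s j)%:R *: \sum_a (comp_mx V2 i j a)^T *m Y2 j *m comp_mx V2 i j a) =
    \sum_j (sigma_neg s j)%:R *: \sum_a (row_mx 0 (comp_mx V2 i j a))^T *m Y2 j *m
      row_mx 0 (comp_mx V2 i j a) :> 'M[R]_(d (inl i)).
  rewrite -[X in block_mx X](scaled_sum0 (barrow Q) _ _ (fun j => (sigma_neg s j)%:R)).
  rewrite -sum_block_diag; apply: eq_bigr => j _; congr (_ *: _); apply: eq_bigr => a _.
  by rewrite tr_row_mx trmx0 mul_col_mx mul0mx mul_col_row !mulmx0 !mul0mx.
rewrite -big_split; apply: eq_bigr => j _ /=; rewrite -scalerDr -big_split; congr (_ *: _).
apply: eq_bigr => a _ /=; rewrite VE block_mxEv tr_col_mx /block_tuple.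
by rewrite mul_row_block !mulmx0 addr0 add0r mul_row_col.
Qed.

Lemma psd_top_gram Z Y1 i : (forall j, posdef (Y1 j)) -> psd (top_gram Z Y1 i).
Proof.
move=> Yp; apply: psd_sum => j _; apply: psdZ; rewrite ?ler0n //.
by apply: psd_sum => a _; apply: psd_conj; exact: posdef_psd.
Qed.

Lemma ul_top_gram Z Y1 i : ulsubmx (top_gram Z Y1 i) = gram s V1 Y1 i.
Proof.
apply/matrixP => k l; rewrite !mxE summxE [RHS]summxE; apply: eq_bigr => j _.
rewrite !mxE; congr (_ * _); rewrite !summxE; apply: eq_bigr => a _.
by rewrite tr_row_mx mul_col_mx mul_col_row block_mxEul.
Qed.

Lemma top_gram0 Y1 i : top_gram (fun _ _ _ => 0) Y1 i = block_mx (gram s V1 Y1 i) 0 0 0.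
Proof.
rewrite /top_gram /gram.
rewrite -[X in block_mx _ _ _ X](scaled_sum0 (barrow Q) _ _ (fun j => (sigma_neg s j)%:R)).
rewrite -sum_block_diag; apply: eq_bigr => j _; congr (_ *: _); apply: eq_bigr => a _.
by rewrite tr_row_mx trmx0 mul_col_mx mul0mx mul_col_row !mulmx0 !mul0mx.
Qed.

Lemma block_tuple_posdef Y1 Y2 : (forall j, posdef (Y1 j)) -> (forall j, posdef (Y2 j)) ->
  forall j, posdef (block_tuple Y1 Y2 j).
Proof. by move=> Y1p Y2p j; apply/posdef_block_diag. Qed.

Lemma block_tuple_den Y1 Y2 : \prod_j \det (block_tuple Y1 Y2 j) ^+ sigma_neg s j =
  (\prod_j \det (Y1 j) ^+ sigma_neg s j) * (\prod_j \det (Y2 j) ^+ sigma_neg s j).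
Proof. by rewrite -big_split; apply: eq_bigr => j _; rewrite det_ublock exprMn. Qed.

Lemma ratio_extension_ge V Z Y1 Y2 : extension V Z ->
    (forall j, posdef (Y1 j)) -> (forall j, posdef (Y2 j)) ->
  gaussian_ratio s V1 Y1 * gaussian_ratio s V2 Y2 <= gaussian_ratio s V (block_tuple Y1 Y2).
Proof.
move=> VE Y1p Y2p; rewrite !gaussian_ratioE block_tuple_den mulrACA -invfM.
apply: ler_wpM2r.
  by rewrite invr_ge0; apply/ltW/mulr_gt0; exact: gram_den_gt0.
rewrite -big_split; apply: ler_prod => i _ /=; rewrite -exprMn.
have ps1 := psd_top_gram Z i Y1p.
have ps2 : psd (gram s V2 Y2 i) by apply: psd_gram_rep => j; exact: posdef_psd.
have ge0 : 0 <= \det (gram s V1 Y1 i) * \det (gram s V2 Y2 i).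
  apply: mulr_ge0; last exact: psd_det_ge0.
  by apply: psd_det_ge0; apply: psd_gram_rep => j; exact: posdef_psd.
rewrite exprn_ge0 //= lerXn2r ?nnegrE //; last first.
  by rewrite (gram_extension _ _ _ VE) -(ul_top_gram Z); exact: det_block_ge.
by apply: psd_det_ge0; apply: psd_gram_rep => j; apply/posdef_psd/block_tuple_posdef.
Qed.

Lemma capacity_ge0 e (W : rep R Q e) : 0 <= capacity s W.
Proof. by apply: capacity_ge => // Y; exact: ratio_ge0. Qed.

Let sd : pairing Q s d = 0.
Proof.
rewrite -[RHS]addr0 -{1}sd1 -sd2 /pairing -big_split; apply: eq_bigr => x _ /=.
by rewrite -mulrDr.
Qed.

(** Any [Y] is a block diagonal tuple moved by a unipotent congruence. Read as a group element at
    the sinks, with [chi = 1], the unipotent factor is absorbed into [V], where it alters only the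
    corner. *)
Lemma capacity_extension_ge V Z : extension V Z ->
  capacity s V1 * capacity s V2 <= capacity s V.
Proof.
move=> VE; apply: capacity_ge => // Y Yp.
have fac j := posdef_block_factor (Yp j).
pose K j := sval (cid (fac j)); pose Y1 j := sval (cid (svalP (cid (fac j)))).
pose Y2 j := sval (cid (svalP (cid (svalP (cid (fac j)))))).
have [Y1p Y2p YE] : [/\ forall j, posdef (Y1 j), forall j, posdef (Y2 j) &
    forall j, Y j = (unipotent_mx (K j))^T *m block_tuple Y1 Y2 j *m unipotent_mx (K j)].
  have h j : [/\ posdef (Y1 j), posdef (Y2 j) &
      Y j = (unipotent_mx (K j))^T *m block_tuple Y1 Y2 j *m unipotent_mx (K j)].
    exact: (svalP (cid (svalP (cid (svalP (cid (fac j))))))).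
  by split=> j; have [] := h j.
pose A (x : vertex Q) : 'M[R]_(d x) := match x with inl i => 1%:M | inr j => unipotent_mx (K j) end.
have gA : GL A by case=> k; [exact: unitmx1|exact: unipotent_unit].
have chiA : chi Q s A = 1.
  by rewrite (chiE s_pos s_neg) !big1 ?divr1 // => k _; rewrite /A ?det_unipotent ?det1 expr1n.
have -> : gaussian_ratio s V Y = gaussian_ratio s (act A V) (block_tuple Y1 Y2).
  rewrite (ratio_act s_pos s_neg) // chiA expr1n divr1; congr gaussian_ratio.
  by apply: functional_extensionality_dep => j; rewrite YE.
have VE' : extension (act A V) (fun i j a => Z i j a + K j *m comp_mx V2 i j a).
  move=> i j a; rewrite comp_mx_act VE /= invmx1 mulmx1 /unipotent_mx mulmx_block.
  by rewrite !mulmx0 !mul0mx !mul1mx !addr0 add0r.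
apply: le_trans (ratio_extension_ge VE' Y1p Y2p).
by apply: ler_pM; rewrite ?capacity_ge0 //; apply: capacity_le => //;
  [exact: (total_dimE s_pos s_neg sd1)|exact: (total_dimE s_pos s_neg sd2)].
Qed.

(* The one-parameter subgroup [diag(t, 1)], on which [chi] is 1 because [s] vanishes on [d1],
   contracts the extension to the direct sum. *)
Lemma capacity_extension_le V Z Y1 Y2 : extension V Z ->
    (forall j, posdef (Y1 j)) -> (forall j, posdef (Y2 j)) ->
  capacity s V <= gaussian_ratio s V1 Y1 * gaussian_ratio s V2 Y2.
Proof.
move=> VE Y1p Y2p.
pose A (t : R) (x : vertex Q) : 'M[R]_(d x) := block_mx t%:M 0 0 1%:M.
have AV (t : R) : t != 0 -> GL (A t) /\ extension (act (A t) V) (fun i j a => t *: Z i j a).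
  move=> t0; have AA x : A t x *m (block_mx t^-1%:M 0 0 1%:M) = 1%:M.
    rewrite mulmx_block !mulmx0 !mul0mx !addr0 add0r mul1mx -scalar_mxM mulfV //.
    by rewrite -scalar_mx_block.
  split=> [x|i j a]; first by case: (mulmx1_unit (AA x)).
  rewrite comp_mx_act VE (invmx_uniq (AA _)) /A !mulmx_block.
  rewrite !mulmx0 !mul0mx !addr0 !add0r !mul1mx !mulmx1.
  rewrite !mul_scalar_mx -scalemxAl mul_mx_scalar scalerA mulfV // scale1r.
  by rewrite mul0mx.
have chiA (t : R) : t != 0 -> chi Q s (A t) = 1.
  move=> t0; transitivity (t ^ (pairing Q s d1)); last by rewrite sd1.
  rewrite /chi /pairing (big_morph (fun z : int => t ^ z) (fun x y => expfzDr x y t0) (expr0z t)).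
  apply: eq_bigr => x _; rewrite det_ublock det1 mulr1 det_scalar.
  by rewrite exprnP exprz_exp mulrC.
have ratioE : gaussian_ratio s V1 Y1 * gaussian_ratio s V2 Y2 =
    (\prod_i \det (top_gram (fun _ _ _ => 0) Y1 i + block_mx 0 0 0 (gram s V2 Y2 i)) ^+ sigma_pos s i) /
    \prod_j \det (block_tuple Y1 Y2 j) ^+ sigma_neg s j.
  rewrite !gaussian_ratioE block_tuple_den mulrACA -invfM; congr (_ / _).
  rewrite -big_split; apply: eq_bigr => i _.
  by rewrite top_gram0 add_block_mx !addr0 add0r det_ublock exprMn.
rewrite ratioE.
have lim : (fun t : R => gaussian_ratio s (act (A t) V) (block_tuple Y1 Y2)) @ 0^'+ -->
    (\prod_i \det (top_gram (fun _ _ _ => 0) Y1 i + block_mx 0 0 0 (gram s V2 Y2 i)) ^+ sigma_pos s i) /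
    \prod_j \det (block_tuple Y1 Y2 j) ^+ sigma_neg s j.
  have cvg_id : (fun t : R => t) @ 0^'+ --> (0 : R) by apply: cvg_within.
  (* The formula through [top_gram] gives the ratio for nonzero [t] only, but it is polynomial in
     [t] and makes sense at 0, where the corner disappears. *)
  apply: (@cvg_trans _ ((fun t : R => (\prod_i \det (top_gram (fun i j a => t *: Z i j a) Y1 i +
      block_mx 0 0 0 (gram s V2 Y2 i)) ^+ sigma_pos s i) /
      \prod_j \det (block_tuple Y1 Y2 j) ^+ sigma_neg s j) @ 0^'+)).
    apply: near_eq_cvg; near=> t; have t0 : t != 0 by rewrite gt_eqF //; near: t; exact: nbhs_right_gt.
    have [_ AE] := AV t t0; rewrite gaussian_ratioE; congr (_ / _).
    by apply: eq_bigr => i _; rewrite (gram_extension _ _ _ AE).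
  apply: cvgM; last exact: cvg_cst.
  apply: cvg_bigprod => i _; apply: cvg_exprn; apply: cvg_det; apply: mx_cvgD; last exact: mx_cvg_cst.
  apply: mx_cvg_sum => j _; apply: mx_cvgZ; first exact: cvg_cst.
  apply: mx_cvg_sum => a _.
  have rlim : mx_cvg 0^'+ (fun t : R => row_mx (comp_mx V1 i j a) (t *: Z i j a))
      (row_mx (comp_mx V1 i j a) 0).
    rewrite -[X in row_mx _ X](scale0r (Z i j a)) => k l.
    under eq_fun do rewrite mxE; rewrite mxE.
    case: fintype.split => l'; first exact: cvg_cst.
    by apply: (@mx_cvgZ _ _ _ _ _ _ (fun t : R => t)) => //; exact: mx_cvg_cst.
  apply: mx_cvgM => //; apply: mx_cvgM; last exact: mx_cvg_cst.
  exact: mx_cvgT.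
apply: (cvgr_to_ge lim); near=> t.
have t0 : t != 0 by rewrite gt_eqF //; near: t; exact: nbhs_right_gt.
have [gA _] := AV t t0.
have -> : capacity s V = capacity s (act (A t) V).
  by rewrite (capacity_act s_pos s_neg) // chiA // expr1n divr1.
apply: capacity_le; first exact: (total_dimE s_pos s_neg sd).
exact: block_tuple_posdef.
Unshelve. all: by end_near. Qed.

Theorem capacity_extension V Z : extension V Z ->
  capacity s V = capacity s V1 * capacity s V2.
Proof.
move=> VE; apply/le_anti; rewrite (capacity_extension_ge VE) andbT.
(* The infimum over [Y1] is taken first, at fixed [Y2]; a vanishing ratio at [Y2] is treated apart,
   as it cannot be divided by. *)
have h Y2 : (forall j, posdef (Y2 j)) -> capacity s V <= capacity s V1 * gaussian_ratio s V2 Y2.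
  move=> Y2p; have := ratio_ge0 s V2 Y2p; rewrite le_eqVlt => /orP[/eqP r0|r0].
    have := capacity_extension_le VE (fun j => posdef1 _) Y2p.
    by rewrite -r0 !mulr0.
  rewrite -ler_pdivrMr //; apply: capacity_ge => // Y1 Y1p.
  by rewrite ler_pdivrMr //; exact: capacity_extension_le.
have [c0|c1] := eqVneq (capacity s V1) 0.
  by have := h _ (fun j => posdef1 _); rewrite c0 !mul0r.
have c0 : 0 < capacity s V1 by rewrite lt_def c1 capacity_ge0.
rewrite mulrC -ler_pdivrMr //; apply: capacity_ge => // Y2 Y2p.
by rewrite ler_pdivrMr // mulrC h.
Qed.
End BlockTriangular.

(** * Gaussian extremisers *)

Section Extremisers.
Context {R : realType} {n m : nat} {Q : bipartite_quiver n m}.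
Context (s : 'I_n + 'I_m -> int).
Context (s_pos : forall i, 0 < s (inl i)) (s_neg : forall j, s (inr j) < 0).
Context (d : 'I_n + 'I_m -> nat) (sd0 : pairing Q s d = 0).
Implicit Types (V W : rep R Q d) (A B : forall x : vertex Q, 'M[R]_(d x)).

Lemma geometrizingE V A : geometrizing s V A <-> GL A /\ geometric_rep s (act A V).
Proof. by split=> -[gA g]; split=> //; exact/geometricE. Qed.

Lemma geometrizing_polystable V A : geometrizing s V A -> polystable Q s V.
Proof.
move=> /geometrizingE[gA g].
exact: polystable_iso (isomorphic_sym (isomorphic_act V gA)) (geometric_polystable s_pos s_neg sd0 g).
Qed.

Lemma polystable_geometrizing V : polystable Q s V -> exists A, geometrizing s V A.
Proof.
by move=> /(polystable_geometric s_pos s_neg)[A gA g]; exists A; apply/geometrizingE.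
Qed.

(** By [ratio_act], the ratio at [A^T A] is [chi(A)^2] times the ratio of the geometric datum at the
    identity, which is 1. *)
Lemma geometrizing_extremiser V A (Y : forall j, 'M[R]_(d (inr j))) : geometrizing s V A ->
  (forall j, Y j = (A (inr j))^T *m A (inr j)) -> gaussian_extremiser s V Y.
Proof.
move=> /geometrizingE[gA g] YE; split=> [j|]; first by rewrite YE; exact/posdef_gram/gA.
rewrite (capacity_geometrizing s_pos s_neg sd0 gA g).
have := ratio_act s_pos s_neg V (fun=> 1%:M) gA; rewrite geometric_ratio1 //.
rewrite (_ : (fun j => _) = Y) => [/esym/divr1_eq -> //|].
by apply: functional_extensionality_dep => j; rewrite YE mulmx1.
Qed.

Lemma extremisable_polystable V : 0 < capacity s V ->
  gaussian_extremisable s V <-> polystable Q s V.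
Proof.
move=> D0; split=> [[Y /(extremiser_geometrizing s_pos s_neg sd0 D0)[A [gA _]]]|].
  exact: geometrizing_polystable gA.
by move=> /polystable_geometrizing[A gA]; exists (fun j => (A (inr j))^T *m A (inr j));
  exact: geometrizing_extremiser gA _.
Qed.

(* If [p] is an endomorphism, so is [B = 1 + p], for which [B^T B = 1 + 3 p]. *)
Lemma geometric_decomposable V (U : forall x : vertex Q, {vspace 'cV[R]_(d x)}) :
    geometric_rep s V -> is_subrep V U -> pairing Q s (subdim U) = 0 ->
    (forall B, GL B -> is_hom V V B ->
       exists c, forall j, (B (inr j))^T *m B (inr j) = c%:M) ->
  (forall x, \dim (U x) = 0)%N \/ (forall x, \dim (U x) = d x).
Proof.
move=> g hU sU scal.
have [p hp] : exists p : forall x : vertex Q, 'M[R]_(d x), forall x, orth_proj (U x) (p x).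
  by exists (fun x => sval (cid (orth_projP (U x)))) => x; exact: (svalP (cid _)).
have [_ /(_ sU) phom] := geometric_subrep s_pos s_neg g hU hp.
pose B (x : vertex Q) := 1%:M + p x.
have pp x : p x *m p x = p x by case: (hp x).
have gB : GL B.
  (* As [p] is idempotent, [1 - p / 2] is the inverse of [1 + p]. *)
  move=> x; have [] // := @mulmx1_unit _ _ (B x) (1%:M - 2^-1 *: p x).
  rewrite mulmxDl mul1mx mulmxBr mulmx1 -scalemxAr pp; move: (p x) => P.
  by apply/matrixP => k l; rewrite !mxE; move: (_ *+ _) (P k l) => u w; field.
have hB : is_hom V V B by move=> a; rewrite mulmxDl mulmxDr mul1mx mulmx1 phom.
have [c cE] := scal B gB hB.
have pE j : p (inr j) = ((c - 1) / 3)%:M.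
  have [ps _ _ _] := hp (inr j).
  have := cE j; rewrite /B trmxD trmx1 ps mulmxDl mul1mx mulmxDr mulmx1 pp.
  move=> h; have : 3 *: p (inr j) = (c - 1)%:M.
    by rewrite raddfB /= -h; apply/matrixP => k l; rewrite !mxE; ring.
  by move=> /(congr1 (fun M => 3^-1 *: M)); rewrite scalerA mulVf // scale1r => ->; rewrite scale_scalar_mx mulrC.
have tr0 x : \tr (p x) = (\dim (U x))%:R by case: (hp x).
have sum_eq : (\sum_i sigma_pos s i * \dim (U (inl i)) = \sum_j sigma_neg s j * \dim (U (inr j)))%N.
  by move: sU; rewrite (pairingE s_pos s_neg) => /subr0_eq[].
have dle x : (\dim (U x) <= d x)%N by have := dimvS (subvf (U x)); rewrite dimvf /dim /= muln1.
(* The projections at the sinks share one scalar, so they are all 0 or all the identity; the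
   vanishing weight carries either case over to the sources. *)
have [c1|c1] := eqVneq ((c - 1) / 3) 0; [left|right].
  have r0 j : \dim (U (inr j)) = 0%N.
    by apply/eqP; rewrite -(eqr_nat R) -tr0 pE c1 raddf0 mxtrace0.
  case=> [i|//]; move: sum_eq; rewrite [in RHS]big1 => [/eqP|j _]; last by rewrite r0 muln0.
  rewrite sum_nat_eq0 => /forallP/(_ i); rewrite /= muln_eq0 gtn_eqF ?sigma_pos_gt0 //.
  by move=> /eqP.
have r1 j : \dim (U (inr j)) = d (inr j).
  apply/eqP; rewrite -(eqr_nat R) -tr0 -(mxtrace1 R (d (inr j))); apply/eqP; congr (\tr _).
  by rewrite pE; apply: (scalerI c1); rewrite -mul_scalar_mx -pE pp scalemx1 pE.
case=> [i|//]; apply/eqP; rewrite eqn_leq dle /= leqNgt; apply/negP => lt.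
suff : (\sum_i sigma_pos s i * \dim (U (inl i)) < \sum_i sigma_pos s i * d (inl i))%N.
  rewrite sum_eq -total_col_dimE -(total_dimE s_pos s_neg sd0) total_row_dimE.
  by under [X in (X < _)%N]eq_bigr do rewrite r1; rewrite ltnn.
rewrite (bigD1 i) //= [X in (_ < X)%N](bigD1 i) //= -addSn leq_add //.
  by rewrite ltn_pmul2l ?sigma_pos_gt0.
by apply: leq_sum => k _; rewrite leq_mul.
Qed.

Lemma subrep_act V A (U : forall x : vertex Q, {vspace 'cV[R]_(d x)}) : GL A -> is_subrep V U ->
  exists U' : forall x : vertex Q, {vspace 'cV[R]_(d x)},
    is_subrep (act A V) U' /\ forall x, \dim (U' x) = \dim (U x).
Proof.
move=> gA hU; pose f x := linfun (mulmx (A x) : 'cV[R]_(d x) -> 'cV[R]_(d x)).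
have fE x u : f x u = A x *m u by rewrite lfunE.
exists (fun x => (f x @: U x)%VS); split=> [a v /memv_imgP[u uU ->]|x].
  have -> : act A V a *m f (tl a) u = f (hd a) (V a *m u).
    by rewrite !fE /act -!mulmxA mulKmx.
  by apply: memv_img; exact: hU.
apply: limg_dim_eq; apply/eqP; rewrite -subv0; apply/subvP => u.
rewrite memv_cap memv_ker memv0 => /andP[_]; rewrite fE => /eqP Au0.
by rewrite -[u](mulKmx (gA x)) Au0 mulmx0.
Qed.

Lemma unique_extremisers_stable V : 0 < capacity s V ->
  unique_gaussian_extremisers s V -> stable Q s V.
Proof.
move=> D0 [[Y exY] uniq]; split=> // U hU [x0 Ux0] [x1 Ux1].
have [A [/geometrizingE[gA g] YE]] := extremiser_geometrizing s_pos s_neg sd0 D0 exY.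
have [U' [hU' dimU']] := subrep_act gA hU.
have -> : pairing Q s (subdim U) = pairing Q s (subdim U').
  by congr pairing; apply/funext => x; rewrite /subdim dimU'.
have [_ /(_ _ hU')] := geometric_semistable s_pos s_neg sd0 g.
rewrite le_eqVlt => /orP[/eqP sU'|//].
have [|h|h] := geometric_decomposable g hU' sU'.
(* For an automorphism [B] of the geometric datum, [B A] geometrizes [V] as well; uniqueness
   compares [A^T B^T B A] with [A^T A] and makes [B^T B] scalar. *)
- move=> B gB hB; have gBA := GL_mul gB gA.
  have /uniq-/(_ _ exY)/= : gaussian_extremiser s V
      (fun j => (gl_mul B A (inr j))^T *m gl_mul B A (inr j)).
    apply: (@geometrizing_extremiser V (gl_mul B A)) => //; apply/geometrizingE; split=> //.
    by rewrite act_mul // -(act_is_hom gB hB).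
  move=> [c [c0 cE]]; exists c^-1 => j.
  have conjA N : (invmx (A (inr j)))^T *m ((A (inr j))^T *m N *m A (inr j)) *m
      invmx (A (inr j)) = N.
    by rewrite !mulmxA -trmx_mul mulmxV ?gA // trmx1 mul1mx mulmxK ?gA.
  have E : 1%:M = c *: ((B (inr j))^T *m B (inr j)).
    transitivity ((invmx (A (inr j)))^T *m Y j *m invmx (A (inr j))).
      by rewrite -[LHS]conjA mulmx1 YE.
    rewrite cE /gl_mul trmx_mul -scalemxAr -scalemxAl; congr (_ *: _).
    by rewrite -[RHS]conjA !mulmxA.
  by rewrite -scalemx1 E scalerA mulVf ?scale1r // gt_eqF.
- by move: Ux0; rewrite -dimv_eq0 -dimU' h.
- by move: Ux1; rewrite eqEdim subvf dimvf /dim /= muln1 -dimU' h leqnn.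
Qed.

(** A first extremiser makes [V] geometric. A second one, moved along, has ratio 1 there; together
    with its gram matrices it is an endomorphism, hence a scalar. *)
Lemma stable_unique_extremisers V : stable Q s V -> one_dim_End V -> 0 < capacity s V ->
  unique_gaussian_extremisers s V.
Proof.
move=> st [f0 [hf0 [x0 fx0] bas]] D0; split.
  have [A gA g] := stable_geometric s_pos s_neg st.
  exists (fun j => (A (inr j))^T *m A (inr j)).
  by apply: (@geometrizing_extremiser V A) => //; apply/geometrizingE.
move=> Y Y' exY [Y'p Y'D].
have [A [/geometrizingE[gA g] YE]] := extremiser_geometrizing s_pos s_neg sd0 D0 exY.
(* The identity is a multiple of the basis element, so every endomorphism is scalar. *)
have scal f : is_hom V V f -> exists c, forall x, f x = c%:M.
  move=> hf; have [c1 fE] := bas f hf.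
  have [c0 idE] : exists c, forall x, 1%:M = c *: f0 x.
    by apply: bas => a; rewrite mul1mx mulmx1.
  exists (c1 / c0) => x; rewrite fE -scalemx1 idE scalerA divfK //.
  by apply: contraNneq fx0 => c00; rewrite -[f0 x0]mul1mx idE c00 scale0r mul0mx.
pose Z j := (invmx (A (inr j)))^T *m Y' j *m invmx (A (inr j)).
have Zp j : posdef (Z j) by apply: posdef_conj; rewrite ?unitmx_inv ?gA.
have AZA j : (A (inr j))^T *m Z j *m A (inr j) = Y' j.
  by rewrite /Z !mulmxA -trmx_mul mulVmx ?gA // trmx1 mul1mx -mulmxA mulVmx ?gA // mulmx1.
have Z1 : gaussian_ratio s (act A V) Z = 1.
  rewrite (ratio_act s_pos s_neg) // (_ : (fun j => _) = Y'); last first.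
    by apply: functional_extensionality_dep => j; rewrite AZA.
  by rewrite -Y'D -(capacity_act s_pos s_neg) // (capacity_geometric s_pos s_neg sd0 g).
pose f (x : vertex Q) : 'M[R]_(d x) := match x with
  | inl i => gram s (act A V) Z i | inr j => Z j end.
have hf : is_hom (act A V) (act A V) f.
  by apply/is_hom_comp => i j a; exact: (geometric_ratio_eq1 s_pos s_neg g Zp Z1).
have [c cE] : exists c, forall x, invmx (A x) *m f x *m A x = c%:M.
  apply: scal => a; have := hf a; rewrite /act; move: (f (hd a)) (f (tl a)) => f1 f2 h.
  transitivity (invmx (A (hd a)) *m (f1 *m (A (hd a) *m V a *m invmx (A (tl a)))) *m A (tl a)).
    by rewrite !mulmxA mulmxKV ?gA.
  by rewrite h !mulmxA mulVmx ?gA // mul1mx.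
have ZE j : Z j = c%:M.
  have := cE (inr j) => /(congr1 (fun M => A (inr j) *m M *m invmx (A (inr j)))) /=.
  move: (Z j) => Zj.
  rewrite !mulmxA mulmxV ?gA // mul1mx mulmxK ?gA // => ->.
  by rewrite mul_mx_scalar -scalemxAl mulmxV ?gA // scalemx1.
have Y'E j : Y' j = c *: Y j.
  by rewrite -AZA ZE mul_mx_scalar -scalemxAl -YE.
(* Positivity of the scalar is read off a nonzero sink space; if there is none, the tuples consist
   of empty matrices and the scalar 1 serves. *)
have [[j dj]|none] := pselect (exists j, d (inr j) <> 0%N).
  exists c; split=> //; have [_] := Zp j; have dj0 : (0 < d (inr j))%N by rewrite lt0n; exact/eqP.
  move=> /(_ (delta_mx (Ordinal dj0) 0)); rewrite ZE mul_mx_scalar -scalemxAl mxE.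
  have d0 : delta_mx (Ordinal dj0) 0 != 0 :> 'cV[R]_(d (inr j)).
    by apply/eqP => /matrixP/(_ (Ordinal dj0) 0)/eqP; rewrite !mxE !eqxx oner_eq0.
  by move=> /(_ d0); rewrite pmulr_lgt0 // sqnorm_gt0.
exists 1; split=> // j; apply/matrixP => k; have := ltn_ord k.
by rewrite [X in (_ < X)%N](_ : _ = 0%N) //; apply: contrapT => dj; apply: none; exists j.
Qed.
End Extremisers.

Theorem theorem2 (R : realType) (n m : nat) (Q : bipartite_quiver n m)
    (Q_connected : quiver_connected Q)
    (d : 'I_n + 'I_m -> nat) (s : 'I_n + 'I_m -> int)
    (sd0 : pairing Q s d = 0)
    (s_pos : forall i : 'I_n, 0 < s (inl i))
    (s_neg : forall j : 'I_m, s (inr j) < 0) :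
  (* (1) *)
  (forall V : rep R Q d, semistable Q s V ->
     ((exists A, geometrizing s V A) <-> polystable Q s V)) /\
  (* (2) *)
  (forall V : rep R Q d, semistable Q s V ->
     (exists W : rep R Q d, polystable Q s W /\ in_orbit_closure Q s V W) /\
     (forall W : rep R Q d, polystable Q s W -> in_orbit_closure Q s V W ->
        capacity s V = capacity s W /\
        forall A, geometrizing s W A -> capacity s W = chi Q s A ^+ 2)) /\
  (* (3) *)
  (forall (d1 d2 : 'I_n + 'I_m -> nat) (dE : forall x, d x = (d1 x + d2 x)%N)
     (V : rep R Q d) (V1 : rep R Q d1) (V2 : rep R Q d2)
     (X : forall a : arrow Q, 'M[R]_(d1 (hd a), d2 (tl a))),
     (forall a : arrow Q, castmx (dE (hd a), dE (tl a)) (V a) =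
        block_mx (V1 a) (X a) 0 (V2 a)) ->
     pairing Q s d1 = 0 ->
     capacity s V = capacity s V1 * capacity s V2) /\
  (* (4) *)
  (forall V : rep R Q d, 0 < capacity s V ->
     (gaussian_extremisable s V <-> polystable Q s V) /\
     (gaussian_extremisable s V ->
        forall Y : forall j : 'I_m, 'M[R]_(d (inr j)),
          gaussian_extremiser s V Y <->
          exists A, geometrizing s V A /\
            forall j, Y j = (A (inr j))^T *m A (inr j))) /\
  (* (5) *)
  (forall V : rep R Q d, 0 < capacity s V ->
     (unique_gaussian_extremisers s V -> stable Q s V) /\
     (stable Q s V -> one_dim_End V -> unique_gaussian_extremisers s V)).
Proof.
split; [|split; [|split; [|split]]].
- move=> V _; split=> [[A gA]|]; first exact: (geometrizing_polystable s_pos s_neg sd0 gA).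
  exact: polystable_geometrizing.
- move=> V ss; split.
    have [F [A [W [B [UF gA AW gB geoB]]]]] := semistable_degeneration s_pos s_neg ss.
    exists W; split; last exact: (orbit_closure_limit gA AW).
    by apply: (geometrizing_polystable s_pos s_neg sd0 (A := B)); apply/geometrizingE.
  move=> W pW VW; split; first exact: capacity_orbit_closure.
  by move=> A /(geometrizingE s_pos s_neg)[gA g]; exact: capacity_geometrizing.
(* As an equality of functions, the dimension formula can be substituted, after which the cast in
   the hypothesis is trivial. *)
- move=> d1 d2 dE; have dE' : d = (fun x => d1 x + d2 x)%N by exact/funext.
  subst d => V V1 V2 X VE sd1.
  have sd2 : pairing Q s d2 = 0.
    apply: (addrI (pairing Q s d1)); rewrite [in RHS]sd1 addr0 -[RHS]sd0 /pairing -big_split.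
    by apply: eq_bigr => x _ /=; rewrite -mulrDr.
  apply: (capacity_extension s_pos s_neg sd1 sd2
    (Z := fun i j a => ursubmx (comp_mx V i j a))) => i j a.
  have [|na] := boolP (a \in arrows_between Q i j); last first.
    rewrite /comp_mx (negbTE na) (_ : ursubmx 0 = 0) ?block_mx0 //.
    by apply/matrixP => k l; rewrite !mxE.
  rewrite inE => /andP[/eqP <- /eqP <-]; rewrite !comp_mx_arrow.
  by have := VE a; rewrite castmx_id => ->; rewrite block_mxKur.
- move=> V D0; split; first exact: extremisable_polystable.
  move=> _ Y; split; first exact: extremiser_geometrizing.
  by move=> [A [gA YE]]; exact: (geometrizing_extremiser s_pos s_neg sd0 gA YE).
- move=> V D0; split; first exact: unique_extremisers_stable.
  by move=> st one; exact: stable_unique_extremisers.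
Qed.
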